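(* Let $I=(c,d)$ with $-\infty\le c<d\le\infty$. Let $v:I\to[-\infty,\infty]$ be Lebesgue measurable with $v>0$ $\mathcal{L}^1$-a.e. on $I$, $\pi(v)\in L^1_{\mathrm{loc}}([c,d))$, $\lim_{b\to d-}\int_c^b v=\infty$, and let $w(x)=\left[\int_c^x v\right]^{-1}\in(0,\infty)$ for all $x\in I$. Put $$X:=\{f\in AC(I)\,:\,\text{the limit } f(c+) \text{ exists, and there is } b\in I \text{ with } \chi_{(b,d)}f=0\}$$ and $$W^1_1(I):=\{\mathbf{f}\in L^1_{\mathrm{loc}}(I): D\mathbf{f}\in L^1_{\mathrm{loc}}(I),\ \|\mathbf{f}\|_{W^1_1(I)}<\infty\},\qquad \|\mathbf{f}\|_{W^1_1(I)}:=\|v\mathbf{f}\|_{L^1(I)}+\left\|\tfrac{1}{w}D\mathbf{f}\right\|_{L^1(I)}.$$ Then the following equalities of sets hold, with the indicated equivalences of norms on these sets: $$(W_1^1(I))'_{\mathrm{s}}=\mathrm{Cs}_{\infty,w}(I),\qquad \|\cdot\|_{(W_1^1(I))'_{\mathrm{s}}}\approx\|\cdot\|_{\mathrm{Cs}_{\infty,w}(I)};$$ $$(W_1^1(I))'_{\mathrm{w}}=\mathrm{Cs}_{\infty,w}(I),\qquad \|\cdot\|_{(W_1^1(I))'_{\mathrm{w}}}\approx\|\cdot\|_{\mathrm{Ch}_{\infty,w}(I)};$$ $$(\pi(X),\|\cdot\|_{W_1^1(I)})'_{\mathrm{w}}=\mathrm{Ch}_{\infty,w}(I),\qquad \|\c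dot\|_{(\pi(X),\|\cdot\|_{W_1^1(I)})'_{\mathrm{w}}}\approx\|\cdot\|_{\mathrm{Ch}_{\infty,w}(I)}.$$
   Context: $\mathcal{L}^1$ is Lebesgue measure on $I$; $\mathfrak{M}(I)$ is the set of all $\mathcal{L}^1$-measurable functions $f:I\to[-\infty,\infty]$; $L^0(I)$ is the set of classes of elements of $\mathfrak{M}(I)$ modulo equality $\mathcal{L}^1$-a.e.; classes are written in bold ($\mathbf{f},\mathbf{g}$), $\pi(f)$ denotes the class of $f\in\mathfrak{M}(I)$, and $\pi(X)=\{\pi(f):f\in X\}$. Products such as $v\mathbf{f}$ are classes of products of representatives. $L^1_{\mathrm{loc}}(I)$ is the set of $\mathbf{f}\in L^0(I)$ with $\|\chi_{(a,b)}\mathbf{f}\|_{L^1(I)}<\infty$ for all $a,b\in I$; $L^1_{\mathrm{loc}}([c,d))$ is the set of $\mathbf{f}\in L^0(I)$ with $\|\chi_{(c,x)}\mathbf{f}\|_{L^1(I)}<\infty$ for all $x\in I$. $D\mathbf{f}$ is the weak derivative. $AC(I)$ is the space of absolutely continuous functions $f:I\to\mathbb{R}$. $\mathrm{Cs}_{\infty,w}(I)$ is the set of $\mathbf{f}\in L^1_{\mathrm{loc}}([c,d))$ with $\|\mathbf{f}\|_{\mathrm{Cs}_{\infty,w}(I)}:=\operatorname{ess\,sup}_{x\in I}w(x)\int_c^x|f|<\infty$, and $\mathrm{Ch}_{\infty,w}(I)$ is the set of $\mathbf{f}\in L^1_{\mathrm{loc}}([c,d))$ with $\|\mathbf{f}\|_{\mathrm{Ch}_{\infty,w}(I)}:=\operatorname{ess\,sup}_{x\in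 I}\left|w(x)\int_c^x f\right|<\infty$, where $f\in\mathbf{f}$. For a normed space $(Z,\|\cdot\|)$ of elements of $L^0(I)$, the strong associated space is $$Z'_{\mathrm{s}}=(Z,\|\cdot\|)'_{\mathrm{s}}:=\Big\{\mathbf{g}\in L^0(I):\ \|\mathbf{g}\|_{Z'_{\mathrm{s}}}:=\sup_{\mathbf{h}\in Z\setminus\{0\}}\frac{\|\mathbf{h}\mathbf{g}\|_{L^1(I)}}{\|\mathbf{h}\|}<\infty\Big\},$$ and the weak associated space is $$Z'_{\mathrm{w}}=(Z,\|\cdot\|)'_{\mathrm{w}}:=\Big\{\mathbf{g}\in L^0(I):\ \mathbf{f}\mathbf{g}\in L^1(I)\ \forall\,\mathbf{f}\in Z,\ \text{ and }\ \|\mathbf{g}\|_{Z'_{\mathrm{w}}}:=\sup_{h\in\mathbf{h}\in Z\setminus\{0\}}\frac{\left|\int_I hg\right|}{\|\mathbf{h}\|}<\infty,\ g\in\mathbf{g}\Big\}.$$ $A\approx B$ means $c_1A\le B\le c_2A$ with constants $c_1,c_2>0$ that are absolute (independent of $I,v,w$ and of the element of the space). *)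

(* Defs.v *)
From HB Require Import structures.
From mathcomp Require Import all_boot all_order all_algebra.
From mathcomp Require Import all_classical all_reals all_analysis.
From mathcomp Require Import measurable_realfun ess_sup_inf.

Set Implicit Arguments.
Unset Strict Implicit.
Unset Printing Implicit Defensive.

Import Order.TTheory GRing.Theory Num.Theory.
Import numFieldNormedType.Exports.

Local Open Scope classical_set_scope.
Local Open Scope ring_scope.
Local Open Scope ereal_scope.

(* The real line with the Caratheodory (that is, Lebesgue) sigma-algebra;
   it is the domain of [completed_lebesgue_measure], and convertible to [R]. *)
Definition leb_line (R : realType) : measurableType _ :=
  caratheodory_type (@wlength R idfun)^*%mu.

Definition leb (R : realType) : {measure set (leb_line R) -> \bar R} :=
  @completed_lebesgue_measure R.

Definition leb_measurable (R : realType) (A : set R) (f : R -> \bar R) : Prop :=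
  measurable_fun (A : set (leb_line R)) (f : leb_line R -> \bar R).

Definition eitv (R : realType) (a b : \bar R) : set R :=
  [set x | a < x%:E /\ x%:E < b].

(* The filters x -> a+ and x -> b- for extended endpoints; only a < +oo and
   -oo < b are meaningful. *)
Definition ereal_at_right (R : realType) (a : \bar R) : set_system R :=
  if a is r%:E then r^'+ else ninfty_nbhs R.

Definition ereal_at_left (R : realType) (b : \bar R) : set_system R :=
  if b is r%:E then r^'- else pinfty_nbhs R.

Section L0.
Context {R : realType}.
Implicit Type I : set R.

(* Functions on I are represented by functions on R whose values off I are
   irrelevant. *)
Record Mfun I := MkMfun {
  Mfun_fun :> R -> \bar R ;
  Mfun_measurable : leb_measurable I Mfun_fun }.

HB.instance Definition _ I := gen_eqMixin (Mfun I).
HB.instance Definition _ I := gen_choiceMixin (Mfun I).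

Definition Mfun_eq I (f g : Mfun I) : bool :=
  `[< ae_eq (leb R) I (Mfun_fun f) (Mfun_fun g) >].

Lemma Mfun_eq_refl I : reflexive (@Mfun_eq I).
Proof. by move=> f; apply/asboolP/ae_eq_refl. Qed.

Lemma Mfun_eq_sym I : symmetric (@Mfun_eq I).
Proof. by move=> f g; apply/idP/idP => /asboolP h; apply/asboolP/ae_eq_sym. Qed.

Lemma Mfun_eq_trans I : transitive (@Mfun_eq I).
Proof.
by move=> f g h /asboolP gf /asboolP fh; apply/asboolP/(ae_eq_trans gf fh).
Qed.

Canonical Mfun_eq_equiv I := EquivRel (@Mfun_eq I)
  (@Mfun_eq_refl I) (@Mfun_eq_sym I) (@Mfun_eq_trans I).

Definition L0 I : Type := {eq_quot (@Mfun_eq I)}%qT.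
HB.instance Definition _ I := Choice.on (L0 I).
HB.instance Definition _ I := EqQuotient.on (L0 I).

(* A class is used as a function through its canonical representative. All
   notions below depend on the class only. *)
Definition L0_fun I (f : L0 I) : R -> \bar R := Mfun_fun (repr f).
Coercion L0_fun : L0 >-> Funclass.

Definition L0_mem I (F : L0 I) (f : R -> \bar R) : Prop :=
  ae_eq (leb R) I f (L0_fun F).

Definition Mfun_cst I (k : \bar R) : Mfun I :=
  MkMfun (measurable_cst (T1 := leb_line R) (D := I) k).

Definition L0_cst I (k : \bar R) : L0 I := (\pi_(L0 I) (Mfun_cst I k))%qT.

Definition L0_image I (X : set (R -> R)) : set (L0 I) :=
  [set F | exists2 f, X f & L0_mem F (EFin \o f)].

End L0.

Section spaces.
Context {R : realType}.
Implicit Types (I : set R) (c d : \bar R) (f g v w : R -> \bar R).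

Definition L1norm I f : \bar R := \int[leb R]_(x in I) `|f x|.

Definition L1loc I f : Prop :=
  forall a b : R, I a -> I b -> L1norm (eitv a%:E b%:E) f < +oo.

(* f in L^1_loc([c,d)): integrable up to the left endpoint. *)
Definition L1loc_left c d f : Prop :=
  forall x : R, eitv c d x -> L1norm (eitv c x%:E) f < +oo.

Definition test_function I (phi : R -> R) : Prop :=
  [/\ forall (n : nat) (x : R), derivable (phi^`(n))%classic x 1,
      compact (closure [set x | phi x != 0%R]) &
      closure [set x | phi x != 0%R] `<=` I].

Definition is_weak_derivative I f g : Prop :=
  [/\ L1loc I f, L1loc I g &
      forall phi, test_function I phi ->
        \int[leb R]_(x in I) (f x * (phi^`()%classic x)%:E) =
        - \int[leb R]_(x in I) (g x * (phi x)%:E)].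

(* The weak derivative is unique in L0 when it exists. Otherwise the value is
   the class of +oo, which is not in L1loc and makes W11norm infinite. *)
Definition weak_derivative I (f : L0 I) : L0 I :=
  xget (L0_cst I +oo) [set g : L0 I | is_weak_derivative I f g].

Definition W11norm I v w (f : L0 I) : \bar R :=
  L1norm I (fun x => v x * f x) +
  L1norm I (fun x => (w x)^-1 * weak_derivative f x).

Definition W11 I v w : set (L0 I) :=
  [set f : L0 I | [/\ L1loc I f, L1loc I (weak_derivative f) &
                      W11norm v w f < +oo]].

(* The functions whose essential supremum is taken are nonnegative, so that
   extending them by 0 off (c,d) does not change it. *)
Definition Cs_norm c d w f : \bar R :=
  ess_sup (leb R)
    ((fun x => w x * \int[leb R]_(t in eitv c x%:E) `|f t|) \_ (eitv c d)).

Definition Ch_norm c d w f : \bar R :=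
  ess_sup (leb R)
    ((fun x => `|w x * \int[leb R]_(t in eitv c x%:E) f t|) \_ (eitv c d)).

Definition Cs c d w : set (L0 (eitv c d)) :=
  [set f : L0 _ | L1loc_left c d f /\ Cs_norm c d w f < +oo].

Definition Ch c d w : set (L0 (eitv c d)) :=
  [set f : L0 _ | L1loc_left c d f /\ Ch_norm c d w f < +oo].

(* [N h] is expected to lie in ]0, +oo] for nonzero [h] in [Z]; the quotient is
   0 when [N h = +oo] and the numerator is finite. *)
Definition strong_assoc_norm I (Z : set (L0 I)) (N : L0 I -> \bar R)
    (g : L0 I) : \bar R :=
  ereal_sup [set L1norm I (fun x => h x * g x) / N h
            | h in Z `\ L0_cst I 0].

Definition strong_assoc I (Z : set (L0 I)) (N : L0 I -> \bar R) :
    set (L0 I) :=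
  [set g : L0 I | strong_assoc_norm Z N g < +oo].

Definition weak_assoc_norm I (Z : set (L0 I)) (N : L0 I -> \bar R)
    (g : L0 I) : \bar R :=
  ereal_sup [set `|\int[leb R]_(x in I) (h x * g x)| / N h
            | h in Z `\ L0_cst I 0].

Definition weak_assoc I (Z : set (L0 I)) (N : L0 I -> \bar R) :
    set (L0 I) :=
  [set g : L0 I |
    (forall f : L0 I, Z f -> L1norm I (fun x => f x * g x) < +oo) /\
    weak_assoc_norm Z N g < +oo].

Definition AC I (f : R -> R) : Prop :=
  forall e : R, (0 < e)%R -> exists2 delta : R, (0 < delta)%R &
    forall (n : nat) (a b : 'I_n -> R),
      (forall i, [/\ I (a i), I (b i) & (a i <= b i)%R]) ->
      trivIset [set: 'I_n] (fun i => [set` `]a i, b i[]) ->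
      (\sum_(i < n) (b i - a i) < delta)%R ->
      (\sum_(i < n) `|f (b i) - f (a i)| < e)%R.

Definition AC_vanishing c d : set (R -> R) :=
  [set f | [/\ AC (eitv c d) f,
      exists l : R, f x @[x --> ereal_at_right c] --> l &
      exists2 b : R, eitv c d b & forall x, eitv b%:E d x -> f x = 0%R]].

(* A ≈ B on the set S, with constants k1 and k2 *)
Definition equiv_norms (k1 k2 : R) (T : Type) (S : set T) (A B : T -> \bar R) :=
  forall g : T, S g -> k1%:E * A g <= B g /\ B g <= k2%:E * A g.

End spaces.

Arguments L0_image {R} I X.
Arguments W11norm {R} I v w f.
Arguments W11 {R} I v w.
Arguments Cs {R} c d w.
Arguments Ch {R} c d w.

(* Main.v *)
Require Import Defs.
From mathcomp Require Import all_boot all_order all_algebra.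
From mathcomp Require Import all_classical all_reals all_analysis.
From mathcomp Require Import measurable_realfun ess_sup_inf.
From mathcomp Require Import ring lra.

Set Implicit Arguments.
Unset Strict Implicit.
Unset Printing Implicit Defensive.

Import Order.TTheory GRing.Theory Num.Theory.
Import numFieldNormedType.Exports.

Local Open Scope classical_set_scope.
Local Open Scope ring_scope.
Local Open Scope ereal_scope.

(** Write [I = (c, d)] and [V x] for the integral of [v] over [(c, x)], so that
    [w = 1 / V]. Because [V] grows to infinity at [d], the space [W11 I v w] is
    a space of tails: if the norm of [f] is finite, then [f] and its weak
    derivative satisfy [f x = \int_x^d q] for almost every [x], with
    [q = - D f] and [\int V |q|] at most the norm of [f] (lemma [W11_repr]).
    Indeed [f x - \int_x^d q] is constant, and a nonzero constant would have
    infinite [v]-weighted integral. Conversely the tail [f] of a density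
    [q >= 0] with [\int V q] finite lies in the space, and by Tonelli both
    terms of its norm equal [\int V q] (lemma [tail_W11]).

    Interchanging the order of integration turns the pairing of such a tail
    with [g] into a pairing of the density with primitives of [g]:
    [\int f g = \int q(t) G(t) dt], with [G t = \int_c^t g], and
    [\int |f g| <= \int |q(t)| M(t) dt], with [M t = \int_c^t |g|], where
    equality holds for [q >= 0]. The bound [\int q m <= C \int V q] for all
    [q >= 0] amounts to [m <= C V] almost everywhere, and bounded densities
    supported inside [I] suffice to detect this (lemma [density_duality]). For
    [m = M] this says that the Cs norm of [g] is at most [C]; for [m = G] and
    [m = - G] together, that its Ch norm is at most [C]. Hence the three
    equivalences, with constants 1 and 2: the 2 is the ratio of the norm of a
    tail to [\int V q].

    Three points need more than this computation.

    - A member of the weak associated space of [W11 I v w] must lie in Cs and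
      not only in Ch: if [M <= 2^n V] fails for every [n], then scaled densities
      witnessing the failures add up to one density [q] with [\int V q] finite
      and [\int q M] infinite (lemma [gliding_hump]).
    - The tails of bounded densities supported inside [I] are absolutely
      continuous and vanish near [d], so the lower bounds hold already on
      the smaller space. The elements of that space are bounded and vanish near
      [d], so they are integrable against every [g] in Ch, but [\int |q| M]
      may be infinite because [M] need not be bounded by a multiple of [V] near
      [c]. The integral is therefore cut at a point [a] with [\int_c^a |g|]
      small before the order of integration is interchanged (lemma
      [vanishing_upper]).
    - That the weak derivative determines the increments of [f] is proved by
      testing against differences of smooth steps rising just to the right of
      two Lebesgue points (lemma [weak_derivative_increment]). *)

(** * Lebesgue measurable functions and their Borel representatives *)

Section lebesgue_line.
Context {R : realType}.
Local Notation mu := (leb R).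
Local Notation BR := (measurableTypeR R).
Local Notation LR := (leb_line R).

Lemma borel_measurable_leb (A : set R) :
  measurable (A : set BR) -> measurable (A : set LR).
Proof. exact: sub_caratheodory. Qed.

Lemma leb_borelE (A : set R) : mu A = (@lebesgue_measure R) A.
Proof. by []. Qed.

Lemma borel_fun_leb (D : set R) (f : R -> \bar R) : measurable (D : set BR) ->
  measurable_fun (D : set BR) f -> leb_measurable D f.
Proof. by move=> mD mf _ Y mY; apply: borel_measurable_leb; exact: mf. Qed.

Lemma leb_completion (A : set R) : measurable (A : set LR) ->
  exists B N : set R, [/\ measurable (B : set BR), measurable (N : set BR),
    (@lebesgue_measure R) N = 0 & forall x, ~ N x -> (A x <-> B x)].
Proof.
move=> mA.
have : (completed_algebra_gen (@lebesgue_measure R)).-sigma.-measurable A.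
  by rewrite completed_caratheodory_measurable.
rewrite g_sigma_completed_algebra_genE => -[B mB [N [M [mM M0 NM]]] BNA].
exists B, M; split => // x Mx; rewrite -BNA; split; last by left.
by case=> // /NM.
Qed.

(** The quantifier over a countable type is used over rational endpoints, to
    pass from statements on compactly included intervals to the whole
    interval. *)
Lemma ae_forall_countable d (T : measurableType d)
    (nu : {measure set T -> \bar R}) (I : countType) (P : I -> T -> Prop) :
  (forall i, {ae nu, forall x, P i x}) -> {ae nu, forall x, forall i, P i x}.
Proof.
move=> aP.
have : {ae nu, forall x, forall n i, unpickle n = Some i -> P i x}.
  apply: ae_foralln => n; case: (unpickle n) => [i|]; last exact: aeW.
  by apply: filterS (aP i) => x Px j [<-].
by apply: filterS => x Px i; apply: (Px (pickle i)); rewrite pickleK.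
Qed.

Lemma aeS d (T : measurableType d) (nu : {measure set T -> \bar R})
    (P Q : T -> Prop) :
  (forall x, P x -> Q x) -> {ae nu, forall x, P x} -> {ae nu, forall x, Q x}.
Proof.
move=> PQ; apply: filterS => //; exact: (ae_filter_ringOfSetsType nu).
Qed.

Lemma aeI d (T : measurableType d) (nu : {measure set T -> \bar R})
    (P Q : T -> Prop) :
  {ae nu, forall x, P x} -> {ae nu, forall x, Q x} ->
  {ae nu, forall x, P x /\ Q x}.
Proof.
move=> aP aQ; apply: filterI => //; exact: (ae_filter_ringOfSetsType nu).
Qed.

Lemma ae_leb (P : R -> Prop) :
  {ae @lebesgue_measure R, forall x, P x} -> {ae mu, forall x, P x}.
Proof. by move=> [A [mA A0 PA]]; exists A; split => //; exact: borel_measurable_leb. Qed.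

(** The differentiation theorem is about Borel functions. The superlevel sets
    of [f] at rational heights agree with Borel sets off one Borel null set
    [N]; resetting [f] to 0 on [N] makes all of its superlevel sets Borel. *)
Lemma borel_representative (f : R -> \bar R) : leb_measurable setT f ->
  exists2 g : R -> \bar R, measurable_fun (setT : set BR) g &
    {ae @lebesgue_measure R, forall x, f x = g x}.
Proof.
move=> mf.
(* [BN q] pairs a Borel version of the superlevel set with the null set off
   which they agree *)
have mfq (q : rat) : measurable ([set x | (ratr q)%:E < f x] : set LR).
  by rewrite -[X in measurable X]setTI; exact: emeasurable_fun_o_infty.
have /choice[BN BNP] : forall q : rat, exists BN : set R * set R,
    [/\ measurable (BN.1 : set BR), measurable (BN.2 : set BR),
        (@lebesgue_measure R) BN.2 = 0 &
        forall x, ~ BN.2 x -> ((ratr q)%:E < f x <-> BN.1 x)].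
  by move=> q; have [B [N ?]] := leb_completion (mfq q); exists (B, N).
pose N := \bigcup_q (BN q).2.
have mN : measurable (N : set BR).
  by apply: bigcupT_measurable_rat => q; have [] := BNP q.
pose g x := if x \in N then 0 else f x.
exists g.
  move=> mT; apply: (measurability _ (ErealGenOInfty.measurableE R)) => //.
  move=> /= _ [_ [y ->] <-]; rewrite setTI preimage_itvoy.
  rewrite [X in measurable X](_ : _ =
      (\bigcup_(q in [set q : rat | (y < ratr q)%R]) ((BN q).1 `\` N)) `|`
      (if (y < 0)%R then N else set0)).
    apply: measurableU; last by case: ifP.
    rewrite bigcup_mkcond; apply: bigcupT_measurable_rat => q.
    by case: ifP => // _; apply: measurableD => //; have [] := BNP q.
  apply/seteqP; split => x /=.
    rewrite /g; case: ifPn => [/set_mem Nx y0|/negP Nx yfx].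
      by right; rewrite -lte_fin y0.
    left.
    have [q yq qfx] : exists2 q : rat, (y < ratr q)%R & (ratr q)%:E < f x.
      case: (f x) yfx => [r| |].
      - rewrite lte_fin => /rat_in_itvoo[q]; rewrite in_itv/= => /andP[yq qr].
        by exists q => //; rewrite lte_fin.
      - have /rat_in_itvoo[q] : (y < y + 1)%R by rewrite ltrDl.
        by rewrite in_itv/= => /andP[yq _]; exists q => //; rewrite ltry.
      - by rewrite ltNge leNye.
    exists q => //; split; last by move=> /mem_set.
    have [_ _ _ /(_ x)[|h _]] := BNP q; last exact: h.
    by move=> Nqx; apply: Nx; apply/mem_set; exists q.
  case=> [[q /= yq [Bqx Nx]]|].
    rewrite /g; case: ifPn => [/set_mem//|_]; apply: (@lt_trans _ _ (ratr q)%:E); first by rewrite lte_fin.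
    have [_ _ _ /(_ x)[|_ h]] := BNP q; last exact: h.
    by move=> Nqx; apply: Nx; exists q.
  by case: ifPn => // y0 Nx; rewrite /g (mem_set Nx) lte_fin.
have : {ae @lebesgue_measure R, forall x, forall q, ~ (BN q).2 x}.
  apply: ae_forall_countable => q; have [_ mNq Nq0 _] := BNP q.
  by exists (BN q).2; split => // x /= /contrapT.
apply: aeS => x Nx; rewrite /g; case: ifPn => // /set_mem[q _].
by move=> /Nx.
Qed.

(** Both measures have the same values on Borel sets, so the identity map
    pushes one forward to the other. *)
Lemma ge0_integral_leb (D : set R) (f : R -> \bar R) :
  measurable (D : set BR) -> measurable_fun (D : set BR) f ->
  (forall x, D x -> 0 <= f x) ->
  \int[mu]_(x in D) f x = \int[@lebesgue_measure R]_(x in D) f x.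
Proof.
move=> mD mf f0.
have mid : measurable_fun (setT : set LR) (idfun : LR -> BR).
  by move=> _ Y mY; rewrite setTI; exact: borel_measurable_leb.
transitivity (\int[pushforward mu (idfun : LR -> BR)]_(y in D) f y).
  rewrite ge0_integral_pushforward//.
  by move=> x /set_mem; exact: f0.
by apply: eq_measure_integral => A mA _.
Qed.

Lemma eitv_fin (a b : R) : eitv a%:E b%:E = `]a, b[%classic.
Proof.
by apply/seteqP; split => x; rewrite /eitv/= in_itv/= !lte_fin => /andP.
Qed.

Lemma borel_measurable_eitv (c d : \bar R) : measurable (eitv c d : set BR).
Proof.
rewrite (_ : eitv c d = EFin @^-1` `]c, d[%classic).
  by rewrite -[X in measurable X]setTI; apply: EFin_measurable => //; exact: emeasurable_itv.
by apply/seteqP; split => x; rewrite /eitv/= in_itv/= => /andP.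
Qed.

Lemma leb_eitv (a b : R) : (a <= b)%R -> mu (eitv a%:E b%:E) = (b - a)%:E.
Proof.
move=> ab; rewrite leb_borelE eitv_fin lebesgue_measure_itv/= lte_fin.
by case: ltgtP ab => // ->; rewrite subrr.
Qed.

End lebesgue_line.

(** * Measurability and integration over the completed line *)

Section lebesgue_calculus.
Context {R : realType}.
Local Notation mu := (leb R).
Local Notation LR := (leb_line R).
Implicit Types (A B D E : set R) (f g : R -> \bar R).

(** The plain type [R] carries the Borel sigma-algebra, so this and the
    notions below fix the completed line once for all. *)
Definition leb_set A : Prop := measurable (A : set LR).

Lemma leb_set_eitv (c d : \bar R) : leb_set (eitv c d).
Proof. apply: borel_measurable_leb; exact: borel_measurable_eitv. Qed.

Lemma leb_setT : leb_set setT.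
Proof. exact: (@measurableT _ LR). Qed.

Lemma leb_measurable_abse D f :
  leb_measurable D f -> leb_measurable D (fun x => `|f x|).
Proof. exact: (@measurableT_comp _ _ _ LR _ _ abse). Qed.

Lemma leb_measurable_cst D k : leb_measurable D (fun=> k).
Proof. exact: (@measurable_cst _ _ LR). Qed.

Lemma leb_measurableN D f :
  leb_measurable D f -> leb_measurable D (fun x => - f x).
Proof. exact: (@measurableT_comp _ _ _ LR _ _ oppe). Qed.

Lemma leb_measurableD D f g : leb_measurable D f -> leb_measurable D g ->
  leb_measurable D (fun x => f x + g x).
Proof. exact: (@emeasurable_funD _ LR). Qed.

Lemma leb_measurableB D f g : leb_measurable D f -> leb_measurable D g ->
  leb_measurable D (fun x => f x - g x).
Proof. exact: (@emeasurable_funB _ LR). Qed.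

Lemma leb_measurableM D f g : leb_measurable D f -> leb_measurable D g ->
  leb_measurable D (fun x => f x * g x).
Proof. exact: (@emeasurable_funM _ LR). Qed.

Lemma leb_measurableS E D f : leb_set E -> D `<=` E -> leb_measurable E f ->
  leb_measurable D f.
Proof. exact: (@measurable_funS _ _ LR). Qed.

Lemma leb_measurable_patch D f : leb_set D ->
  leb_measurable D f -> leb_measurable setT (f \_ D).
Proof. by move=> mD; move/(@measurable_restrictT _ _ LR _ D f mD). Qed.

Lemma leb_integral_ge0 D f :
  (forall x, D x -> 0 <= f x) -> 0 <= \int[mu]_(x in D) f x.
Proof. exact: (@integral_ge0 _ LR). Qed.

Lemma leb_integral_abse_ge0 D f : 0 <= \int[mu]_(x in D) `|f x|.
Proof. by apply: leb_integral_ge0 => x _. Qed.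

Lemma eq_leb_integral D f g :
  (forall x, D x -> f x = g x) -> \int[mu]_(x in D) f x = \int[mu]_(x in D) g x.
Proof. by move=> fg; apply: (@eq_integral _ LR) => x /set_mem; exact: fg. Qed.

Lemma leb_integral_patch D f : \int[mu]_(x in D) f x = \int[mu]_x (f \_ D) x.
Proof. exact: (@integral_mkcond _ LR). Qed.

Lemma ge0_le_leb_integral D f g : leb_set D ->
  (forall x, D x -> 0 <= f x) -> leb_measurable D f -> leb_measurable D g ->
  (forall x, D x -> f x <= g x) ->
  \int[mu]_(x in D) f x <= \int[mu]_(x in D) g x.
Proof. move=> mD f0 mf mg fg; exact: (@ge0_le_integral _ LR _ mu D mD f g f0 mf mg fg). Qed.

Lemma ae_ge0_le_leb_integral D f g : leb_set D ->
  (forall x, D x -> 0 <= f x) -> leb_measurable D f ->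
  (forall x, D x -> 0 <= g x) -> leb_measurable D g ->
  {ae mu, forall x, D x -> f x <= g x} ->
  \int[mu]_(x in D) f x <= \int[mu]_(x in D) g x.
Proof.
move=> mD f0 mf g0 mg; exact: (@ae_ge0_le_integral _ LR R mu D mD f g).
Qed.

Lemma ae_eq_leb_integral D f g : leb_set D ->
  leb_measurable D f -> leb_measurable D g ->
  {ae mu, forall x, D x -> f x = g x} ->
  \int[mu]_(x in D) f x = \int[mu]_(x in D) g x.
Proof. exact: (@ae_eq_integral _ LR R mu D g f). Qed.

Lemma ge0_subset_leb_integral A B f : leb_set A -> leb_set B ->
  leb_measurable B f -> (forall x, B x -> 0 <= f x) -> A `<=` B ->
  \int[mu]_(x in A) f x <= \int[mu]_(x in B) f x.
Proof. by move=> mA mB; exact: (@ge0_subset_integral _ LR R mu A B mA mB f). Qed.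

Lemma ge0_leb_integralZl D f k : leb_set D -> leb_measurable D f ->
  (forall x, D x -> 0 <= f x) -> 0 <= k ->
  \int[mu]_(x in D) (k * f x) = k * \int[mu]_(x in D) f x.
Proof. by move=> mD mf; exact: (@ge0_integralZl _ LR R mu D mD f mf k). Qed.

Lemma ge0_leb_integralD D f g : leb_set D ->
  (forall x, D x -> 0 <= f x) -> leb_measurable D f ->
  (forall x, D x -> 0 <= g x) -> leb_measurable D g ->
  \int[mu]_(x in D) (f x + g x) = \int[mu]_(x in D) f x + \int[mu]_(x in D) g x.
Proof. by move=> mD; exact: (@ge0_integralD _ LR R mu D mD f g). Qed.

Definition leb_integrable D f : Prop := mu.-integrable (D : set LR) f.

Lemma leb_integrableP D f : leb_integrable D f <->
  leb_measurable D f /\ \int[mu]_(x in D) `|f x| < +oo.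
Proof.
by split => [/(@integrableP _ LR R mu D f)|h]; last exact/(@integrableP _ LR R mu D f).
Qed.

Lemma leb_integrable_measurable D f : leb_integrable D f -> leb_measurable D f.
Proof. by move/leb_integrableP => []. Qed.

Lemma leb_integrableS E D f : leb_set E -> leb_set D -> D `<=` E ->
  leb_integrable E f -> leb_integrable D f.
Proof. exact: (@integrableS _ LR R mu E D f). Qed.

Lemma leb_integrable_patch D f : leb_set D ->
  leb_integrable D f <-> leb_integrable setT (f \_ D).
Proof. exact: (@integrable_mkcond _ LR R mu D f). Qed.

Lemma leb_integrable_ae D f : leb_set D -> leb_integrable D f ->
  {ae mu, forall x, D x -> f x \is a fin_num}.
Proof. by move=> mD; exact: (@integrable_ae _ LR R mu D mD f). Qed.

Lemma leb_integrable_fin_num D f : leb_set D -> leb_integrable D f ->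
  \int[mu]_(x in D) f x \is a fin_num.
Proof. by move=> mD; exact: (@integrable_fin_num _ LR R mu D mD f). Qed.

Lemma le_leb_integrable D f g : leb_set D -> leb_measurable D f ->
  (forall x, D x -> `|f x| <= `|g x|) -> leb_integrable D g -> leb_integrable D f.
Proof. by move=> mD; exact: (@le_integrable _ LR R mu D mD f g). Qed.

Lemma leb_integrableZl D f (k : R) : leb_set D -> leb_integrable D f ->
  leb_integrable D (fun x => k%:E * f x).
Proof. by move=> mD; exact: (@integrableZl _ LR R mu D mD k f). Qed.

Lemma leb_integrableN D f : leb_integrable D f ->
  leb_integrable D (fun x => - f x).
Proof. exact: (@integrableN _ LR R mu D f). Qed.

Lemma leb_integrable_abse D f : leb_integrable D f ->
  leb_integrable D (fun x => `|f x|).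
Proof. exact: (@integrable_abse _ LR R mu D f). Qed.

Lemma leb_integralD D f g : leb_set D -> leb_integrable D f ->
  leb_integrable D g ->
  \int[mu]_(x in D) (f x + g x) = \int[mu]_(x in D) f x + \int[mu]_(x in D) g x.
Proof. by move=> mD; exact: (@integralD _ LR R mu D mD f g). Qed.

Lemma leb_integralB D f g : leb_set D -> leb_integrable D f ->
  leb_integrable D g ->
  \int[mu]_(x in D) (f x - g x) = \int[mu]_(x in D) f x - \int[mu]_(x in D) g x.
Proof. by move=> mD; exact: (@integralB _ LR R mu D mD f g). Qed.

Lemma leb_integralN D f : leb_set D -> leb_integrable D f ->
  \int[mu]_(x in D) - f x = - \int[mu]_(x in D) f x.
Proof.
move=> mD fi; apply: (@integralN _ LR R mu D f).
exact: (@integrable_add_def _ LR R mu D mD f).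
Qed.

Lemma leb_integralZl D f (k : R) : leb_set D -> leb_integrable D f ->
  \int[mu]_(x in D) (k%:E * f x) = k%:E * \int[mu]_(x in D) f x.
Proof. by move=> mD fi; exact: (@integralZl _ LR R mu D mD f fi k). Qed.

Lemma le_abse_leb_integral D f : leb_set D -> leb_measurable D f ->
  `|\int[mu]_(x in D) f x| <= \int[mu]_(x in D) `|f x|.
Proof. by move=> mD; exact: (@le_abse_integral _ LR R mu D f mD). Qed.

Lemma leb_integral_cst D k : leb_set D -> \int[mu]_(x in D) k = k * mu D.
Proof. by move=> mD; exact: (@integral_cst _ LR R mu D mD k). Qed.

End lebesgue_calculus.

(** * One-sided Lebesgue points *)

Section lebesgue_points.
Context {R : realType}.
Local Notation mu := (leb R).
Local Notation BR := (measurableTypeR R).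

(** Only intervals to the right of [x] are averaged, because the bumps used
    below are supported there. Finiteness of [f x] is included because [f]
    may be infinite on a null set. *)
Definition right_lebesgue_pt (f : R -> \bar R) (x : R) : Prop :=
  f x \is a fin_num /\
  forall e : R, (0 < e)%R -> exists2 delta : R, (0 < delta)%R &
    forall r : R, (0 < r < delta)%R ->
      \int[mu]_(t in eitv x%:E (x + r)%:E) `|f t - f x| <= (e * r)%:E.

Lemma integrable_right_lebesgue_pt (f : R -> \bar R) :
  leb_integrable setT f -> {ae mu, forall x, right_lebesgue_pt f x}.
Proof.
move=> intf.
have mf : leb_measurable setT f by exact: leb_integrable_measurable.
have [g0 mg0 /ae_leb fg0] := borel_representative mf.
pose g := fine \o g0.
have fg : {ae mu, forall x, f x = (g x)%:E}.
  apply: aeS (aeI fg0 (leb_integrable_ae leb_setT intf)) => x /= [fgx fx].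
  by rewrite /g/= -fgx fineK//; exact: fx.
have mg : measurable_fun (setT : set BR) g.
  exact: measurableT_comp.
have intg : (@lebesgue_measure R).-integrable (setT : set BR) (EFin \o g).
  apply/integrableP; split; first exact/measurable_EFinP.
  have /leb_integrableP[_] := intf; apply: le_lt_trans.
  have mge : measurable_fun (setT : set BR) (fun x => `|(g x)%:E|).
    by apply: measurableT_comp => //; exact/measurable_EFinP.
  rewrite -ge0_integral_leb//.
  rewrite le_eqVlt; apply/orP; left; apply/eqP.
  apply: ae_eq_leb_integral.
  - exact: leb_setT.
  - exact: borel_fun_leb.
  - exact: leb_measurable_abse.
  - by apply: aeS fg => x /= -> _.
have := lebesgue_differentiation (open_integrable_locally openT intg).
move=> /ae_leb lg; apply: aeS (aeI fg lg) => x [fgx lgx]; split.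
  by rewrite fgx.
move=> e e0.
have e20 : (0 < e / 2)%R by rewrite divr_gt0.
have : \forall r \near (0:R)^'+, davg g x r < (e / 2)%:E.
  apply: (lgx [set y | y < (e / 2)%:E]); apply: open_nbhs_nbhs; split.
    exact: open_ereal_lt_ereal.
  by rewrite /= lte_fin.
move=> [d /= d0 Hd]; exists d => // r /andP[r0 rd].
have {}Hd : davg g x r < (e / 2)%:E.
  by apply: Hd => //=; rewrite sub0r normrN gtr0_norm.
have mdist : measurable_fun (setT : set BR) (fun t => `|(g t - g x)%:E|).
  apply: measurableT_comp => //; apply/measurable_EFinP.
  exact: measurable_funB.
have -> : \int[mu]_(t in eitv x%:E (x + r)%:E) `|f t - f x| =
    \int[mu]_(t in eitv x%:E (x + r)%:E) `|(g t - g x)%:E|.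
  apply: ae_eq_leb_integral.
  - exact: leb_set_eitv.
  - apply: leb_measurable_abse; apply: leb_measurableB.
      by apply: leb_measurableS mf => //; exact: leb_setT.
    exact: leb_measurable_cst.
  - apply: borel_fun_leb; first exact: borel_measurable_eitv.
    exact: measurable_funS mdist.
  - by apply: aeS fg => y fy _; rewrite fgx fy.
rewrite ge0_integral_leb//; first last.
- exact: measurable_funS mdist.
- exact: borel_measurable_eitv.
apply: (@le_trans _ _ (\int[@lebesgue_measure R]_(t in ball x r) `|(g t - g x)%:E|)).
  apply: ge0_subset_integral => //.
  - exact: borel_measurable_eitv.
  - exact: measurable_ball.
  - exact: measurable_funS mdist.
  - rewrite eitv_fin => y; rewrite /= in_itv/= => /andP[xy yxr].
    rewrite /ball/= ltr_distlC; apply/andP; split => //.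
    by rewrite (lt_trans _ xy)// ltrBlDr ltrDl.
move: Hd; rewrite /davg /iavg (lebesgue_measure_ball _ (ltW r0)) => Hd.
have r20 : (0 < r *+ 2)%R by rewrite mulrn_wgt0.
move: Hd; rewrite inver gt_eqF// lte_pdivrMl// => /ltW.
move/le_trans; apply; rewrite -EFinM lee_fin.
by rewrite -mulr_natr; lra.
Qed.

Lemma rat_between_eitv (c d : \bar R) x : eitv c d x ->
  exists p q : rat, [/\ eitv c d (ratr p), eitv c d (ratr q),
                        (ratr p < x)%R & (x < ratr q)%R].
Proof.
move=> [cx xd].
have [p cp px] : exists2 p : rat, c < (ratr p)%:E & (ratr p < x)%R.
  case: c cx => [r| |].
  - rewrite lte_fin => /rat_in_itvoo[q]; rewrite in_itv/= => /andP[rq qx].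
    by exists q => //; rewrite lte_fin.
  - by rewrite ltNge leey.
  - have /rat_in_itvoo[q] : (x - 1 < x)%R by rewrite ltrBlDr ltrDl.
    by rewrite in_itv/= => /andP[_ qx]; exists q => //; rewrite ltNyr.
have [q qd xq] : exists2 q : rat, (ratr q)%:E < d & (x < ratr q)%R.
  case: d xd => [r| |].
  - rewrite lte_fin => /rat_in_itvoo[q]; rewrite in_itv/= => /andP[xq qr].
    by exists q => //; rewrite lte_fin.
  - have /rat_in_itvoo[q] : (x < x + 1)%R by rewrite ltrDl.
    by rewrite in_itv/= => /andP[qx _]; exists q => //; rewrite ltry.
  - by rewrite ltNge leNye.
exists p, q; split => //; split => //=.
- by apply: lt_trans xd; rewrite lte_fin.
- by apply: (lt_trans cx); rewrite lte_fin.
Qed.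

Lemma eitvS (a b c d : \bar R) : c <= a -> b <= d -> eitv a b `<=` eitv c d.
Proof.
by move=> ca bd x [ax xb]; split; [exact: le_lt_trans ax|exact: lt_le_trans bd].
Qed.

(** The notion is local, so it may be checked on the countably many intervals
    with rational endpoints. *)
Lemma L1loc_right_lebesgue_pt (c d : \bar R) f :
  leb_measurable (eitv c d) f -> L1loc (eitv c d) f ->
  {ae mu, forall x, eitv c d x -> right_lebesgue_pt f x}.
Proof.
move=> mf f1.
have : {ae mu, forall x, forall pq : rat * rat, eitv c d (ratr pq.1) ->
    eitv c d (ratr pq.2) -> (ratr pq.1 < x)%R -> (x < ratr pq.2)%R ->
    right_lebesgue_pt f x}.
  apply: ae_forall_countable => -[p q] /=.
  have [[cp pd]|] := pselect (eitv c d (ratr p)); last by move=> ?; apply: aeW.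
  have [[cq qd]|] := pselect (eitv c d (ratr q)); last by move=> ?; apply: aeW.
  pose J : set R := eitv (ratr p)%:E (ratr q)%:E.
  have JI : J `<=` eitv c d by apply: eitvS; exact: ltW.
  have : leb_integrable setT (f \_ J).
    apply: (iffLR (leb_integrable_patch f (leb_set_eitv _ _))).
    apply/leb_integrableP; split; last exact: f1.
    by apply: (leb_measurableS _ JI mf); exact: leb_set_eitv.
  move=> /integrable_right_lebesgue_pt; apply: aeS => x [fx Hx] _ _ px xq.
  have Jx : J x by split; rewrite lte_fin.
  have fJ t : J t -> (f \_ J) t = f t by move=> Jt; rewrite patchE mem_set.
  split; first by rewrite -fJ.
  move=> e /Hx[d0 d00 Hd]; exists (Num.min d0 (ratr q - x)%R).
    by rewrite lt_min d00 subr_gt0.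
  move=> r; rewrite lt_min => /and3P[r0 rd0 rq].
  apply: le_trans (Hd r _); last by rewrite r0.
  rewrite le_eqVlt; apply/orP; left; apply/eqP.
  apply: eq_leb_integral => t [xt tr]; rewrite !fJ//; split; rewrite lte_fin.
    by apply: (lt_trans px); rewrite -lte_fin.
  move: tr; rewrite lte_fin => /lt_trans; apply; lra.
apply: aeS => x Px /rat_between_eitv[p [q [Ip Iq px xq]]].
exact: (Px (p, q)).
Qed.

End lebesgue_points.

(** * Smooth bumps and steps *)

Section flat_functions.
Context {R : realType}.
Local Open Scope ring_scope.
Implicit Types (p q : {poly R}) (x y : R).

(** The function [p q^-k exp (-1/q)] extended by 0 where [q <= 0]. With
    [p], [q] and [k] as parameters this family is stable under derivation,
    which is how smoothness is obtained. *)
Definition flat q p k x : R :=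
  if 0 < q.[x] then p.[x] * (q.[x])^-1 ^+ k * expR (- (q.[x])^-1) else 0.

(** [y^n / n!] is one term of the series of [expR y]. *)
Lemma exprM_expRN_le y n : 0 < y -> y ^+ n * expR (- y) <= n`!%:R + 1.
Proof.
move=> y0; rewrite expRN ler_pdivrMr ?expR_gt0//.
case: n => [|n].
  rewrite expr0 (le_trans _ (ler_peMl _ _)) ?ler1n ?expR_ge0//.
    by rewrite ltW// expR_gt1.
  by rewrite lerDr ler0n.
have := expR_ge1Dxn n (ltW y0).
have f0 : 0 < n.+1`!%:R :> R by rewrite ltr0n fact_gt0.
have e0 := expR_ge0 y.
have : y ^+ n.+1 / n.+1`!%:R <= expR y -> y ^+ n.+1 <= n.+1`!%:R * expR y.
  by rewrite ler_pdivrMr// mulrC.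
nra.
Qed.

(** Two more factors of [1/q] are absorbed by the exponential, at the price of
    the factor [q^2]: this makes the function vanish to second order where [q]
    does. *)
Lemma flat_le q p k x :
  `|flat q p k x| <= (k.+2`!%:R + 1) * `|p.[x]| * Num.max 0 q.[x] ^+ 2.
Proof.
rewrite /flat; case: ltP => q0; last by rewrite normr0 expr2 !mulr0.
have y0 : 0 < (q.[x])^-1 by rewrite invr_gt0.
have /(ler_wpM2l (normr_ge0 p.[x])) := exprM_expRN_le k.+2 y0.
rewrite normrM normrM (ger0_norm (expR_ge0 _)) (ger0_norm (exprn_ge0 k (ltW y0))).
have -> : (q.[x])^-1 ^+ k.+2 = (q.[x])^-1 ^+ k * (q.[x])^-1 ^+ 2.
  by rewrite -exprD addn2.
move=> /(ler_wpM2r (exprn_ge0 2 (ltW q0))).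
set e := expR _; set m := (_ ^+ k); set P := `|_|.
have -> : P * (m * q.[x]^-1 ^+ 2 * e) * q.[x] ^+ 2 = P * m * e.
  by field; rewrite gt_eqF.
by rewrite [(_ + 1) * P]mulrC.
Qed.

(** Where [q] is positive this is a computation. Elsewhere the slopes are
    dominated by a polynomial vanishing at [x], by [flat_le], so the
    derivative is 0. *)
Lemma is_derive_flat q p k x :
  is_derive x 1 (flat q p k)
    (flat q (p^`()%R * q ^+ 2 - k%:R *: (p * q^`()%R * q) + p * q^`()%R) k.+2 x).
Proof.
have [q0|q0] := ltP 0 q.[x].
  pose y := fun z : R => (q.[z])^-1.
  have dy : is_derive x 1 y (- q.[x] ^- 2 *: (q^`()%R).[x]).
    by apply: is_deriveV; rewrite gt_eqF.
  apply: (@near_eq_is_derive _ _ _ (horner p * y ^+ k * (expR \o (- y)))).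
    near=> z.
    have qz : 0 < q.[z].
      by near: z; apply: (cvgr_gt q.[x]) => //; exact: continuous_horner.
    by rewrite /flat qz /= !fctE.
  apply: is_derive_eq.
  rewrite /flat q0.
  have yx : y x = (q.[x])^-1 by [].
  have qn0 : q.[x] != 0 by rewrite gt_eqF.
  transitivity (p.[x] * q.[x]^-1 ^+ k * (expR (- q.[x]^-1) *
      - (- q.[x] ^- 2 * q^`().[x])) + expR (- q.[x]^-1) *
      (p.[x] * (k%:R * q.[x]^-1 ^+ k.-1 * (- q.[x] ^- 2 * q^`().[x])) +
      q.[x]^-1 ^+ k * p^`().[x])).
    by rewrite !fctE.
  rewrite (exprS _ k.+1) (exprS _ k) !(hornerD, hornerN, hornerM, hornerZ, horner_exp); set e := expR _; clearbody e.
  case: k => [|k]; first by rewrite !expr0 mulr0n; field.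
  rewrite [k.+1.-1]/= !(exprS _ k); set m := _ ^+ k; clearbody m.
  by field.
pose g z : R := if z == x then 0 else flat q p k z / (z - x).
(* from here on [q.[x] <= 0]: the slope is shown continuous at [x] *)
have fx0 : flat q p k x = 0 by rewrite /flat ltNge q0.
rewrite {2}/flat ltNge q0/=; apply/is_derive1_caratheodory; exists g; split.
- move=> z; rewrite /g fx0 subr0; case: eqVneq => [->|zx].
    by rewrite fx0 mul0r.
  by rewrite divfK// subr_eq0.
- have /factor_theorem[q1 q1E] : root (q - q.[x]%:P) x.
    by rewrite /root !hornerE subrr.
  (* [q <= q1 * (X - x)] since [q.[x] <= 0], so [q^2] divided by [X - x] still
     vanishes at [x] *)
  pose P := (k.+2`!%:R + 1) *: (p * q1 ^+ 2 * ('X - x%:P)).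
  have gP z : `|g z| <= `|P.[z]|.
    rewrite /g; case: eqVneq => [->|zx]; first by rewrite normr0.
    have zx0 : 0 < `|z - x| by rewrite normr_gt0 subr_eq0.
    rewrite normrM normfV ler_pdivrMr// (le_trans (flat_le q p k z))//.
    have q1z : q.[z] - q.[x] = q1.[z] * (z - x).
      by have := congr1 (horner^~ z) q1E; rewrite /= !(hornerD, hornerN, hornerC, hornerM, hornerX).
    rewrite /P !(hornerM, hornerZ, horner_exp, hornerXsubC) !normrM ?normrX.
    rewrite (@ger0_norm _ (k.+2`!%:R + 1)) ?addr_ge0 ?ler0n ?ler01//.
    have : Num.max 0 q.[z] <= `|q1.[z]| * `|z - x|.
      rewrite -normrM -q1z ge_max normr_ge0/= (le_trans _ (ler_norm _))//.
      by rewrite lerBrDr gerDl.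
    have : 0 <= Num.max 0 q.[z] by rewrite le_max lexx.
    set m := Num.max _ _; set a := `|q1.[z]|; set b := `|z - x| => m0 mab.
    have m2 : m ^+ 2 <= (a * b) ^+ 2 by rewrite ler_sqr ?nnegrE// mulr_ge0 ?normr_ge0.
    have c0 : 0 <= (k.+2`!%:R + 1) * `|p.[z]| by rewrite mulr_ge0 ?normr_ge0 ?addr_ge0 ?ler0n ?ler01.
    apply: le_trans (ler_wpM2l c0 m2) _; rewrite le_eqVlt; apply/orP; left.
    by apply/eqP; ring.
  have Px : P.[x] = 0 by rewrite /P !(hornerM, hornerZ, hornerXsubC) subrr !mulr0.
  have /cvgr0Pnorm_lt Pc : horner P z @[z --> x] --> (0 : R).
    by rewrite -[X in _ --> X]Px; exact: continuous_horner.
  have gx : g x = 0 by rewrite /g eqxx.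
  rewrite /prop_for /continuous_at gx; apply/cvgr0Pnorm_lt => e e0.
  near=> z; apply: le_lt_trans (gP z) _.
  near: z; exact: Pc.
- by rewrite /g eqxx.
Unshelve. all: by end_near. Qed.

End flat_functions.

Section smooth_steps.
Context {R : realType}.
Local Notation BR := (measurableTypeR R).
Local Open Scope ring_scope.
Implicit Types (f g : R -> R).

Definition smooth f : Prop :=
  forall (n : nat) (x : R), derivable (f^`(n))%classic x 1.

(** By [is_derive_flat] all derivatives stay in the family. *)
Lemma smooth_flat (p q : {poly R}) k : smooth (flat q p k).
Proof.
have flatn n : exists p' k', ((flat q p k)^`(n))%classic = flat q p' k'.
  elim: n => [|n [p' [k' ih]]]; first by exists p, k.
  do 2 eexists; rewrite derive1nS ih; apply/funext => x; rewrite derive1E.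
  by have [_ ->] := is_derive_flat q p' k' x.
move=> n x; have [p' [k' ->]] := flatn n.
by have [] := is_derive_flat q p' k' x.
Qed.

Lemma smooth_continuous f : smooth f -> continuous f.
Proof.
by move=> sf x; apply/differentiable_continuous/derivable1_diffP; exact: (sf 0%N).
Qed.

Lemma smooth_derive f : smooth f -> smooth (f^`())%classic.
Proof.
move=> sf n x; have := sf n.+1 x; rewrite /derive1n iterSr.
by [].
Qed.

Lemma smooth_primitive f : (forall x, derivable f x 1) ->
  smooth (f^`())%classic -> smooth f.
Proof.
move=> df sf [|n] x; first exact: df.
by have := sf n x; rewrite /derive1n -iterSr.
Qed.

Lemma smoothB f g : smooth f -> smooth g -> smooth (f \- g).
Proof.
move=> sf sg.
have fgn n : ((f \- g)^`(n))%classic = (f^`(n))%classic \- (g^`(n))%classic.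
  elim: n => [//|n ih]; rewrite !derive1nS ih; apply/funext => x.
  by rewrite derive1E deriveB; [rewrite -!derive1E|exact: sf|exact: sg].
move=> n x; rewrite fgn; apply: derivableB; [exact: sf|exact: sg].
Qed.

(** The bump is [exp (-1/q)] for the quadratic [q] with roots [a] and [b],
    normalized. The height is bounded by a universal constant over [b - a]
    because [q >= 3/16] on the middle half of the interval; this uniformity
    is what makes mollification converge at Lebesgue points. *)
Lemma bump_exists : exists2 C : R, 0 < C & forall a b : R, a < b ->
  exists rho : R -> R, [/\ smooth rho, forall x, 0 <= rho x <= C / (b - a),
    forall x, rho x != 0 -> a < x < b &
    (\int[@lebesgue_measure R]_x (rho x)%:E = 1)%E].
Proof.
have C0 : 0 < 2 * expR (16 / 3) :> R by rewrite mulr_gt0// expR_gt0.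
exists (2 * expR (16 / 3)) => // a b ab.
have ba0 : 0 < b - a by rewrite subr_gt0.
pose q : {poly R} := ((b - a) ^- 2) *: (('X - a%:P) * (b%:P - 'X)).
have qE x : q.[x] = (b - a) ^- 2 * ((x - a) * (b - x)).
  by rewrite /q !(hornerZ, hornerM, hornerD, hornerN, hornerX, hornerC).
have q_gt0 x : 0 < q.[x] -> a < x < b.
  rewrite qE pmulr_rgt0 ?exprn_gt0 ?invr_gt0 ?exprn_gt0//.
  by move=> ?; apply/andP; split; nra.
pose f := flat q 1 0.
have fE x : f x = if 0 < q.[x] then expR (- q.[x]^-1) else 0.
  by rewrite /f /flat hornerC expr0 !mul1r.
have f0 x : 0 <= f x by rewrite fE; case: ifP => // _; exact: expR_ge0.
have f1 x : f x <= 1.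
  rewrite fE; case: ifP => // qx.
  by rewrite -expR0 ler_expR oppr_le0 invr_ge0 ltW.
have fab x : f x != 0 -> a < x < b.
  by rewrite fE; case: ifPn => [/q_gt0//|_]; rewrite eqxx.
have fC x : a + (b - a) / 4 < x < b - (b - a) / 4 -> expR (- (16 / 3)) <= f x.
  move=> xab; have q316 : 3 / 16 <= q.[x].
    rewrite qE [leRHS]mulrC ler_pdivlMr ?exprn_gt0//.
    by case/andP: xab => xa xb; nra.
  have qx : 0 < q.[x] by apply: lt_le_trans q316; lra.
  rewrite fE qx ler_expR lerN2 -[_ / 3]invrK lef_pV2 ?posrE ?invr_gt0//.
  by rewrite invf_div.
have mf : measurable_fun (setT : set BR) (EFin \o f).
  apply/measurable_EFinP; apply: continuous_measurable_fun.
  exact/smooth_continuous/smooth_flat.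
pose m := (\int[@lebesgue_measure R]_x (f x)%:E)%E.
have m0 : (0 <= m)%E by apply: integral_ge0 => x _; rewrite lee_fin.
have mlty : (m <= (b - a)%:E)%E.
  have <- : (\int[@lebesgue_measure R]_(x in `]a, b[) cst 1%E x = (b - a)%:E)%E.
    by rewrite integral_cst//= mul1e lebesgue_measure_itv/= lte_fin ab.
  rewrite [leRHS]integral_mkcond; apply: ge0_le_integral => //.
  - by move=> x _; rewrite lee_fin.
  - by apply: (iffLR (measurable_restrictT _ _)) => //; exact: measurable_cst.
  - move=> x _; rewrite patchE; case: ifPn => [_|]; first by rewrite lee_fin.
    by rewrite notin_setE/= in_itv/= => xab; case: eqVneq (fab x) => [->//|_ /(_ isT)/xab].
have mgt : (((2 * expR (16 / 3)) / (b - a))^-1%:E <= m)%E.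
  set l := a + (b - a) / 4; set u := b - (b - a) / 4.
  have lu : l < u by rewrite /l /u; lra.
  apply: (@le_trans _ _ (\int[@lebesgue_measure R]_(x in `]l, u[)
      cst (expR (- (16 / 3)))%:E x)%E).
    rewrite integral_cst//= lebesgue_measure_itv/= lte_fin lu -EFinB -EFinM.
    rewrite lee_fin invf_div invfM expRN mulrA mulrC ler_pM2l ?invr_gt0 ?expR_gt0//.
    by rewrite /u /l; lra.
  apply: (@le_trans _ _ (\int[@lebesgue_measure R]_(x in `]l, u[) (f x)%:E)%E).
    apply: ge0_le_integral => //.
    - by move=> x _; rewrite lee_fin expR_ge0.
    - exact: measurable_funS mf.
  rewrite /m; apply: ge0_subset_integral => //.
  by move=> x _; rewrite lee_fin.
pose r := fine m.
have mr : m = r%:E by rewrite /r fineK// ge0_fin_numE// (le_lt_trans mlty)// ltry.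
have r0 : 0 < r.
  rewrite -lte_fin -mr (lt_le_trans _ mgt)// lte_fin invr_gt0.
  by rewrite divr_gt0.
have rE x : flat q (r^-1)%:P 0 x = r^-1 * f x.
  by rewrite /f /flat; case: ifP => _; rewrite ?mulr0// !hornerC expr0 !mulr1 mul1r.
exists (flat q (r^-1)%:P 0); split.
- exact: smooth_flat.
- move=> x; rewrite rE mulr_ge0 ?invr_ge0 ?(ltW r0)//=.
  rewrite (le_trans (ler_piMr _ (f1 x))) ?invr_ge0 ?(ltW r0)//.
  rewrite -[leRHS]invrK lef_pV2 ?posrE// ?invr_gt0 ?divr_gt0//.
  by rewrite -lee_fin -mr.
- by move=> x; rewrite rE mulf_eq0 negb_or => /andP[_]; exact: fab.
- under eq_integral do rewrite rE EFinM.
  rewrite ge0_integralZl//; last 2 first.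
  + by move=> x _; rewrite lee_fin.
  + by rewrite lee_fin invr_ge0 ltW.
  by rewrite -/m mr -EFinM mulVf// gt_eqF.
Qed.

Lemma smooth_test_function (I : set R) (a b : R) f :
  smooth f -> (forall x, f x != 0 -> a <= x <= b) -> `[a, b]%classic `<=` I ->
  test_function I f.
Proof.
move=> sf fab abI.
have clf : closure [set x | f x != 0] `<=` `[a, b]%classic.
  rewrite [X in _ `<=` X](iffLR (closure_id _) (@itv_closed _ _ _ _)).
  by apply: closureS => x /= /fab; rewrite in_itv.
split => //; last exact: subset_trans abI.
apply: subclosed_compact clf; first exact: closed_closure.
exact: segment_compact.
Qed.

Lemma step_of_bump (a b : R) (rho : R -> R) : a < b -> smooth rho ->
  (forall x, 0 <= rho x) -> (forall x, rho x != 0 -> a < x < b) ->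
  (\int[@lebesgue_measure R]_x (rho x)%:E = 1)%E ->
  exists S : R -> R, [/\ smooth S, (S^`())%classic = rho,
    forall x, 0 <= S x <= 1, forall x, x <= a -> S x = 0 &
    forall x, b <= x -> S x = 1].
Proof.
move=> ab srho rho0 rhoab irho.
have mrho : measurable_fun (setT : set BR) (EFin \o rho).
  apply/measurable_EFinP; apply: continuous_measurable_fun.
  exact: smooth_continuous.
have intrho : (@lebesgue_measure R).-integrable (setT : set BR) (EFin \o rho).
  apply/integrableP; split => //.
  under eq_integral do rewrite gee0_abs ?lee_fin//.
  by rewrite irho ltry.
pose Se x := (\int[@lebesgue_measure R]_(t in `]-oo, x]) (rho t)%:E)%E.
have Se0 x : (0 <= Se x)%E by apply: integral_ge0 => t _; rewrite lee_fin.
have Se1 x : (Se x <= 1)%E.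
  rewrite -irho; apply: ge0_subset_integral => //.
  by move=> t _; rewrite lee_fin.
have Sefin x : Se x \is a fin_num.
  by rewrite ge0_fin_numE// (le_lt_trans (Se1 x))// ltry.
pose S x := (\int[@lebesgue_measure R]_(t in `]-oo, x]) rho t)%R.
have SE x : Se x = (S x)%:E by rewrite /S /Rintegral fineK//; exact: Sefin.
have dS x : derivable S x 1 /\ (S^`())%classic x = rho x.
  apply: (@continuous_FTC1 _ rho -oo%O x (x + 1)).
  - by rewrite ltrDl.
  - by apply: integrableS intrho.
  - by rewrite ltNyr.
  - by apply/differentiable_continuous/derivable1_diffP; exact: (srho 0%N).
have S'E : (S^`())%classic = rho by apply/funext => x; exact: (dS x).2.
exists S; split => //.
- apply: smooth_primitive; first by move=> x; exact: (dS x).1.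
  by rewrite S'E.
- by move=> x; rewrite -2!lee_fin -SE Se0 Se1.
- move=> x xa; apply: EFin_inj; rewrite -SE; apply: integral0_eq => t.
  rewrite /= in_itv/= => tx; case: eqVneq (rhoab t) => [->//|_ /(_ isT)].
  by rewrite ltNge (le_trans tx xa).
- move=> x bx; apply: EFin_inj; rewrite -SE -irho /Se integral_mkcond.
  apply: eq_integral => t _; rewrite patchE; case: ifPn => //.
  rewrite notin_setE/= in_itv/= => /negP tx.
  case: eqVneq (rhoab t) => [->//|_ /(_ isT)/andP[_ tb]].
  by rewrite (le_trans (ltW tb) bx) in tx.
Qed.

End smooth_steps.

(** * Mollification at a Lebesgue point *)

Section mollification.
Context {R : realType}.
Local Notation mu := (leb R).
Implicit Types (f k : R -> \bar R) (c d : \bar R).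

(** Cutting an integral down to the support of the integrand needs no
    measurability, since both sides are integrals of the same extension by 0. *)
Lemma leb_integral_support (A B : set R) f : A `<=` B ->
  (forall x, B x -> ~ A x -> f x = 0) ->
  \int[mu]_(x in B) f x = \int[mu]_(x in A) f x.
Proof.
move=> AB f0; rewrite leb_integral_patch [RHS]leb_integral_patch.
apply: eq_leb_integral => x _; rewrite !patchE.
case: ifPn => [/set_mem Bx|/negP Bx]; case: ifPn => [/set_mem Ax|/negP Ax] //.
- by apply: f0 => // /mem_set.
- by exfalso; apply: Bx; apply/mem_set; exact: AB.
Qed.

Lemma leb_measurable_EFin (f : R -> R) (D : set R) : leb_set D ->
  continuous f -> leb_measurable D (EFin \o f).
Proof.
move=> mD cf; apply: (leb_measurableS leb_setT) => //.
apply: borel_fun_leb => //; apply/measurable_EFinP.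
exact: continuous_measurable_fun.
Qed.

(** The height bound [C / r] is part of the definition because the
    mollification estimate needs it with [C] independent of [r]. *)
Definition bump_on (C a r : R) (rho : R -> R) : Prop :=
  [/\ smooth rho, forall x, (0 <= rho x <= C / r)%R,
      forall x, rho x != 0%R -> (a < x < a + r)%R &
      \int[mu]_(x in eitv a%:E (a + r)%:E) (rho x)%:E = 1].

Lemma bump_on_exists : exists2 C : R, (0 < C)%R &
  forall a r : R, (0 < r)%R -> exists rho S : R -> R,
    [/\ bump_on C a r rho, smooth S, (S^`())%classic = rho,
      forall x, (0 <= S x <= 1)%R &
      (forall x, (x <= a)%R -> S x = 0%R) /\
      (forall x, (a + r <= x)%R -> S x = 1%R)].
Proof.
have [C C0 HC] := @bump_exists R; exists C => // a r r0.
have ar : (a < a + r)%R by rewrite ltrDl.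
have [rho [srho rhoC rhoa irho]] := HC _ _ ar.
have rho0 x : (0 <= rho x)%R by case/andP: (rhoC x).
have [S [sS S' S01 S0 S1]] := step_of_bump ar srho rho0 rhoa irho.
exists rho, S; split => //; split => //.
  by move=> x; have := rhoC x; rewrite addrAC subrr add0r.
rewrite -(@leb_integral_support _ setT) ?ge0_integral_leb//.
- apply/measurable_EFinP; apply: continuous_measurable_fun.
  exact: smooth_continuous.
- by move=> x _; rewrite lee_fin.
- move=> x _ xa; apply/eqP; rewrite eqe; apply: contra_notT xa => /rhoa.
  by move=> /andP[? ?]; split; rewrite lte_fin.
Qed.

Lemma leb_integrableMr D f (h : R -> R) (M : R) : leb_set D ->
  leb_integrable D f -> leb_measurable D (EFin \o h) ->
  (forall x, D x -> (`|h x| <= M)%R) ->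
  leb_integrable D (fun x => f x * (h x)%:E).
Proof.
move=> mD fi mh hM.
apply: (le_leb_integrable (g := fun x => M%:E * f x)) => //.
- by apply: leb_measurableM => //; exact: leb_integrable_measurable.
- move=> x Dx; rewrite !abseM muleC lee_wpmul2r//= lee_fin.
  exact: le_trans (hM _ Dx) (ler_norm _).
- exact: leb_integrableZl.
Qed.

Lemma leb_integrable_cst (a b : R) (k : R) :
  leb_integrable (eitv a%:E b%:E) (fun=> k%:E).
Proof.
apply/leb_integrableP; split; first exact: leb_measurable_cst.
rewrite leb_integral_cst; last exact: leb_set_eitv.
have [ab|ba] := leP a b; first by rewrite leb_eitv// -EFinM ltry.
rewrite (_ : eitv _ _ = set0) ?measure0 ?mule0 ?ltry//.
apply/seteqP; split => x //= [+ xb].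
by rewrite ltNge (le_trans (ltW xb))// lee_fin ltW.
Qed.

Lemma eitv_sub c d (a b : R) : eitv c d a -> eitv c d b ->
  eitv a%:E b%:E `<=` eitv c d.
Proof. by case=> ? _ [_ ?]; apply: eitvS; exact: ltW. Qed.

Lemma near_right_eitv c d x : eitv c d x ->
  \forall r \near (0 : R)^'+, eitv c d (x + r)%R.
Proof.
move=> [cx xd].
have [e e0 He] : exists2 e : R, (0 < e)%R & (x + e)%:E <= d.
  case: d xd => [y| |].
  - by rewrite lte_fin => xy; exists (y - x)%R; rewrite ?subr_gt0// subrKC.
  - by move=> _; exists 1%R => //; rewrite leey.
  - by rewrite ltNge leNye.
near=> r; have r0 : (0 < r)%R by near: r; exact: nbhs_right_gt.
split; first by rewrite (lt_trans cx)// lte_fin ltrDl.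
by apply: lt_le_trans He; rewrite lte_fin ltrD2l; near: r; exact: nbhs_right_lt.
Unshelve. all: by end_near. Qed.

Lemma right_lebesgue_ptP f x : right_lebesgue_pt f x -> forall e : R, (0 < e)%R ->
  \forall r \near (0 : R)^'+,
    \int[mu]_(t in eitv x%:E (x + r)%:E) `|f t - f x| <= (e * r)%:E.
Proof.
move=> [_ fx] e e0; have [dl dl0 Hd] := fx _ e0.
near=> r; apply: Hd; apply/andP; split; near: r.
  exact: nbhs_right_gt.
exact: nbhs_right_lt.
Unshelve. all: by end_near. Qed.

Lemma L1loc_integrable c d f (a b : R) : leb_measurable (eitv c d) f ->
  L1loc (eitv c d) f -> eitv c d a -> eitv c d b ->
  leb_integrable (eitv a%:E b%:E) f.
Proof.
move=> mf f1 Ia Ib; apply/leb_integrableP; split; last exact: f1.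
apply: (leb_measurableS (leb_set_eitv c d)) => //.
exact: eitv_sub.
Qed.

(** The error is at most the height of the bump times the integral of
    [|k - k x|] over its support, hence at most
    [C / r * (e / C * r)]. The radius is chosen before the bump, so
    that one radius serves the bumps at several points. *)
Lemma near_mollify c d k x (C : R) : (0 < C)%R ->
  leb_measurable (eitv c d) k -> L1loc (eitv c d) k -> eitv c d x ->
  right_lebesgue_pt k x -> forall e : R, (0 < e)%R ->
  \forall r \near (0 : R)^'+, forall rho, bump_on C x r rho ->
    `|\int[mu]_(t in eitv c d) (k t * (rho t)%:E) - k x| <= e%:E.
Proof.
move=> C0 mk k1 Ix kx e e0.
have eC : (0 < e / C)%R by rewrite divr_gt0.
near=> r; have r0 : (0 < r)%R by near: r; exact: nbhs_right_gt.
move=> rho [srho rhoC rhox irho].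
have Ixr : eitv c d (x + r)%R by near: r; exact: near_right_eitv.
have Hr : \int[mu]_(t in eitv x%:E (x + r)%:E) `|k t - k x| <= (e / C * r)%:E.
  by near: r; exact: right_lebesgue_ptP.
set J := eitv x%:E (x + r)%:E in irho Hr *.
have mJ : leb_set J by exact: leb_set_eitv.
have ik : leb_integrable J k by exact: (L1loc_integrable mk k1).
have JI : J `<=` eitv c d by exact: eitv_sub.
have mrho : leb_measurable J (EFin \o rho).
  exact/leb_measurable_EFin/smooth_continuous.
rewrite (leb_integral_support JI); last first.
  move=> t _ Jt; suff -> : rho t = 0%R by rewrite mule0.
  apply/eqP; apply: contra_notT Jt => /rhox.
  by move=> /andP[? ?]; split; rewrite lte_fin.
have rhoCn t : (`|rho t| <= C / r)%R by case/andP: (rhoC t) => p q; rewrite ger0_norm.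
have ikr : leb_integrable J (fun t => k t * (rho t)%:E).
  exact: (@leb_integrableMr _ _ _ (C / r)).
have kxE : k x = (fine (k x))%:E by have [kxf _] := kx; rewrite fineK.
have ixr : leb_integrable J (fun t => k x * (rho t)%:E).
  apply: (@leb_integrableMr _ _ _ (C / r)) => //.
  by rewrite kxE; exact: leb_integrable_cst.
have -> : k x = \int[mu]_(t in J) (k x * (rho t)%:E).
  rewrite kxE leb_integralZl ?irho ?mule1//.
  apply/leb_integrableP; split => //.
  under eq_integral do rewrite gee0_abs ?lee_fin ?(proj1 (andP (rhoC _)))//.
  by rewrite irho ltry.
rewrite -leb_integralB//; apply: le_trans (le_abse_leb_integral _ _) _ => //.
  by apply: leb_measurableB; exact: leb_integrable_measurable.
apply: (@le_trans _ _ (\int[mu]_(t in J) ((C / r)%:E * `|k t - k x|))).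
  apply: ge0_le_leb_integral => //.
  - apply: leb_measurable_abse.
    by apply: leb_measurableB; exact: leb_integrable_measurable.
  - apply: leb_measurableM; first exact: leb_measurable_cst.
    apply: leb_measurable_abse; apply: leb_measurableB.
      exact: leb_integrable_measurable.
    exact: leb_measurable_cst.
  - move=> t Jt; rewrite kxE -muleBl ?fin_num_adde_defl//.
    by rewrite abseM muleC lee_wpmul2r//= lee_fin.
rewrite ge0_leb_integralZl//; last 2 first.
- apply: leb_measurable_abse; apply: leb_measurableB.
    exact: leb_integrable_measurable.
  exact: leb_measurable_cst.
- by rewrite lee_fin divr_ge0// ltW.
apply: le_trans (lee_wpmul2l _ Hr) _; first by rewrite lee_fin divr_ge0// ltW.
rewrite -EFinM lee_fin le_eqVlt; apply/orP; left; apply/eqP.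
by field; rewrite !gt_eqF.
Unshelve. all: by end_near. Qed.
End mollification.

(** * Weak derivatives and increments *)

Section increments.
Context {R : realType}.
Local Notation mu := (leb R).
Implicit Types (f g k : R -> \bar R) (c d : \bar R).

Lemma leb_integrable_support (A B : set R) f : leb_set A -> leb_set B ->
  A `<=` B -> leb_measurable B f -> (forall x, B x -> ~ A x -> f x = 0) ->
  leb_integrable A f -> leb_integrable B f.
Proof.
move=> mA mB AB mf f0 /leb_integrableP[_ fA]; apply/leb_integrableP; split => //.
rewrite (leb_integral_support AB)// => x Bx Ax.
by rewrite f0 ?abse0.
Qed.

Lemma leb_integral_patchS (A B : set R) f : A `<=` B ->
  \int[mu]_(x in B) (f \_ A) x = \int[mu]_(x in A) f x.
Proof.
move=> AB; rewrite (leb_integral_support AB); last first.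
  by move=> x _ Ax; rewrite patchE; case: ifPn => // /set_mem.
by apply: eq_leb_integral => x Ax; rewrite patchE mem_set.
Qed.

Lemma leb_measurable_patchS (A B : set R) f : leb_set A -> 
  leb_measurable A f -> leb_measurable B (f \_ A).
Proof.
by move=> mA mf; apply: (leb_measurableS leb_setT) => //; exact: leb_measurable_patch.
Qed.

Lemma leb_integrable_patchS (A B : set R) f : leb_set A -> leb_set B ->
  leb_integrable A f -> leb_integrable B (f \_ A).
Proof.
move=> mA mB fA; apply: (leb_integrableS leb_setT) => //.
exact/(leb_integrable_patch f mA).
Qed.

Lemma patch_eitv (a b t : R) f :
  (f \_ (eitv a%:E b%:E)) t = if (a < t < b)%R then f t else 0.
Proof.
rewrite patchE; suff -> : (t \in eitv a%:E b%:E) = (a < t < b)%R by [].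
apply/idP/andP => [/set_mem[]|[at_ tb]]; first by rewrite !lte_fin.
by apply/mem_set; split; rewrite lte_fin.
Qed.

Lemma leb_ae_neq (b : R) : {ae mu, forall x, x <> b}.
Proof.
apply: ae_leb; exists [set b]; split => //.
  by rewrite lebesgue_measure_set1.
by move=> x /= /contrapT.
Qed.

(** Near a Lebesgue point [g] integrates like the constant [g x]. *)
Lemma near_small_integral c d g x : leb_measurable (eitv c d) g ->
  L1loc (eitv c d) g -> eitv c d x -> right_lebesgue_pt g x ->
  forall e : R, (0 < e)%R -> \forall r \near (0 : R)^'+,
    \int[mu]_(t in eitv x%:E (x + r)%:E) `|g t| <= e%:E.
Proof.
move=> mg g1 Ix gx e e0.
have [gxf _] := gx; pose y := fine (g x).
have gxE : g x = y%:E by rewrite fineK.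
have e1 : (0 < e / (1 + `|y|))%R by rewrite divr_gt0// ltr_wpDr.
near=> r; have r0 : (0 < r)%R by near: r; exact: nbhs_right_gt.
have Ixr : eitv c d (x + r)%R by near: r; exact: near_right_eitv.
have Hr : \int[mu]_(t in eitv x%:E (x + r)%:E) `|g t - g x| <= (1 * r)%:E.
  by near: r; exact: right_lebesgue_ptP.
have re : (r < e / (1 + `|y|))%R by near: r; exact: nbhs_right_lt.
have mJ := leb_set_eitv x%:E (x + r)%:E.
have gi := L1loc_integrable mg g1 Ix Ixr.
have mgJ := leb_integrable_measurable gi.
have mgx : leb_measurable (eitv x%:E (x + r)%:E) (fun t => `|g t - g x|).
  by apply: leb_measurable_abse; apply: leb_measurableB => //; exact: leb_measurable_cst.
apply: (@le_trans _ _ (\int[mu]_(t in eitv x%:E (x + r)%:E) (`|g t - g x| + `|y|%:E))).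
  apply: ge0_le_leb_integral => //.
  - exact: leb_measurable_abse.
  - by apply: leb_measurableD => //; exact: leb_measurable_cst.
  - move=> t _; rewrite gxE -[X in _ + X]/(`|y%:E|).
    rewrite -[in leLHS](@subeK _ (g t) y%:E)//.
    exact: lee_abs_add.
rewrite ge0_leb_integralD//; last exact: leb_measurable_cst.
rewrite leb_integral_cst// leb_eitv ?lerDl ?(ltW r0)//.
apply: le_trans (leeD2r _ Hr) _.
rewrite -EFinM -EFinD lee_fin addrAC subrr add0r -mulrDl.
by rewrite mulrC -ler_pdivlMr ?ltW// ltr_wpDr.
Unshelve. all: by end_near. Qed.

Lemma bump_integrable c d k a r (C : R) rho : leb_measurable (eitv c d) k ->
  L1loc (eitv c d) k -> eitv c d a -> eitv c d (a + r)%R ->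
  bump_on C a r rho -> leb_integrable (eitv c d) (fun t => k t * (rho t)%:E).
Proof.
move=> mk k1 Ia Iar [srho rhoC rhoa _].
have mI := leb_set_eitv c d.
have mrho (D : set R) : leb_set D -> leb_measurable D (EFin \o rho).
  by move=> mD; exact/leb_measurable_EFin/smooth_continuous.
apply: (@leb_integrable_support (eitv a%:E (a + r)%:E)) => //.
- exact: leb_set_eitv.
- exact: eitv_sub.
- by apply: leb_measurableM => //; exact: mrho.
- move=> t _ Jt; suff -> : rho t = 0%R by rewrite mule0.
  apply/eqP; apply: contra_notT Jt => /rhoa.
  by move=> /andP[? ?]; split; rewrite lte_fin.
- apply: (@leb_integrableMr _ _ _ _ (C / r)).
  + exact: leb_set_eitv.
  + exact: (L1loc_integrable mk k1).
  + exact/mrho/leb_set_eitv.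
  + by move=> t _; case/andP: (rhoC t) => p q; rewrite ger0_norm.
Qed.

(** Test the weak derivative against [Sa - Sb], where [Sa] and [Sb] are
    smooth steps rising from 0 to 1 on [(a, a + r)] and [(b, b + r)].
    Its derivative is a difference of two bumps, so one side tends to
    [f a - f b]; the function itself differs from the indicator of
    [(a, b)] only on the two short intervals, over which [g] has a small
    integral. *)
Lemma weak_derivative_increment c d f g a b :
  leb_measurable (eitv c d) f -> leb_measurable (eitv c d) g ->
  is_weak_derivative (eitv c d) f g ->
  eitv c d a -> eitv c d b -> (a < b)%R ->
  right_lebesgue_pt f a -> right_lebesgue_pt f b ->
  right_lebesgue_pt g a -> right_lebesgue_pt g b ->
  {ae mu, forall x, eitv c d x -> right_lebesgue_pt g x} ->
  f b - f a = \int[mu]_(t in eitv a%:E b%:E) g t.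
Proof.
move=> mf mg [f1 g1 fg] Ia Ib ab fa fb ga gb gae.
have mI := leb_set_eitv c d.
have mab := leb_set_eitv a%:E b%:E.
(* [C] comes first: it is common to the bumps at [a] and [b] and all radii *)
have [C C0 HC] := @bump_on_exists R.
have gab := L1loc_integrable mg g1 Ia Ib.
have gabf := leb_integrable_fin_num mab gab.
have [faf _] := fa; have [fbf _] := fb.
(* two errors [e] from the bumps, and [2 * e] from the steps *)
suff H : forall e : R, (0 < e)%R ->
    (`|fine (f b) - fine (f a) - fine (\int[mu]_(t in eitv a%:E b%:E) g t)| <= 4 * e)%R.
  rewrite -(fineK faf) -(fineK fbf) -(fineK gabf) -EFinB; congr EFin.
  apply/eqP; rewrite -subr_eq0 -normr_le0; apply/ler_addgt0Pr => e e0.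
  rewrite add0r; apply: le_trans (H (e / 4)%R _) _; first by rewrite divr_gt0.
  by rewrite mulrC divfK.
move=> e e0.
near (0 : R)^'+ => r.
have r0 : (0 < r)%R by near: r; exact: nbhs_right_gt.
have Ibr : eitv c d (b + r)%R by near: r; exact: near_right_eitv.
have arb : (a + r <= b)%R.
  by rewrite -lerBrDl ltW//; near: r; apply: nbhs_right_lt; rewrite subr_gt0.
have Iar : eitv c d (a + r)%R.
  have [ca _] := Ia; have [_ bd] := Ib; split; last by rewrite (le_lt_trans _ bd)// lee_fin.
  by rewrite (lt_trans ca)// lte_fin ltrDl.
have Ga : \int[mu]_(t in eitv a%:E (a + r)%:E) `|g t| <= e%:E.
  by near: r; exact: (near_small_integral mg g1).
have Gb : \int[mu]_(t in eitv b%:E (b + r)%:E) `|g t| <= e%:E.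
  by near: r; exact: (near_small_integral mg g1).
have Fa : forall rho, bump_on C a r rho ->
    `|\int[mu]_(t in eitv c d) (f t * (rho t)%:E) - f a| <= e%:E.
  by near: r; exact: near_mollify.
have Fb : forall rho, bump_on C b r rho ->
    `|\int[mu]_(t in eitv c d) (f t * (rho t)%:E) - f b| <= e%:E.
  by near: r; exact: near_mollify.
have [ra [Sa [bra sSa Sa' Sa01 [Sa0 Sa1]]]] := HC a r r0.
have [rb [Sb [brb sSb Sb' Sb01 [Sb0 Sb1]]]] := HC b r r0.
move: (Fa _ bra) (Fb _ brb) => {}Fa {}Fb.
have ia := bump_integrable mf f1 Ia Iar bra.
have ib := bump_integrable mf f1 Ib Ibr brb.
pose psi := (Sa \- Sb)%R.
have psiE x : psi x = (Sa x - Sb x)%R by [].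
have psi' x : (psi^`())%classic x = (ra x - rb x)%R.
  rewrite -Sa' -Sb' !derive1E deriveB//; [exact: (sSa 0%N)|exact: (sSb 0%N)].
have psi_out x : psi x != 0%R -> (a < x < b + r)%R.
  rewrite /psi/= => px; apply/andP; split; rewrite ltNge; apply/negP => xx.
    by move: px; rewrite Sa0 ?Sb0 ?subrr ?eqxx// (le_trans xx)// ltW.
  move: px; rewrite Sa1 ?Sb1 ?subrr ?eqxx//.
  by rewrite (le_trans _ xx)// (le_trans arb)// lerDl ltW.
have tpsi : test_function (eitv c d) psi.
  apply: (@smooth_test_function _ _ a (b + r)) => //; first exact: smoothB.
    by move=> x /psi_out/andP[/ltW-> /ltW->].
  have [ca _] := Ia; have [_ bd] := Ibr.
  move=> x; rewrite /= in_itv/= => /andP[ax xb]; split.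
    by rewrite (lt_le_trans ca)// lee_fin.
  by rewrite (le_lt_trans _ bd)// lee_fin.
have := fg _ tpsi.
have -> : \int[mu]_(x in eitv c d) (f x * ((psi^`())%classic x)%:E) =
    \int[mu]_(x in eitv c d) (f x * (ra x)%:E) -
    \int[mu]_(x in eitv c d) (f x * (rb x)%:E).
  rewrite -leb_integralB//; apply: eq_leb_integral => x _; rewrite psi'.
  have [_ _ rax _] := bra; have [_ _ rbx _] := brb.
  case: (eqVneq (ra x)) (rax x) => [->|_ /(_ isT)/andP[ax xr]].
    by rewrite mule0 sub0e -muleN sub0r.
  case: (eqVneq (rb x)) (rbx x) => [->|_ /(_ isT)/andP[bx _]].
    by rewrite mule0 sube0 subr0.
  by have := lt_trans xr (le_lt_trans arb bx); rewrite ltxx.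
have spsi : continuous psi by apply: smooth_continuous; exact: smoothB.
have mpsi : leb_measurable (eitv c d) (EFin \o psi) by exact: leb_measurable_EFin.
have psi1 x : (`|psi x| <= 1)%R.
  by have := Sa01 x; have := Sb01 x; rewrite /psi/= ler_norml; lra.
have gpsi : leb_integrable (eitv c d) (fun x => g x * (psi x)%:E).
  apply: (@leb_integrable_support (eitv a%:E (b + r)%:E)) => //.
  - exact: leb_set_eitv.
  - exact: eitv_sub.
  - exact: leb_measurableM.
  - move=> t _ Jt; suff -> : psi t = 0%R by rewrite mule0.
    apply/eqP; apply: contra_notT Jt => /psi_out.
    by move=> /andP[? ?]; split; rewrite lte_fin.
  - apply: (@leb_integrableMr _ _ _ _ 1) => //.
    + exact: leb_set_eitv.
    + exact: (L1loc_integrable mg g1).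
    + exact/leb_measurable_EFin/spsi/leb_set_eitv.
set Jab := eitv a%:E b%:E in mab gab gabf *.
set Ja := eitv a%:E (a + r)%:E in Ga *.
set Jb := eitv b%:E (b + r)%:E in Gb *.
have JabI : Jab `<=` eitv c d by exact: eitv_sub.
have JaI : Ja `<=` eitv c d by exact: eitv_sub.
have JbI : Jb `<=` eitv c d by exact: eitv_sub.
have mJa : leb_set Ja by exact: leb_set_eitv.
have mJb : leb_set Jb by exact: leb_set_eitv.
pose ag t := `|g t|.
have mag : leb_measurable (eitv c d) ag by exact: leb_measurable_abse.
have magP (A : set R) : leb_set A -> A `<=` eitv c d -> leb_measurable (eitv c d) (ag \_ A).
  move=> mA AI; apply: leb_measurable_patchS => //.
  exact: (leb_measurableS mI).
have ag0 (A : set R) t : 0 <= (ag \_ A) t by rewrite patchE; case: ifP => // _; exact: abse_ge0.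
have gabP := leb_integrable_patchS mab mI gab.
have key : `|\int[mu]_(t in eitv c d) (g t * (psi t)%:E) - \int[mu]_(t in Jab) g t|
    <= (2 * e)%:E.
  rewrite -(leb_integral_patchS _ JabI) -leb_integralB//.
  apply: (le_trans (le_abse_leb_integral _ _)) => //.
    apply: leb_measurableB; exact: leb_integrable_measurable.
  apply: (@le_trans _ _ (\int[mu]_(t in eitv c d) ((ag \_ Ja) t + (ag \_ Jb) t))).
    apply: ae_ge0_le_leb_integral => //.
    - apply: leb_measurable_abse; apply: leb_measurableB; exact: leb_integrable_measurable.
    - by move=> t _; exact: adde_ge0.
    - by apply: leb_measurableD; exact: magP.
    - apply: aeS (aeI gae (leb_ae_neq b)) => t [gt tb] It.
      have [gtf _] := gt It.
      rewrite /Ja /Jb /Jab !patch_eitv /ag -(fineK gtf) psiE.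
      set y := fine (g t).
      have := Sa01 t; have := Sb01 t.
      have norm_le (p : R) : (0 <= p <= 1)%R -> (`|y * p| <= `|y|)%R.
        case/andP => p0 p1; rewrite normrM (ger0_norm p0).
        exact: ler_piMr.
      have [ta _ _|ta] := leP t a.
        have tb' : (t < b)%R by rewrite (le_lt_trans ta ab).
        rewrite Sa0// Sb0 ?(ltW tb')// (ltNge b) (ltW tb') andFb.
        by rewrite subr0 mule0 sube0 abse0 adde0.
      have [tar _ s|tar] := ltP t (a + r)%R.
        have tb' : (t < b)%R by rewrite (lt_le_trans tar arb).
        rewrite tb' (ltNge b) (ltW tb')/= adde0 (Sb0 t (ltW tb')) subr0.
        rewrite lee_fin -{2}(mulr1 y) -mulrBr -normrN -mulrN opprB.
        by apply: norm_le; lra.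
      rewrite (Sa1 _ tar) => + _.
      have [tltb _|tgtb s|//] := ltgtP t b.
        by rewrite Sb0 ?(ltW tltb)//= subr0 mulr1 subrr normr0 adde0.
      have [tbr|tbr] /= := ltP t (b + r)%R.
        by rewrite subr0 add0e lee_fin; apply: norm_le; lra.
      by rewrite Sb1// subrr mulr0 subr0 normr0 adde0.
  rewrite ge0_leb_integralD//; last 2 first.
  - exact: magP.
  - exact: magP.
  by rewrite !leb_integral_patchS// mulrDl mul1r EFinD leeD.
have Gf := leb_integrable_fin_num mI gpsi.
have Af := leb_integrable_fin_num mI ia.
have Bf := leb_integrable_fin_num mI ib.
move: Fa Fb key; rewrite -(fineK Gf) -(fineK Af) -(fineK Bf) -(fineK gabf).
rewrite -(fineK faf) -(fineK fbf) -!EFinB -EFinN /= !lee_fin.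
rewrite !ler_norml => /andP[? ?] /andP[? ?] /andP[? ?] [?]; lra.
Unshelve. all: by end_near. Qed.
End increments.

Section weak_derivatives.
Context {R : realType}.
Local Notation mu := (leb R).
Implicit Types (f g : R -> \bar R) (c d : \bar R).

Lemma weak_derivative_ae_increment c d f g :
  leb_measurable (eitv c d) f -> leb_measurable (eitv c d) g ->
  is_weak_derivative (eitv c d) f g ->
  exists2 Z : set R, {ae mu, forall x, eitv c d x -> Z x} &
    forall a b, Z a -> Z b -> eitv c d a -> eitv c d b -> (a < b)%R ->
      [/\ f a \is a fin_num, f b \is a fin_num &
          f b - f a = \int[mu]_(t in eitv a%:E b%:E) g t].
Proof.
move=> mf mg fg; have [f1 g1 _] := fg.
have fae := L1loc_right_lebesgue_pt mf f1.
have gae := L1loc_right_lebesgue_pt mg g1.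
exists (right_lebesgue_pt f `&` right_lebesgue_pt g).
  by apply: aeS (aeI fae gae) => x [fx gx] Ix; split; [exact: fx|exact: gx].
move=> a b [fa ga] [fb gb] Ia Ib ab.
split; [by case: fa|by case: fb|exact: (weak_derivative_increment mf mg fg)].
Qed.

(** Both candidates have the same integral against bumps, hence the same value
    at common Lebesgue points. *)
Lemma weak_derivative_unique c d f g1 g2 :
  leb_measurable (eitv c d) g1 -> leb_measurable (eitv c d) g2 ->
  is_weak_derivative (eitv c d) f g1 -> is_weak_derivative (eitv c d) f g2 ->
  {ae mu, forall x, eitv c d x -> g1 x = g2 x}.
Proof.
move=> mg1 mg2 [_ lg1 fg1] [_ lg2 fg2].
have ae1 := L1loc_right_lebesgue_pt mg1 lg1.
have ae2 := L1loc_right_lebesgue_pt mg2 lg2.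
apply: aeS (aeI ae1 ae2) => x [+ +] Ix => /(_ Ix) g1x /(_ Ix) g2x.
have [C C0 HC] := @bump_on_exists R.
have [g1f _] := g1x; have [g2f _] := g2x.
suff H : forall e : R, (0 < e)%R -> (`|fine (g1 x) - fine (g2 x)| <= 2 * e)%R.
  rewrite -(fineK g1f) -(fineK g2f); congr EFin.
  apply/eqP; rewrite -subr_eq0 -normr_le0; apply/ler_addgt0Pr => e e0.
  rewrite add0r; apply: le_trans (H (e / 2)%R _) _; first by rewrite divr_gt0.
  by rewrite mulrC divfK.
move=> e e0; near (0 : R)^'+ => r.
have r0 : (0 < r)%R by near: r; exact: nbhs_right_gt.
have Ixr : eitv c d (x + r)%R by near: r; exact: near_right_eitv.
have F1 : forall rho, bump_on C x r rho ->
    `|\int[mu]_(t in eitv c d) (g1 t * (rho t)%:E) - g1 x| <= e%:E.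
  by near: r; exact: near_mollify.
have F2 : forall rho, bump_on C x r rho ->
    `|\int[mu]_(t in eitv c d) (g2 t * (rho t)%:E) - g2 x| <= e%:E.
  by near: r; exact: near_mollify.
have [rho [_ [brho _ _ _ _]]] := HC x r r0.
have [srho _ rhox _] := brho.
have trho : test_function (eitv c d) rho.
  apply: (@smooth_test_function _ _ x (x + r)) => //.
    by move=> y /rhox/andP[/ltW-> /ltW->].
  have [cx _] := Ix; have [_ xd] := Ixr.
  move=> y; rewrite /= in_itv/= => /andP[xy yx]; split.
    by rewrite (lt_le_trans cx)// lee_fin.
  by rewrite (le_lt_trans _ xd)// lee_fin.
move: (F1 _ brho) (F2 _ brho) (bump_integrable mg1 lg1 Ix Ixr brho).
have := fg1 _ trho; rewrite (fg2 _ trho) => /oppe_inj ->.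
move=> {}F1 {}F2 /(leb_integrable_fin_num (leb_set_eitv c d)) gf.
move: F1 F2; rewrite -(fineK gf) -(fineK g1f) -(fineK g2f) -!EFinB /= !lee_fin.
rewrite !ler_norml => /andP[? ?] /andP[? ?]; apply/andP; split; lra.
Unshelve. all: by end_near. Qed.

End weak_derivatives.

(** * Iterated integrals over a triangle *)

Section triangle.
Context {R : realType}.
Local Notation mu := (leb R).
Local Notation LR := (leb_line R).
Implicit Types (p q : R -> \bar R) (c d : \bar R).

Lemma eitv_tail c d (x : R) : eitv c d x -> eitv x%:E d `<=` eitv c d.
Proof. by move=> [cx _]; apply: eitvS => //; exact: ltW. Qed.

Lemma eitv_head c d (x : R) : eitv c d x -> eitv c x%:E `<=` eitv c d.
Proof. by move=> [_ xd]; apply: eitvS => //; exact: ltW. Qed.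

Lemma measurable_triangle :
  measurable ([set z : LR * LR | (z.1 < z.2)%R] : set (LR * LR)%type).
Proof.
rewrite (_ : [set _ | _] = \bigcup_(r : rat)
   ((eitv -oo (ratr r)%:E : set LR) `*` (eitv (ratr r)%:E +oo : set LR))).
  apply: bigcupT_measurable_rat => r; apply: measurableX; exact: leb_set_eitv.
apply/seteqP; split => [[x t]/= /rat_in_itvoo[r]|[x t] [r _]].
  rewrite in_itv/= => /andP[xr rt].
  by exists r => //; split; split; rewrite /= ?ltNyr ?ltry ?lte_fin.
by case=> -[_ /= xr] [/= rt _]; move: xr rt; rewrite !lte_fin; exact: lt_trans.
Qed.

Let smu : {sigma_finite_measure set LR -> \bar R} := @completed_lebesgue_measure R.

(** The kernel whose rows are [p x * q] on tails and whose columns are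
    [p * q t] on heads. Extending it by 0 to the plane lets the theorems
    for product measures apply. *)
Let triangle (I : set R) p q : LR * LR -> \bar R :=
  (fun z => (p \_ I) z.1 * (q \_ I) z.2) \_ [set z : LR * LR | (z.1 < z.2)%R].

Let triangleE I p q (x t : R) : triangle I p q (x, t) =
  if (x < t)%R then (p \_ I) x * (q \_ I) t else 0.
Proof.
rewrite /triangle patchE; case: ifPn => [/set_mem/= -> //|].
by rewrite notin_setE/= => /negP/negPf ->.
Qed.

Let measurable_triangle_fun c d p q : leb_measurable (eitv c d) p ->
  leb_measurable (eitv c d) q ->
  measurable_fun (setT : set (LR * LR)) (triangle (eitv c d) p q).
Proof.
move=> mp mq; have mI := leb_set_eitv c d.
apply: (iffLR (measurable_restrictT _ measurable_triangle)).
apply: measurable_funTS; apply: emeasurable_funM.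
- have mP : measurable_fun (setT : set LR) (p \_ (eitv c d)) by exact: leb_measurable_patch.
  exact: (measurableT_comp mP (@measurable_fst _ _ LR LR)).
- have mQ : measurable_fun (setT : set LR) (q \_ (eitv c d)) by exact: leb_measurable_patch.
  exact: (measurableT_comp mQ (@measurable_snd _ _ LR LR)).
Qed.

Let triangle_row c d p q (x : R) :
  \int[mu]_t triangle (eitv c d) p q (x, t) =
  ((fun x => \int[mu]_(t in eitv x%:E d) (p x * q t)) \_ (eitv c d)) x.
Proof.
rewrite patchE; case: ifPn => [/set_mem Ix|Ix]; last first.
  rewrite -[RHS](@integral0 _ LR _ mu setT); apply: eq_leb_integral => t _.
  by rewrite triangleE [X in X * _]patchE (ifN _ _ Ix) mul0e if_same.
have [cx xd] := Ix.
rewrite (@leb_integral_support _ (eitv x%:E d)) //; last first.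
  move=> t _ xt; rewrite triangleE; case: ifPn => // lxt.
  rewrite [X in _ * X]patchE ifN ?mule0//; apply/negP => /set_mem[_ td].
  by apply: xt; split.
apply: eq_leb_integral => t [xt td].
rewrite triangleE -lte_fin xt !patchE !mem_set//.
by split => //; exact: lt_trans xt.
Qed.

Let triangle_col c d p q (t : R) :
  \int[mu]_x triangle (eitv c d) p q (x, t) =
  ((fun t => \int[mu]_(x in eitv c t%:E) (p x * q t)) \_ (eitv c d)) t.
Proof.
rewrite patchE; case: ifPn => [/set_mem It|It]; last first.
  rewrite -[RHS](@integral0 _ LR _ mu setT); apply: eq_leb_integral => x _.
  by rewrite triangleE [X in _ * X]patchE (ifN _ _ It) mule0 if_same.
have [ct td] := It.
rewrite (@leb_integral_support _ (eitv c t%:E)) //; last first.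
  move=> x _ xt; rewrite triangleE; case: ifPn => // lxt.
  rewrite patchE ifN ?mul0e//; apply/negP => /set_mem[cx _].
  by apply: xt; split.
apply: eq_leb_integral => x [cx xt].
rewrite triangleE -lte_fin xt !patchE !mem_set//.
by split => //; exact: lt_trans td.
Qed.

Let triangle_ge0 c d p q : (forall x, eitv c d x -> 0 <= p x) ->
  (forall x, eitv c d x -> 0 <= q x) -> forall z, 0 <= triangle (eitv c d) p q z.
Proof.
move=> p0 q0 [x t]; rewrite triangleE; case: ifP => // _.
by rewrite !patchE; apply: mule_ge0; case: ifPn => // /set_mem; [exact: p0|exact: q0].
Qed.

Let double_tonelli c d p q :
  leb_measurable (eitv c d) p -> leb_measurable (eitv c d) q ->
  (forall x, eitv c d x -> 0 <= p x) -> (forall x, eitv c d x -> 0 <= q x) ->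
  \int[mu]_(x in eitv c d) \int[mu]_(t in eitv x%:E d) (p x * q t) =
  \int[mu]_(t in eitv c d) \int[mu]_(x in eitv c t%:E) (p x * q t).
Proof.
move=> mp mq p0 q0.
rewrite -(leb_integral_patchS _ (@subsetT _ _)) -[RHS](leb_integral_patchS _ (@subsetT _ _)).
under eq_leb_integral do rewrite -triangle_row.
under [RHS]eq_leb_integral do rewrite -triangle_col.
exact: (@fubini_tonelli _ _ LR LR R smu smu (triangle (eitv c d) p q)
  (measurable_triangle_fun mp mq) (triangle_ge0 p0 q0)).
Qed.

Lemma triangle_tonelli c d p q :
  leb_measurable (eitv c d) p -> leb_measurable (eitv c d) q ->
  (forall x, eitv c d x -> 0 <= p x) -> (forall x, eitv c d x -> 0 <= q x) ->
  \int[mu]_(x in eitv c d) (p x * \int[mu]_(t in eitv x%:E d) q t) =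
  \int[mu]_(t in eitv c d) (q t * \int[mu]_(x in eitv c t%:E) p x).
Proof.
move=> mp mq p0 q0.
have mI := leb_set_eitv c d.
transitivity (\int[mu]_(x in eitv c d) \int[mu]_(t in eitv x%:E d) (p x * q t)).
  apply: eq_leb_integral => x Ix; rewrite ge0_leb_integralZl //.
  - exact: leb_set_eitv.
  - exact: (leb_measurableS mI (eitv_tail Ix)).
  - by move=> t /(eitv_tail Ix); exact: q0.
  - exact: p0.
rewrite double_tonelli//; apply: eq_leb_integral => t It.
under eq_leb_integral do rewrite muleC.
rewrite ge0_leb_integralZl//.
- exact: leb_set_eitv.
- exact: (leb_measurableS mI (eitv_head It)).
- by move=> x /(eitv_head It); exact: p0.
- exact: q0.
Qed.

Lemma leb_measurable_tail c d q : leb_measurable (eitv c d) q ->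
  leb_measurable (eitv c d) (fun x => \int[mu]_(t in eitv x%:E d) q t).
Proof.
have ge0_tail g : leb_measurable (eitv c d) g -> (forall x, 0 <= g x) ->
    leb_measurable (eitv c d) (fun x => \int[mu]_(t in eitv x%:E d) g t).
  move=> mg g0.
  have m1 : leb_measurable (eitv c d) (fun=> 1) by exact: leb_measurable_cst.
  have h : measurable_fun (setT : set LR)
      (fun x => \int[smu]_t triangle (eitv c d) (fun=> 1) g (x, t)).
    apply: (@measurable_fun_fubini_tonelli_F _ _ LR LR R smu).
      exact: measurable_triangle_fun.
    exact: triangle_ge0.
  have : leb_measurable (eitv c d)
      (fun x => \int[smu]_t triangle (eitv c d) (fun=> 1) g (x, t)).
    by move: h; apply: (leb_measurableS leb_setT).
  apply: eq_measurable_fun => x /set_mem Ix.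
  rewrite triangle_row patchE mem_set//; apply: eq_leb_integral => t _.
  by rewrite mul1e.
move=> mq.
have mqp : leb_measurable (eitv c d) q^\+ by exact: (@measurable_funepos _ LR).
have mqn : leb_measurable (eitv c d) q^\- by exact: (@measurable_funeneg _ LR).
have := leb_measurableB (ge0_tail _ mqp (funepos_ge0 q)) (ge0_tail _ mqn (funeneg_ge0 q)).
apply: eq_measurable_fun => t _.
by rewrite [RHS](@integralE _ LR).
Qed.

Lemma leb_measurable_head c d p : leb_measurable (eitv c d) p ->
  leb_measurable (eitv c d) (fun t => \int[mu]_(x in eitv c t%:E) p x).
Proof.
have ge0_head g : leb_measurable (eitv c d) g -> (forall x, 0 <= g x) ->
    leb_measurable (eitv c d) (fun t => \int[mu]_(x in eitv c t%:E) g x).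
  move=> mg g0.
  have m1 : leb_measurable (eitv c d) (fun=> 1) by exact: leb_measurable_cst.
  have h : measurable_fun (setT : set LR)
      (fun t => \int[smu]_x triangle (eitv c d) g (fun=> 1) (x, t)).
    apply: (@measurable_fun_fubini_tonelli_G _ _ LR LR R smu).
      exact: measurable_triangle_fun.
    exact: triangle_ge0.
  have : leb_measurable (eitv c d)
      (fun t => \int[smu]_x triangle (eitv c d) g (fun=> 1) (x, t)).
    by move: h; apply: (leb_measurableS leb_setT).
  apply: eq_measurable_fun => t /set_mem It.
  rewrite triangle_col patchE mem_set//; apply: eq_leb_integral => x _.
  by rewrite mule1.
move=> mp.
have mpp : leb_measurable (eitv c d) p^\+ by exact: (@measurable_funepos _ LR).
have mpn : leb_measurable (eitv c d) p^\- by exact: (@measurable_funeneg _ LR).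
have := leb_measurableB (ge0_head _ mpp (funepos_ge0 p)) (ge0_head _ mpn (funeneg_ge0 p)).
apply: eq_measurable_fun => t _.
by rewrite [RHS](@integralE _ LR).
Qed.

Let triangle_integrable c d p q :
  leb_measurable (eitv c d) p -> leb_measurable (eitv c d) q ->
  \int[mu]_(t in eitv c d) (`|q t| * \int[mu]_(x in eitv c t%:E) `|p x|) < +oo ->
  (smu \x smu).-integrable (setT : set (LR * LR)) (triangle (eitv c d) p q).
Proof.
move=> mp mq pq; have mK := measurable_triangle_fun mp mq.
apply: (iffRL (@integrable21ltyP _ _ LR LR R smu smu _ mK)).
move: pq; congr (_ < +oo).
rewrite -(leb_integral_patchS _ (@subsetT _ (eitv c d))).
apply: eq_leb_integral => t _.
transitivity (\int[mu]_x triangle (eitv c d) (abse \o p) (abse \o q) (x, t)).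
  rewrite triangle_col !patchE; case: ifPn => // /set_mem It.
  under [RHS]eq_leb_integral do rewrite muleC /=.
  rewrite ge0_leb_integralZl//; first exact: leb_set_eitv.
  exact: (leb_measurableS (leb_set_eitv c d) (eitv_head It) (leb_measurable_abse mp)).
apply: eq_leb_integral => x _.
rewrite !triangleE !patchE; case: (x < t)%R; last by rewrite abse0.
by rewrite abseM; congr (_ * _); case: ifP => // _; rewrite abse0.
Qed.

Let double_fubini c d p q :
  leb_measurable (eitv c d) p -> leb_measurable (eitv c d) q ->
  \int[mu]_(t in eitv c d) (`|q t| * \int[mu]_(x in eitv c t%:E) `|p x|) < +oo ->
  [/\ leb_measurable (eitv c d) (fun x => \int[mu]_(t in eitv x%:E d) (p x * q t)),
      leb_measurable (eitv c d) (fun t => \int[mu]_(x in eitv c t%:E) (p x * q t)) &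
      \int[mu]_(x in eitv c d) \int[mu]_(t in eitv x%:E d) (p x * q t) =
      \int[mu]_(t in eitv c d) \int[mu]_(x in eitv c t%:E) (p x * q t)].
Proof.
move=> mp mq pq; have iK := triangle_integrable mp mq pq; split.
- have : leb_measurable (eitv c d) (fubini_F smu (triangle (eitv c d) p q)).
    apply: (leb_measurableS leb_setT) => //.
    exact: (@measurable_fubini_F _ _ LR LR R smu smu _ iK).
  apply: eq_measurable_fun => x /set_mem Ix.
  by rewrite /fubini_F triangle_row patchE mem_set.
- have : leb_measurable (eitv c d) (fubini_G smu (triangle (eitv c d) p q)).
    apply: (leb_measurableS leb_setT) => //.
    exact: (@measurable_fubini_G _ _ LR LR R smu smu _ iK).
  apply: eq_measurable_fun => t /set_mem It.
  by rewrite /fubini_G triangle_col patchE mem_set.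
- rewrite -(leb_integral_patchS _ (@subsetT _ _)) -[RHS](leb_integral_patchS _ (@subsetT _ _)).
  under eq_leb_integral do rewrite -triangle_row.
  under [RHS]eq_leb_integral do rewrite -triangle_col.
  exact: (@Fubini _ _ LR LR R smu smu _ iK).
Qed.

(** Almost everywhere finiteness of [p] and [q] is what allows the factor
    depending on the outer variable to be taken out of the inner integral. *)
Lemma triangle_fubini c d p q :
  leb_measurable (eitv c d) p -> leb_measurable (eitv c d) q ->
  {ae mu, forall x, eitv c d x -> p x \is a fin_num} ->
  {ae mu, forall x, eitv c d x -> q x \is a fin_num} ->
  (forall t, eitv c d t -> leb_integrable (eitv c t%:E) p) ->
  (forall x, eitv c d x -> leb_integrable (eitv x%:E d) q) ->
  \int[mu]_(t in eitv c d) (`|q t| * \int[mu]_(x in eitv c t%:E) `|p x|) < +oo ->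
  \int[mu]_(x in eitv c d) (p x * \int[mu]_(t in eitv x%:E d) q t) =
  \int[mu]_(t in eitv c d) (q t * \int[mu]_(x in eitv c t%:E) p x).
Proof.
move=> mp mq pae qae pint qint pq.
have mI := leb_set_eitv c d.
transitivity (\int[mu]_(x in eitv c d) \int[mu]_(t in eitv x%:E d) (p x * q t)).
  apply: ae_eq_leb_integral.
  - exact: mI.
  - apply: leb_measurableM; [exact: mp|exact: leb_measurable_tail].
  - by have [] := double_fubini mp mq pq.
  - apply: aeS pae => x px Ix; have pxf := px Ix.
    rewrite -(fineK pxf) leb_integralZl; first by [].
      exact: leb_set_eitv.
    exact: qint.
have [_ _ ->] := double_fubini mp mq pq.
symmetry; apply: ae_eq_leb_integral.
- exact: mI.
- apply: leb_measurableM; [exact: mq|exact: leb_measurable_head].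
- by have [] := double_fubini mp mq pq.
- apply: aeS qae => t qt It; have qtf := qt It.
  under [RHS]eq_leb_integral do rewrite muleC.
  rewrite -(fineK qtf) leb_integralZl; first by [].
    exact: leb_set_eitv.
  exact: pint.
Qed.

End triangle.

(** * The weight and its primitive *)

Section weights.
Context {R : realType}.
Local Notation mu := (leb R).
Implicit Types (f g v : R -> \bar R) (c d : \bar R).

Lemma leb_ae_ex (a b : R) (P : R -> Prop) : (a < b)%R ->
  {ae mu, forall x, P x} -> exists2 x, (a < x < b)%R & P x.
Proof.
move=> ab [N [mN N0 PN]]; apply: contrapT => abP.
have abN : eitv a%:E b%:E `<=` N.
  move=> x [ax xb]; apply: PN => Px; apply: abP; exists x => //.
  by apply/andP; rewrite -!lte_fin.
have : mu (eitv a%:E b%:E) <= mu N.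
  by apply: le_measure => //; rewrite inE//; exact: leb_set_eitv.
by rewrite N0 (leb_eitv (ltW ab)) lee_fin subr_le0 leNgt ab.
Qed.

Lemma eitv_nonempty c d : c < d -> exists x, eitv c d x.
Proof.
case: c d => [c| |] [d| |] //.
- rewrite lte_fin => cd; exists ((c + d) / 2)%R.
  by split; rewrite lte_fin; lra.
- by move=> _; exists (c + 1)%R; split; rewrite ?ltry// lte_fin ltrDl.
- by move=> _; exists (d - 1)%R; split; rewrite ?ltNyr// lte_fin ltrBlDr ltrDl.
- by move=> _; exists 0%R; split; rewrite ?ltNyr ?ltry.
Qed.

Lemma eitv_lt_ex c d x : eitv c d x ->
  (exists2 y, eitv c d y & (y < x)%R) /\ (exists2 y, eitv c d y & (x < y)%R).
Proof.
by move/rat_between_eitv => [p [q [Ip Iq px xq]]]; split; [exists (ratr p)|exists (ratr q)].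
Qed.

Lemma leb_integral_eq0 (D : set R) f : leb_set D -> leb_measurable D f ->
  \int[mu]_(x in D) `|f x| = 0 -> {ae mu, forall x, D x -> f x = 0}.
Proof. by move=> mD mf; move/(@ae_eq_integral_abs _ (leb_line R) R mu D mD f mf). Qed.

Lemma ereal_at_left_proper d : ProperFilter (ereal_at_left d).
Proof. by case: d => [r| |] /=; exact: _. Qed.

Lemma near_ereal_at_left c d : c < d ->
  \forall b \near ereal_at_left d, eitv c d b.
Proof.
move=> /eitv_nonempty[x [cx xd]].
case: d xd => [r| |] xd /=.
- near=> b; split.
    rewrite (lt_trans cx)// lte_fin; near: b.
    by apply: nbhs_left_gt; rewrite -lte_fin.
  by rewrite lte_fin; near: b; exact: nbhs_left_lt.
- exists x; split; first exact: num_real.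
  by move=> b xb; split; [rewrite (lt_trans cx)// lte_fin|rewrite ltry].
- by rewrite ltNge leNye in xd.
Unshelve. all: by end_near. Qed.

Definition weight c d v : Prop :=
  [/\ c < d, leb_measurable (eitv c d) v,
      {ae mu, forall x, eitv c d x -> 0 < v x},
      L1loc_left c d v &
      \int[mu]_(t in eitv c b%:E) v t @[b --> ereal_at_left d] --> +oo].

(** For the weight itself this is its primitive [V], since [v] is positive
    almost everywhere (lemma [massE]). The absolute value makes the same
    function serve for the elements of Cs. *)
Definition mass c v (x : R) : \bar R := \int[mu]_(t in eitv c x%:E) `|v t|.

Context (c d : \bar R) (v : R -> \bar R) (hv : weight c d v).
Local Notation I := (eitv c d).
Local Notation V := (mass c v).

Let mI : leb_set I. Proof. exact: leb_set_eitv. Qed.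
Let mv : leb_measurable I v. Proof. by case: hv. Qed.

Lemma massE x : I x -> \int[mu]_(t in eitv c x%:E) v t = V x.
Proof.
move=> Ix; have [_ _ v0 _ _] := hv; apply: ae_eq_leb_integral.
- exact: leb_set_eitv.
- exact: (leb_measurableS mI (eitv_head Ix)).
- exact/leb_measurable_abse/(leb_measurableS mI (eitv_head Ix)).
- by apply: aeS v0 => t vt /(eitv_head Ix) /vt vt0; rewrite gee0_abs// ltW.
Qed.

Lemma mass_lty x : I x -> V x < +oo.
Proof. by have [_ _ _ vx _] := hv => /vx. Qed.

Lemma mass_ge0 x : 0 <= V x.
Proof. exact: leb_integral_abse_ge0. Qed.

Lemma mass_gt0 x : I x -> 0 < V x.
Proof.
move=> Ix; rewrite lt_neqAle mass_ge0 andbT eq_sym; apply/eqP => V0.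
have mvx := leb_measurableS mI (eitv_head Ix) mv.
have ae0 := leb_integral_eq0 (leb_set_eitv c x%:E) mvx V0.
have [[y Iy yx] _] := eitv_lt_ex Ix.
have [_ _ v0 _ _] := hv.
have [z /andP[yz zx] [z1 z2]] := leb_ae_ex yx (aeI ae0 v0).
have cz : eitv c x%:E z.
  have [cy _] := Iy; split; last by rewrite lte_fin.
  by rewrite (lt_trans cy)// lte_fin.
by have := z2 (eitv_head Ix cz); rewrite z1// ltxx.
Qed.

Lemma mass_fin_num x : I x -> V x \is a fin_num.
Proof. by move=> Ix; rewrite ge0_fin_numE ?mass_lty// mass_ge0. Qed.

Lemma head_le g x y : leb_measurable I g -> I y -> (x <= y)%R ->
  \int[mu]_(t in eitv c x%:E) `|g t| <= \int[mu]_(t in eitv c y%:E) `|g t|.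
Proof.
move=> mg Iy xy; apply: ge0_subset_leb_integral.
- exact: leb_set_eitv.
- exact: leb_set_eitv.
- exact/leb_measurable_abse/(leb_measurableS mI (eitv_head Iy)).
- by [].
- by apply: eitvS.
Qed.

Lemma mass_le x y : I y -> (x <= y)%R -> V x <= V y.
Proof. exact: head_le. Qed.

Lemma leb_measurable_mass : leb_measurable I V.
Proof. exact/leb_measurable_head/leb_measurable_abse. Qed.

Lemma mass_unbounded (M : R) : exists2 b, I b & M%:E < V b.
Proof.
have [cd _ _ _ vlim] := hv.
have {}vlim : \forall b \near ereal_at_left d,
    M%:E < \int[mu]_(t in eitv c b%:E) v t.
  apply: (vlim [set y | M%:E < y]).
  by exists M; rewrite num_real.
have Fd := ereal_at_left_proper d.
have [b [Ib Mb]] := filter_ex (filterI (near_ereal_at_left cd) vlim).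
by exists b => //; rewrite -massE.
Qed.

End weights.

(** * Sobolev functions as tails of densities *)

Section classes.
Context {R : realType}.
Local Notation mu := (leb R).

Lemma L0_measurable (I : set R) (f : L0 I) : leb_measurable I f.
Proof. exact: Mfun_measurable. Qed.

Lemma L0_piE (I : set R) (f : Mfun I) :
  {ae mu, forall x, I x -> L0_fun (\pi_(L0 I) f)%qT x = f x}.
Proof.
have /eqmodP/asboolP := reprK (\pi_(L0 I) f)%qT.
by [].
Qed.

End classes.

Section representation.
Context {R : realType} (c d : \bar R) (v w : R -> \bar R).
Local Notation mu := (leb R).
Local Notation I := (eitv c d).
Local Notation V := (mass c v).
Hypothesis hv : weight c d v.
Hypothesis hw : forall x, I x -> w x = (V x)^-1.

Let mI : leb_set I. Proof. exact: leb_set_eitv. Qed.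
Let mv : leb_measurable I v. Proof. by case: hv. Qed.

Lemma weight_inv x : I x -> (w x)^-1 = V x.
Proof.
move=> Ix; rewrite hw//; have := mass_gt0 hv Ix.
rewrite -(fineK (mass_fin_num hv Ix)) lte_fin => V0.
by rewrite inver gt_eqF// inver invr_eq0 gt_eqF// invrK.
Qed.

Lemma W11normE (f : L0 I) : W11norm I v w f =
  \int[mu]_(x in I) (`|v x| * `|f x|) +
  \int[mu]_(x in I) (V x * `|weak_derivative f x|).
Proof.
rewrite /W11norm /L1norm; congr (_ + _); apply: eq_leb_integral => x Ix.
  by rewrite abseM.
by rewrite abseM weight_inv// gee0_abs// mass_ge0.
Qed.

Lemma W11norm_ge0 (f : L0 I) : 0 <= W11norm I v w f.
Proof. by apply: adde_ge0; exact: leb_integral_abse_ge0. Qed.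

(** The default value of the weak derivative is the class of the constant
    [+oo], for which the second term of the norm is infinite; a finite norm
    therefore provides a genuine weak derivative. *)
Lemma W11norm_weak_derivative (f : L0 I) : W11norm I v w f < +oo ->
  is_weak_derivative I f (weak_derivative f).
Proof.
move=> Nf; have [fg|fg] := pselect (exists g : L0 I, is_weak_derivative I f g).
  exact: (xgetPex (L0_cst I +oo) fg).
exfalso; move: Nf; apply/negP; rewrite -leNgt leye_eq; apply/eqP.
rewrite W11normE.
have -> : weak_derivative f = L0_cst I +oo.
  by apply: xgetPN => g; apply: contra_not fg => ?; exists g.
suff -> : \int[mu]_(x in I) (V x * `|(L0_cst I +oo : L0 I) x|) = +oo.
  by rewrite addey// gt_eqF// (lt_le_trans (ltNyr 0))// leb_integral_ge0// => x _; apply: mule_ge0.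
transitivity (\int[mu]_(x in I) (+oo : \bar R)).
  apply: ae_eq_leb_integral => //.
  - apply: leb_measurableM; first exact: leb_measurable_mass.
    exact/leb_measurable_abse/L0_measurable.
  - exact: leb_measurable_cst.
  - apply: aeS (L0_piE (Mfun_cst I +oo)) => x xoo Ix.
    by rewrite xoo//= gt0_muley// (mass_gt0 hv).
rewrite leb_integral_cst// gt0_mulye//.
have [cd _ _ _ _] := hv.
have [x Ix] := eitv_nonempty cd.
have [_ [y Iy xy]] := eitv_lt_ex Ix.
apply: lt_le_trans (_ : mu (eitv x%:E y%:E) <= _).
  by rewrite leb_eitv ?ltW// lte_fin subr_gt0.
by apply: le_measure; rewrite ?inE; [exact: leb_set_eitv|exact: mI|exact: eitv_sub].
Qed.

(** [V] is bounded below by [V x > 0] on the tail from [x]. *)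
Lemma tail_integrable (q : R -> \bar R) x : leb_measurable I q ->
  \int[mu]_(t in I) (V t * `|q t|) < +oo -> I x ->
  leb_integrable (eitv x%:E d) q.
Proof.
move=> mq qV Ix; have mxd := leb_set_eitv x%:E d.
have mqx := leb_measurableS mI (eitv_tail Ix) mq.
apply/leb_integrableP; split => //.
have V0 := mass_gt0 hv Ix.
have mVq : leb_measurable I (fun t => V t * `|q t|).
  by apply: leb_measurableM; [exact: leb_measurable_mass|exact: leb_measurable_abse].
have : V x * \int[mu]_(t in eitv x%:E d) `|q t| < +oo.
  apply: le_lt_trans qV.
  rewrite -(ge0_leb_integralZl mxd (leb_measurable_abse mqx)
    (fun t _ => abse_ge0 _) (ltW V0)).
  apply: (@le_trans _ _ (\int[mu]_(t in eitv x%:E d) (V t * `|q t|))).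
    apply: ge0_le_leb_integral => //.
    - by move=> t _; apply: mule_ge0 => //; exact: mass_ge0.
    - apply: leb_measurableM; first exact: leb_measurable_cst.
      exact: leb_measurable_abse.
    - exact: (leb_measurableS mI (eitv_tail Ix)).
    - move=> t xt; rewrite lee_wpmul2r//; apply: (mass_le hv (eitv_tail Ix xt)).
      by case: xt => + _; rewrite lte_fin => /ltW.
  apply: ge0_subset_leb_integral => //.
  - by move=> t _; apply: mule_ge0 => //; exact: mass_ge0.
  - exact: eitv_tail.
rewrite -(fineK (mass_fin_num hv Ix)).
have : 0 <= \int[mu]_(t in eitv x%:E d) `|q t| by exact: leb_integral_abse_ge0.
have : (0 < fine (V x))%R by rewrite -lte_fin fineK// (mass_fin_num hv Ix).
case: (\int[mu]_(t in _) _) => [r _ _ _|V1 _|]; first by rewrite ltry.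
  by rewrite gt0_muley ?lte_fin.
by rewrite leNgt ltNyr.
Qed.

Lemma density_ae_fin_num (q : R -> \bar R) : leb_measurable I q ->
  \int[mu]_(t in I) (V t * `|q t|) < +oo ->
  {ae mu, forall t, I t -> q t \is a fin_num}.
Proof.
move=> mq qV; have iVq : leb_integrable I (fun t => V t * `|q t|).
  apply/leb_integrableP; split.
    by apply: leb_measurableM; [exact: leb_measurable_mass|exact: leb_measurable_abse].
  apply: le_lt_trans qV; rewrite le_eqVlt; apply/orP; left; apply/eqP.
  apply: eq_leb_integral => t _; rewrite gee0_abs//.
  by apply: mule_ge0 => //; exact: mass_ge0.
apply: aeS (leb_integrable_ae mI iVq) => t + It => /(_ It).
have := mass_gt0 hv It; case: (q t) => //=.
- by move=> V0; rewrite gt0_muley.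
- by move=> V0; rewrite gt0_muley.
Qed.

Lemma leb_integral_split (q : R -> \bar R) (a d' : \bar R) (b : R) :
  a < b%:E -> b%:E < d' -> leb_integrable (eitv a d') q ->
  \int[mu]_(t in eitv a d') q t =
  \int[mu]_(t in eitv a b%:E) q t + \int[mu]_(t in eitv b%:E d') q t.
Proof.
move=> ab bd iq; have mad := leb_set_eitv a d'.
have mab := leb_set_eitv a b%:E; have mbd := leb_set_eitv b%:E d'.
have sab : eitv a b%:E `<=` eitv a d' by apply: eitvS => //; exact: ltW.
have sbd : eitv b%:E d' `<=` eitv a d' by apply: eitvS => //; exact: ltW.
have i1 := leb_integrable_patchS mab mad (leb_integrableS mad mab sab iq).
have i2 := leb_integrable_patchS mbd mad (leb_integrableS mad mbd sbd iq).
rewrite -(leb_integral_patchS _ sab) -(leb_integral_patchS _ sbd).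
rewrite -leb_integralD//; apply: ae_eq_leb_integral => //.
- exact: leb_integrable_measurable.
- by apply: leb_measurableD; exact: leb_integrable_measurable.
- apply: aeS (leb_ae_neq b) => t tb [at_ td].
  rewrite !patchE; have [tlb|blt|//] := ltgtP t b.
    rewrite mem_set; last by split => //; rewrite lte_fin.
    rewrite memNset ?adde0//; case; rewrite lte_fin => /(lt_trans tlb).
    by rewrite ltxx.
  rewrite memNset; last by case=> _; rewrite lte_fin => /(lt_trans blt); rewrite ltxx.
  by rewrite mem_set ?add0e//; split => //; rewrite lte_fin.
Qed.

(** This kills the constant of integration: integrating the bound against [v]
    over [(c, b)] and exchanging the integrals shows that [|L| * V b] is
    at most the norm of [f], while [V] is unbounded. *)
Lemma W11_vanishing (f : L0 I) (L : \bar R) : W11norm I v w f < +oo ->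
  {ae mu, forall x, I x ->
    `|L| <= `|f x| + \int[mu]_(t in eitv x%:E d) `|weak_derivative f t|} ->
  L = 0.
Proof.
move=> Nf HL.
have mf : leb_measurable I f by exact: L0_measurable.
set D := weak_derivative f in HL *.
have mD : leb_measurable I D by exact: L0_measurable.
have mT : leb_measurable I (fun x => \int[mu]_(t in eitv x%:E d) `|D t|).
  exact/leb_measurable_tail/leb_measurable_abse.
have LV b : I b -> `|L| * V b <= W11norm I v w f.
  move=> Ib; rewrite /mass -(ge0_leb_integralZl (leb_set_eitv c b%:E)
    (leb_measurable_abse (leb_measurableS mI (eitv_head Ib) mv))
    (fun t _ => abse_ge0 _) (abse_ge0 L)).
  apply: (@le_trans _ _ (\int[mu]_(x in I) (`|L| * `|v x|))).
    apply: ge0_subset_leb_integral.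
    - exact: leb_set_eitv.
    - exact: mI.
    - apply: leb_measurableM; first exact: leb_measurable_cst.
      exact: leb_measurable_abse.
    - by move=> x _; apply: mule_ge0.
    - exact: eitv_head.
  apply: (@le_trans _ _ (\int[mu]_(x in I) (`|v x| * `|f x| +
      `|v x| * \int[mu]_(t in eitv x%:E d) `|D t|))).
    apply: ae_ge0_le_leb_integral.
    - exact: mI.
    - by move=> x _; apply: mule_ge0.
    - apply: leb_measurableM; first exact: leb_measurable_cst.
      exact: leb_measurable_abse.
    - move=> x _; apply: adde_ge0; apply: mule_ge0 => //.
      exact: leb_integral_abse_ge0.
    - by apply: leb_measurableD; apply: leb_measurableM => //; exact: leb_measurable_abse.
    - apply: aeS HL => x HLx Ix; rewrite -ge0_muleDr//; last exact: leb_integral_abse_ge0.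
      by rewrite muleC lee_wpmul2l// HLx.
  rewrite ge0_leb_integralD//.
  - rewrite W11normE; apply: leeD => //.
    rewrite triangle_tonelli//.
    + by under eq_leb_integral do rewrite muleC.
    + exact: leb_measurable_abse.
    + exact: leb_measurable_abse.
  - by apply: leb_measurableM; exact: leb_measurable_abse.
  - by move=> x _; apply: mule_ge0 => //; exact: leb_integral_abse_ge0.
  - by apply: leb_measurableM => //; exact: leb_measurable_abse.
have Nfin : W11norm I v w f \is a fin_num by rewrite ge0_fin_numE// W11norm_ge0.
apply/eqP; rewrite -abse_eq0; apply/negP => /negP L0.
have {}L0 : 0 < `|L| by rewrite lt_neqAle eq_sym L0 abse_ge0.
move: L0 LV; generalize `|L| => l l0 LV.
have [b Ib bV] := mass_unbounded hv (fine (W11norm I v w f) / fine l).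
have := LV _ Ib; have := mass_gt0 hv Ib; move: bV.
rewrite -(fineK Nfin) -(fineK (mass_fin_num hv Ib)).
case: l l0 {LV} => [l| |] //=.
- rewrite lte_fin => l0; rewrite lte_fin ltr_pdivrMr// => bV _.
  by rewrite -EFinM lee_fin leNgt mulrC bV.
- by move=> _ _ V0; rewrite gt0_mulye ?leye_eq.
Qed.

(** The increments of [f] are those of the tail of its weak derivative, so [f]
    is that tail up to a constant, which [W11_vanishing] shows to be 0. *)
Lemma W11_repr (f : L0 I) : W11norm I v w f < +oo ->
  exists2 q : R -> \bar R, leb_measurable I q &
    \int[mu]_(t in I) (V t * `|q t|) <= W11norm I v w f /\
    {ae mu, forall x, I x -> f x = \int[mu]_(t in eitv x%:E d) q t}.
Proof.
move=> Nf; have fD := W11norm_weak_derivative Nf.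
set D := weak_derivative f in fD.
have mD : leb_measurable I D by exact: L0_measurable.
have DV : \int[mu]_(t in I) (V t * `|D t|) <= W11norm I v w f.
  by rewrite W11normE leeDr//; apply: leb_integral_ge0 => x _; apply: mule_ge0.
have Dtail x := tail_integrable mD (le_lt_trans DV Nf) (x := x).
have Tfin x : I x -> \int[mu]_(t in eitv x%:E d) D t \is a fin_num.
  by move=> Ix; apply: leb_integrable_fin_num; [exact: leb_set_eitv|exact: Dtail].
(* the sign: [f] decreases by the integral of its density *)
exists (fun x => - D x); first exact: leb_measurableN.
split; first by under eq_leb_integral do rewrite abseN.
(* [Z] has full measure, so it meets every interval *)
have [Z Zae Zinc] := weak_derivative_ae_increment (L0_measurable f) mD fD.
have [cd _ _ _ _] := hv.
have [a [Ia Za]] : exists a, I a /\ Z a.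
  have [x0 Ix0] := eitv_nonempty cd.
  have [_ [x1 Ix1 x01]] := eitv_lt_ex Ix0.
  have [a /andP[a0 a1] Za] := leb_ae_ex x01 Zae.
  have Ia : I a by apply: (eitv_sub Ix0 Ix1); split; rewrite lte_fin.
  by exists a; split => //; exact: Za.
have fZ x : I x -> Z x -> f x \is a fin_num.
  move=> Ix Zx; have [_ [x1 Ix1 xx1]] := eitv_lt_ex Ix.
  have [y /andP[xy yx1] Zy] := leb_ae_ex xx1 Zae.
  have Iy : I y by apply: (eitv_sub Ix Ix1); split; rewrite lte_fin.
  by have [] := Zinc x y Zx (Zy Iy) Ix Iy xy.
have inc p r : I p -> Z p -> I r -> Z r -> (p < r)%R ->
    f p + \int[mu]_(t in eitv p%:E d) D t = f r + \int[mu]_(t in eitv r%:E d) D t.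
  move=> Ip Zp Ir Zr pr; have [fp fr frp] := Zinc p r Zp Zr Ip Ir pr.
  rewrite (@leb_integral_split _ _ _ r) -?frp ?lte_fin//; [|by case: Ir|exact: Dtail].
  move: fp fr (Tfin r Ir); case: (f p) => // y _; case: (f r) => // z _.
  case: (\int[mu]_(t in _) _) => // u _.
  by rewrite -EFinB -!EFinD; congr EFin; lra.
pose L := f a + \int[mu]_(t in eitv a%:E d) D t.
have Lx x : I x -> Z x -> f x + \int[mu]_(t in eitv x%:E d) D t = L.
  move=> Ix Zx; rewrite /L; have [xa|ax|->//] := ltgtP x a; first exact: inc.
  by symmetry; exact: inc.
have L0 : L = 0.
  apply: (W11_vanishing Nf); apply: aeS Zae => x Zx Ix.
  rewrite -(Lx x Ix (Zx Ix)); apply: le_trans (lee_abs_add _ _) _.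
  apply: leeD => //; apply: le_abse_leb_integral; first exact: leb_set_eitv.
  exact: (leb_measurableS mI (eitv_tail Ix)).
apply: aeS Zae => x Zx Ix.
rewrite leb_integralN; [|exact: leb_set_eitv|exact: Dtail].
have := Lx x Ix (Zx Ix); rewrite L0.
move: (fZ x Ix (Zx Ix)) (Tfin x Ix).
case: (f x) => // r _; case: (\int[mu]_(t in _) _) => // s _.
by rewrite -EFinD => -[rs]; congr EFin; lra.
Qed.

End representation.

(** * Upper bounds for the pairings *)

Section upper_bounds.
Context {R : realType} (c d : \bar R) (v w : R -> \bar R).
Local Notation mu := (leb R).
Local Notation I := (eitv c d).
Local Notation V := (mass c v).
Hypothesis hv : weight c d v.
Hypothesis hw : forall x, I x -> w x = (V x)^-1.
Implicit Types (k q : R -> \bar R) (f : L0 I).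

Let mI : leb_set I. Proof. exact: leb_set_eitv. Qed.

Lemma L1loc_left_integrable k t : leb_measurable I k -> L1loc_left c d k ->
  I t -> leb_integrable (eitv c t%:E) k.
Proof.
move=> mk k1 It; apply/leb_integrableP; split; last exact: k1.
exact: (leb_measurableS mI (eitv_head It)).
Qed.

Lemma head_ae_fin_num k : leb_measurable I k -> L1loc_left c d k ->
  {ae mu, forall x, I x -> k x \is a fin_num}.
Proof.
move=> mk k1.
have : {ae mu, forall x, forall r : rat, I (ratr r) ->
    eitv c (ratr r)%:E x -> k x \is a fin_num}.
  apply: ae_forall_countable => r.
  have [Ir|Ir] := pselect (I (ratr r)); last exact: aeW.
  have ik := L1loc_left_integrable mk k1 Ir.
  by apply: aeS (leb_integrable_ae (leb_set_eitv _ _) ik) => x kx _.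
apply: aeS => x kx Ix; have [p [r [_ Ir _ xr]]] := rat_between_eitv Ix.
by apply: (kx r Ir); split; [case: Ix|rewrite lte_fin].
Qed.

Lemma density_bound (C : R) q k : leb_measurable I q -> leb_measurable I k ->
  (0 <= C)%R -> {ae mu, forall x, I x -> `|k x| <= C%:E * V x} ->
  \int[mu]_(t in I) (`|q t| * `|k t|) <=
  C%:E * \int[mu]_(t in I) (V t * `|q t|).
Proof.
move=> mq mk C0 kC; have mV := leb_measurable_mass hv.
have mVq : leb_measurable I (fun t => V t * `|q t|).
  by apply: leb_measurableM => //; exact: leb_measurable_abse.
have Vq0 t : I t -> 0 <= V t * `|q t|.
  by move=> It; apply: mule_ge0 => //; exact: mass_ge0.
rewrite -(ge0_leb_integralZl mI mVq Vq0) ?lee_fin//.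
apply: ae_ge0_le_leb_integral => //.
- by apply: leb_measurableM; exact: leb_measurable_abse.
- by move=> t It; apply: mule_ge0; [rewrite lee_fin|exact: Vq0].
- by apply: leb_measurableM => //; exact: leb_measurable_cst.
- apply: aeS kC => t kt It; rewrite muleA [leRHS]muleC lee_wpmul2l//.
  exact: kt.
Qed.

Lemma pairing_abse_le f q k : leb_measurable I q -> leb_measurable I k ->
  {ae mu, forall x, I x -> f x = \int[mu]_(t in eitv x%:E d) q t} ->
  L1norm I (fun x => f x * k x) <= \int[mu]_(t in I) (`|q t| * mass c k t).
Proof.
move=> mq mk fq; rewrite /L1norm /mass.
have mqa := leb_measurable_abse mq; have mka := leb_measurable_abse mk.
rewrite -triangle_tonelli//; apply: ae_ge0_le_leb_integral => //.
- apply: leb_measurable_abse; apply: leb_measurableM => //; exact: L0_measurable.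
- by move=> x _; apply: mule_ge0 => //; exact: leb_integral_abse_ge0.
- by apply: leb_measurableM => //; exact: leb_measurable_tail.
- apply: aeS fq => x fx Ix; rewrite fx// abseM muleC lee_wpmul2l//.
  apply: le_abse_leb_integral; first exact: leb_set_eitv.
  exact: (leb_measurableS mI (eitv_tail Ix)).
Qed.

Lemma strong_upper (C : R) f k : leb_measurable I k -> (0 <= C)%R ->
  {ae mu, forall x, I x -> mass c k x <= C%:E * V x} ->
  W11norm I v w f < +oo ->
  L1norm I (fun x => f x * k x) <= C%:E * W11norm I v w f.
Proof.
move=> mk C0 kC Nf; have [q mq [qN fq]] := W11_repr hv hw Nf.
apply: le_trans (pairing_abse_le mq mk fq) _.
apply: (@le_trans _ _ (\int[mu]_(t in I) (`|q t| * `|mass c k t|))).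
  apply: ge0_le_leb_integral => //.
  - by move=> t _; apply: mule_ge0 => //; exact: leb_integral_abse_ge0.
  - apply: leb_measurableM; first exact: leb_measurable_abse.
    exact/leb_measurable_head/leb_measurable_abse.
  - apply: leb_measurableM; first exact: leb_measurable_abse.
    exact/leb_measurable_abse/leb_measurable_head/leb_measurable_abse.
  - by move=> t _; rewrite lee_wpmul2l// lee_abs.
apply: le_trans (density_bound mq _ C0 _) _.
- exact/leb_measurable_head/leb_measurable_abse.
- by apply: aeS kC => x kx Ix; rewrite gee0_abs ?kx//; exact: leb_integral_abse_ge0.
by rewrite lee_wpmul2l// lee_fin.
Qed.

(** The bound [C'] on the primitive of [|k|] justifies the exchange of the
    integrals; the constant [C] of the conclusion comes from the primitive of
    [k] itself, where cancellation is possible. *)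
Lemma weak_upper (C C' : R) f k : leb_measurable I k -> L1loc_left c d k ->
  (0 <= C)%R -> (0 <= C')%R ->
  {ae mu, forall x, I x -> mass c k x <= C'%:E * V x} ->
  {ae mu, forall x, I x -> `|\int[mu]_(t in eitv c x%:E) k t| <= C%:E * V x} ->
  W11norm I v w f < +oo ->
  `|\int[mu]_(x in I) (f x * k x)| <= C%:E * W11norm I v w f.
Proof.
move=> mk k1 C0 C0' kC' kC Nf; have [q mq [qN fq]] := W11_repr hv hw Nf.
have qoo := le_lt_trans qN Nf.
have -> : \int[mu]_(x in I) (f x * k x) =
    \int[mu]_(t in I) (q t * \int[mu]_(x in eitv c t%:E) k x).
  rewrite -triangle_fubini.
  - apply: ae_eq_leb_integral => //.
    + by apply: leb_measurableM => //; exact: L0_measurable.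
    + by apply: leb_measurableM => //; exact: leb_measurable_tail.
    + by apply: aeS fq => x fx Ix; rewrite fx// muleC.
  - exact: mk.
  - exact: mq.
  - exact: head_ae_fin_num.
  - exact: (density_ae_fin_num hv).
  - by move=> t; exact: L1loc_left_integrable.
  - by move=> x; exact: (tail_integrable hv).
  - apply: (@le_lt_trans _ _ (\int[mu]_(t in I) (`|q t| * `|mass c k t|))).
      rewrite le_eqVlt; apply/orP; left; apply/eqP; apply: eq_leb_integral => t _.
      by rewrite (gee0_abs (mass_ge0 c k t)).
    apply: le_lt_trans (density_bound mq _ C0' _) _.
    + exact/leb_measurable_head/leb_measurable_abse.
    + by apply: aeS kC' => x kx Ix; rewrite gee0_abs ?kx//; exact: leb_integral_abse_ge0.
    + by rewrite lte_mul_pinfty// ge0_fin_numE// leb_integral_ge0// => t It; apply: mule_ge0.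
have mH := leb_measurable_head mk.
apply: le_trans (le_abse_leb_integral _ _) _ => //; first exact: leb_measurableM.
under eq_leb_integral do rewrite abseM.
apply: le_trans (density_bound mq mH C0 kC) _.
by rewrite lee_wpmul2l// lee_fin.
Qed.

End upper_bounds.

(** * Pairings with bounded functions vanishing near the right endpoint *)

Section vanishing_upper_bound.
Context {R : realType} (c d : \bar R) (v w : R -> \bar R).
Local Notation mu := (leb R).
Local Notation I := (eitv c d).
Local Notation V := (mass c v).
Hypothesis hv : weight c d v.
Hypothesis hw : forall x, I x -> w x = (V x)^-1.
Implicit Types (k q : R -> \bar R) (f : L0 I).

Let mI : leb_set I. Proof. exact: leb_set_eitv. Qed.

(** One sequence for finite and infinite [c], nonincreasing and tending to the
    left endpoint. *)
Lemma left_sequence x0 : I x0 -> exists2 a : nat -> R,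
  (forall n m, (n <= m)%N -> (a m <= a n)%R) /\ (forall n, I (a n)) &
  forall x, I x -> exists n, (a n < x)%R.
Proof.
move=> Ix0; have [cx0 x0d] := Ix0.
have [e e0 [ce lim]] : exists2 e : nat -> R,
    (forall n m, (n <= m)%N -> (e m <= e n)%R) /\ (forall n, (e n <= x0)%R) &
    (forall n, c < (e n)%:E) /\
    (forall x, c < x%:E -> exists n, (e n < x)%R).
  case: c cx0 => [r| |] cx0; last 1 first.
  - exists (fun n => x0 - n%:R)%R.
      split=> [n m nm|n]; first by rewrite lerB// ler_nat.
      by rewrite gerBl.
    split=> [n|x _]; first by rewrite ltNyr.
    exists (Num.truncn `|x0 - x|%R).+1; rewrite ltrBlDr -ltrBlDl.
    by rewrite (le_lt_trans (ler_norm _))// truncnS_gt.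
  - rewrite lte_fin in cx0; have r0 : (0 < x0 - r)%R by rewrite subr_gt0.
    exists (fun n => r + (x0 - r) / n.+1%:R)%R.
      split=> [n m nm|n].
        by rewrite lerD2l ler_pM2l// lef_pV2 ?posrE// ler_nat ltnS.
      rewrite -lerBrDl ler_pdivrMr// ler_peMr ?(ltW r0)//.
      by rewrite ler1n.
    split=> [n|x]; first by rewrite lte_fin ltrDl divr_gt0.
    rewrite lte_fin => rx; have rx0 : (0 < x - r)%R by rewrite subr_gt0.
    exists (Num.truncn ((x0 - r) / (x - r))%R).
    rewrite -ltrBrDl ltr_pdivrMr// mulrC -ltr_pdivrMr//.
    by rewrite truncnS_gt.
  - by rewrite ltNge leey in cx0.
exists e; last by move=> x [/lim].
split; first by case: e0.
move=> n; split; first exact: ce.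
by rewrite (le_lt_trans _ x0d)// lee_fin; case: e0.
Qed.

Lemma small_head k (e : R) : leb_measurable I k -> L1loc_left c d k ->
  (0 < e)%R -> exists2 a, I a & mass c k a <= e%:E.
Proof.
move=> mk k1 e0; have [cd _ _ _ _] := hv.
have [x0 Ix0] := eitv_nonempty cd.
have [a [nda Ia] alim] := left_sequence Ix0.
have mka : leb_measurable (eitv c x0%:E) (fun t => `|k t|).
  exact/leb_measurable_abse/(leb_measurableS mI (eitv_head Ix0)).
have ika : leb_integrable (eitv c x0%:E) (fun t => `|k t|).
  exact: (leb_integrable_abse (L1loc_left_integrable mk k1 Ix0)).
have G0 : mass c k x0 \is a fin_num by exact: (leb_integrable_fin_num (leb_set_eitv _ _) ika).
pose F n := eitv (a n)%:E x0%:E.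
have FU : \bigcup_n F n = eitv c x0%:E.
  apply/seteqP; split => [x [n _ [ax xx0]]|x [cx xx0]].
    by split => //; rewrite (lt_trans _ ax)//; case: (Ia n).
  have Ix : I x by split => //; rewrite (lt_trans xx0)//; case: Ix0.
  by have [n an] := alim x Ix; exists n => //; split => //; rewrite lte_fin.
have Fsub n : F n `<=` eitv c x0%:E by rewrite -FU; exact: bigcup_sup.
have : \int[mu]_(x in F i) `|k x| @[i --> \oo] --> mass c k x0.
  rewrite /mass -FU; apply: (@ge0_nondecreasing_set_cvg_integral _ (leb_line R)).
  - move=> n m nm; apply/subsetPset; apply: eitvS => //.
    by rewrite lee_fin nda.
  - by move=> n; exact: leb_set_eitv.
  - by move=> n; exact: (leb_measurableS (leb_set_eitv _ _) (Fsub n)).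
  - by [].
(* the integrals over [(a n, x0)] exhaust the integral over [(c, x0)], up to [e] *)
move=> /(_ [set y | (fine (mass c k x0) - e)%:E < y]) [].
  apply: open_nbhs_nbhs; split; first exact: open_ereal_gt_ereal.
  by rewrite /= -[ltRHS](fineK G0) lte_fin ltrBlDr ltrDl.
move=> n _ /(_ n (leqnn n)) /= Hn.
have [ax0|x0a] := ltP (a n) x0; last first.
  exists x0 => //; move: Hn; rewrite (_ : F n = set0); last first.
    apply/seteqP; split => // x [ax xx0]; move: (lt_trans ax xx0).
    by rewrite lte_fin ltNge x0a.
  rewrite integral_set0 lte_fin subr_lt0 => Ge.
  by rewrite -(fineK G0) lee_fin ltW.
exists (a n) => //; move: Hn G0; rewrite /mass.
rewrite (@leb_integral_split R _ c x0%:E (a n)) ?lte_fin//; last by case: (Ia n).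
rewrite -/(F n).
have := leb_integral_abse_ge0 (eitv c (a n)%:E) k.
have := leb_integral_abse_ge0 (F n) k.
case: (\int[mu]_(x in eitv c _) _) => [r1| |] //; case: (\int[mu]_(x in F n) _) => [r2| |] //.
by rewrite -EFinD /= !lee_fin lte_fin => _ _ + _; lra.
Qed.

Lemma bounded_pairing_le (M : R) b f k : leb_measurable I k ->
  L1loc_left c d k -> (0 <= M)%R -> I b ->
  {ae mu, forall x, I x -> `|f x| <= M%:E} ->
  {ae mu, forall x, I x -> (b < x)%R -> f x = 0} ->
  L1norm I (fun x => f x * k x) <= M%:E * mass c k b.
Proof.
move=> mk k1 M0 Ib fM fb.
have mcb := leb_set_eitv c b%:E.
have mka := leb_measurable_abse mk.
have mkb := leb_measurableS mI (eitv_head Ib) mka.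
have mkI : leb_measurable I ((fun t => `|k t|) \_ (eitv c b%:E)).
  exact: leb_measurable_patchS.
rewrite /mass -(ge0_leb_integralZl mcb mkb (fun t _ => abse_ge0 _)) ?lee_fin//.
rewrite -(leb_integral_patchS _ (eitv_head Ib)).
apply: ae_ge0_le_leb_integral.
- exact: mI.
- by move=> x _; exact: abse_ge0.
- by apply: leb_measurable_abse; apply: leb_measurableM => //; exact: L0_measurable.
- move=> x _; rewrite patchE; case: ifPn => // _; apply: mule_ge0 => //.
- apply: leb_measurable_patchS => //; apply: leb_measurableM => //.
  exact: leb_measurable_cst.
- apply: aeS (aeI (aeI fM fb) (leb_ae_neq b)) => x [[xM xb] xnb] Ix.
  rewrite patchE; have [xltb|bltx|//] := ltgtP x b.
    rewrite mem_set; last by case: Ix => cx _; split => //; rewrite lte_fin.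
    by rewrite abseM lee_wpmul2r// xM.
  rewrite xb// mul0e abse0; case: ifPn => // _.
  by apply: mule_ge0.
Qed.

(** The primitive of [|k|] may exceed every multiple of [V], so Fubini does
    not apply on all of [I]. First [k] is cut off at a point [b'] past the
    support of [f], where its primitive obeys the bound; then the primitive of
    the cut function [k'] is bounded by [C V] almost everywhere, since it is
    constant past [b'] and [V] increases. The integral is split at a point [a]
    close to [c]: the part on [(c, a)] is at most [M * \int_c^a |k|], and
    on [(a, d)] the integrals can be exchanged, with a boundary term
    [(\int_c^a k) * f a] of the same size. *)
Lemma vanishing_upper (C M : R) b f k : leb_measurable I k ->
  L1loc_left c d k -> (0 <= C)%R -> (0 <= M)%R -> I b ->
  {ae mu, forall x, I x -> `|f x| <= M%:E} ->
  {ae mu, forall x, I x -> (b < x)%R -> f x = 0} ->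
  {ae mu, forall x, I x -> `|\int[mu]_(t in eitv c x%:E) k t| <= C%:E * V x} ->
  W11norm I v w f < +oo ->
  `|\int[mu]_(x in I) (f x * k x)| <= C%:E * W11norm I v w f.
Proof.
move=> mk k1 C0 M0 Ib fM fb kC Nf; have [q mq [qN fq]] := W11_repr hv hw Nf.
have qoo := le_lt_trans qN Nf.
have mf : leb_measurable I f by exact: L0_measurable.
have [b' [Ib' bb' kCb']] : exists b', [/\ I b', (b < b')%R &
    `|\int[mu]_(t in eitv c b'%:E) k t| <= C%:E * V b'].
  have [_ [b1 Ib1 bb1]] := eitv_lt_ex Ib.
  have [b' /andP[bb' b'b1] kCb'] := leb_ae_ex bb1 kC.
  have Ib' : I b' by apply: (eitv_sub Ib Ib1); split; rewrite lte_fin.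
  by exists b'; split => //; exact: kCb'.
have mB := leb_set_eitv c b'%:E; have BI := eitv_head Ib'.
pose k' := k \_ (eitv c b'%:E).
have ik' : leb_integrable I k'.
  exact: (leb_integrable_patchS mB mI (L1loc_left_integrable mk k1 Ib')).
have mk' := leb_integrable_measurable ik'.
have k'k x : `|k' x| <= `|k x| by rewrite /k' patchE; case: ifP => // _; rewrite abse0.
have headI t : I t -> leb_integrable (eitv c t%:E) k'.
  move=> It; exact: (leb_integrableS mI (leb_set_eitv _ _) (eitv_head It) ik').
pose h t := fine (\int[mu]_(x in eitv c t%:E) k' x).
have hE t : I t -> \int[mu]_(x in eitv c t%:E) k' x = (h t)%:E.
  by move=> It; rewrite /h (fineK (leb_integrable_fin_num (leb_set_eitv _ _) (headI t It))).
have [K K0 kK] : exists2 K : R, (0 <= K)%R & \int[mu]_(x in I) `|k' x| = K%:E.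
  have := leb_integrable_fin_num mI (leb_integrable_abse ik').
  have := leb_integral_abse_ge0 I k'.
  by case: (\int[mu]_(x in I) _) => [K| |] // K0 _; exists K; rewrite -?lee_fin.
have headK (A : set R) : leb_set A -> A `<=` I -> \int[mu]_(x in A) `|k' x| <= K%:E.
  move=> mA AI; rewrite -kK; apply: ge0_subset_leb_integral => //.
  exact: leb_measurable_abse.
have hK t : I t -> (`|h t| <= K)%R.
  move=> It; rewrite -lee_fin -[leLHS]/(`|(h t)%:E|) -hE//.
  apply: le_trans (headK _ (leb_set_eitv c t%:E) (eitv_head It)).
  apply: le_abse_leb_integral; first exact: leb_set_eitv.
  exact: (leb_measurableS mI (eitv_head It)).
have mh : leb_measurable I (EFin \o h).
  have := leb_measurable_head mk'; apply: eq_measurable_fun => t /set_mem It.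
  by rewrite /= -hE.
have hC : {ae mu, forall t, I t -> `|(h t)%:E| <= C%:E * V t}.
  apply: aeS kC => t kt It; rewrite -hE//; have [tb'|b't] := leP t b'.
    rewrite (@eq_leb_integral _ _ _ k); first exact: kt.
    move=> x [cx xt]; rewrite /k' patchE mem_set//; split => //.
    by rewrite (lt_le_trans xt)// lee_fin.
  rewrite leb_integral_patchS; last by apply: eitvS => //; rewrite lee_fin ltW.
  apply: (le_trans kCb'); rewrite lee_wpmul2l ?lee_fin//.
  by apply: (mass_le hv It); exact: ltW.
have fkE : \int[mu]_(x in I) (f x * k x) = \int[mu]_(x in I) (f x * k' x).
  apply: ae_eq_leb_integral => //.
  - exact: leb_measurableM.
  - exact: leb_measurableM.
  - apply: aeS (aeI fb (leb_ae_neq b')) => x [xb xnb'] Ix.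
    rewrite /k' patchE; have [xltb|bltx|//] := ltgtP x b'.
      by rewrite mem_set//; case: Ix => cx _; split => //; rewrite lte_fin.
    by rewrite xb ?mul0e// (lt_trans bb').
have ifk : leb_integrable I (fun x => f x * k' x).
  apply/leb_integrableP; split; first exact: leb_measurableM.
  apply: (@le_lt_trans _ _ (\int[mu]_(x in I) (M%:E * `|k' x|))).
    apply: ae_ge0_le_leb_integral => //.
    - by apply: leb_measurable_abse; exact: leb_measurableM.
    - by move=> x _; apply: mule_ge0; rewrite ?lee_fin.
    - apply: leb_measurableM; first exact: leb_measurable_cst.
      exact: leb_measurable_abse.
    - by apply: aeS fM => x xM Ix; rewrite abseM lee_wpmul2r// xM.
  rewrite (ge0_leb_integralZl mI (leb_measurable_abse mk') (fun t _ => abse_ge0 _)) ?lee_fin//.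
  by rewrite kK -EFinM ltry.
rewrite fkE; apply/lee_addgt0Pr => e e0.
(* two error terms of size [eps * M], with 1 added in case [M = 0] *)
pose eps := (e / (2 * M + 1))%R.
have M1 : (0 < 2 * M + 1)%R by rewrite ltr_wpDl// mulr_ge0.
have eps0 : (0 < eps)%R by rewrite divr_gt0.
have epsM : (eps * M + eps * M <= e)%R.
  rewrite -mulrDr -mulrA -ler_pdivlMl; last exact: e0.
  rewrite mulVf ?gt_eqF// ler_pdivrMl// mulr1; lra.
have [a0 Ia0 a0k] := small_head mk k1 eps0.
have [a [Ia aa0 [fa faM]]] : exists a, [/\ I a, (a < a0)%R &
    f a = \int[mu]_(t in eitv a%:E d) q t /\ `|f a| <= M%:E].
  have [[y Iy ya0] _] := eitv_lt_ex Ia0.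
  have [a /andP[ya aa0] [fa faM]] := leb_ae_ex ya0 (aeI fq fM).
  have Ia : I a by apply: (eitv_sub Iy Ia0); split; rewrite lte_fin.
  by exists a; split => //; split; [exact: fa|exact: faM].
have [ca ad] := Ia.
have massa : mass c k a <= eps%:E.
  by apply: le_trans a0k; apply: (head_le mk Ia0); exact: ltW.
have massa' : \int[mu]_(x in eitv c a%:E) `|k' x| <= eps%:E.
  apply: le_trans massa; apply: ge0_le_leb_integral => //.
  - exact: leb_set_eitv.
  - exact/leb_measurable_abse/(leb_measurableS mI (eitv_head Ia)).
  - exact/leb_measurable_abse/(leb_measurableS mI (eitv_head Ia)).
rewrite (leb_integral_split ca ad ifk).
have mca := leb_set_eitv c a%:E; have caI := eitv_head Ia.
have mJ := leb_set_eitv a%:E d; have JI := eitv_tail Ia.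
have part1 : `|\int[mu]_(x in eitv c a%:E) (f x * k' x)| <= (eps * M)%:E.
  have mfk := leb_measurableM (leb_measurableS mI caI mf) (leb_measurableS mI caI mk').
  have mka' := leb_measurable_abse (leb_measurableS mI caI mk').
  apply: le_trans (le_abse_leb_integral mca mfk) _.
  apply: (@le_trans _ _ (\int[mu]_(x in eitv c a%:E) (M%:E * `|k' x|))).
    apply: ae_ge0_le_leb_integral => //.
    - exact: leb_measurable_abse.
    - by move=> x _; apply: mule_ge0; rewrite ?lee_fin.
    - by apply: leb_measurableM => //; exact: leb_measurable_cst.
    - by apply: aeS fM => x xM cx; rewrite abseM lee_wpmul2r// xM//; exact: caI.
  rewrite (ge0_leb_integralZl mca mka' (fun t _ => abse_ge0 _)) ?lee_fin//.
  by rewrite mulrC EFinM lee_wpmul2l// lee_fin.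
have part2 : `|\int[mu]_(x in eitv a%:E d) (f x * k' x)| <=
    C%:E * W11norm I v w f + (eps * M)%:E.
  have mqJ := leb_measurableS mI JI mq; have mkJ := leb_measurableS mI JI mk'.
  have qa := tail_integrable hv mq qoo Ia.
  have -> : \int[mu]_(x in eitv a%:E d) (f x * k' x) =
      \int[mu]_(t in eitv a%:E d) (q t * \int[mu]_(x in eitv a%:E t%:E) k' x).
    rewrite -triangle_fubini.
    - apply: ae_eq_leb_integral => //.
      + by apply: leb_measurableM => //; exact: (leb_measurableS mI JI).
      + by apply: leb_measurableM => //; exact: leb_measurable_tail.
      + by apply: aeS fq => x fx Jx; rewrite fx 1?muleC//; exact: JI.
    - exact: mkJ.
    - exact: mqJ.
    - exact: (leb_integrable_ae mJ (leb_integrableS mI mJ JI ik')).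
    - exact: (leb_integrable_ae mJ qa).
    - move=> t Jt; apply: (leb_integrableS mI (leb_set_eitv _ _) _ ik').
      by apply: subset_trans (eitv_head Jt) JI.
    - move=> x Jx; apply: (leb_integrableS mJ (leb_set_eitv _ _) _ qa).
      exact: eitv_tail.
    - apply: (@le_lt_trans _ _ (\int[mu]_(t in eitv a%:E d) (K%:E * `|q t|))).
        apply: ge0_le_leb_integral => //.
        + by move=> t _; apply: mule_ge0 => //; exact: leb_integral_abse_ge0.
        + apply: leb_measurableM; first exact: leb_measurable_abse.
          exact/leb_measurable_head/leb_measurable_abse.
        + apply: leb_measurableM; first exact: leb_measurable_cst.
          exact: leb_measurable_abse.
        + move=> t Jt; rewrite muleC lee_wpmul2r//.
          apply: headK; first exact: leb_set_eitv.
          exact: subset_trans (eitv_head Jt) JI.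
      rewrite (ge0_leb_integralZl mJ (leb_measurable_abse mqJ) (fun t _ => abse_ge0 _)) ?lee_fin//.
      by rewrite lte_mul_pinfty ?lee_fin//; case/leb_integrableP: qa.
  have iqh : leb_integrable (eitv a%:E d) (fun t => q t * (h t)%:E).
    apply: (leb_integrableMr (M := K)) => //.
      exact: (leb_measurableS mI JI).
    by move=> t /JI; exact: hK.
  have iqa : leb_integrable (eitv a%:E d) (fun t => (h a)%:E * q t).
    exact: leb_integrableZl.
  have -> : \int[mu]_(t in eitv a%:E d) (q t * \int[mu]_(x in eitv a%:E t%:E) k' x) =
      \int[mu]_(t in eitv a%:E d) (q t * (h t)%:E) - (h a)%:E * f a.
    rewrite fa -(leb_integralZl _ mJ qa) -(leb_integralB mJ iqh iqa).
    apply: ae_eq_leb_integral => //.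
    - apply: leb_measurableM => //; exact: leb_measurable_head.
    - by apply: leb_measurableB; exact: leb_integrable_measurable.
    - apply: aeS (leb_integrable_ae mJ qa) => t qt Jt; have qtf := qt Jt.
      have It := JI _ Jt; have [at_ td] := Jt.
      have := leb_integral_split ca at_ (headI t It).
      rewrite (hE t It) (hE a Ia).
      have := leb_integrable_fin_num (leb_set_eitv a%:E t%:E)
        (leb_integrableS mI (leb_set_eitv _ _) (subset_trans (eitv_head Jt) JI) ik').
      rewrite -(fineK qtf).
      case: (\int[mu]_(x in eitv a%:E _) _) => // r _; rewrite -EFinD => -[htr].
      by rewrite -!EFinM -EFinB; congr EFin; rewrite htr; ring.
  apply: le_trans (lee_abs_sub _ _) _; apply: leeD.
    apply: le_trans (le_abse_leb_integral mJ (leb_integrable_measurable iqh)) _.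
    under eq_leb_integral do rewrite abseM.
    have mh' : leb_measurable I (fun t => (h t)%:E) by exact: mh.
    apply: (@le_trans _ _ (\int[mu]_(t in I) (`|q t| * `|(h t)%:E|))).
      apply: ge0_subset_leb_integral => //.
      by apply: leb_measurableM; exact: leb_measurable_abse.
    apply: le_trans (density_bound hv mq mh' C0 hC) _.
    by rewrite lee_wpmul2l// lee_fin.
  rewrite abseM EFinM; apply: lee_pmul => //.
  rewrite -(hE a Ia); apply: le_trans massa'.
  by apply: le_abse_leb_integral => //; exact: (leb_measurableS mI caI).
apply: le_trans (lee_abs_add _ _) _.
apply: le_trans (leeD part1 part2) _.
by rewrite addeCA -EFinD leeD2l// lee_fin.
Qed.

End vanishing_upper_bound.

(** * Tails belong to the Sobolev space *)

Section test_functions.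
Context {R : realType} (c d : \bar R).
Local Notation mu := (leb R).
Local Notation BR := (measurableTypeR R).
Local Notation I := (eitv c d).

Lemma integral_leb (D : set R) (f : R -> \bar R) :
  measurable (D : set BR) -> measurable_fun (D : set BR) f ->
  \int[mu]_(x in D) f x = \int[@lebesgue_measure R]_(x in D) f x.
Proof.
move=> mD mf; rewrite integralE [RHS]integralE; congr (_ - _).
- by apply: ge0_integral_leb => //; exact: measurable_funepos.
- by apply: ge0_integral_leb => //; exact: measurable_funeneg.
Qed.

(** The support is compact in an open interval, so its extreme points leave
    room on both sides. *)
Lemma test_function_support (psi : R -> R) : c < d -> test_function I psi ->
  exists a b, [/\ I a, I b, (a < b)%R & forall x, psi x != 0%R -> (a < x < b)%R].
Proof.
move=> cd [_ cpt clI]; pose K := closure [set x | psi x != 0%R].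
have [K0|/set0P K0] := eqVneq K set0.
  have [a Ia] := eitv_nonempty cd; have [_ [b Ib ab]] := eitv_lt_ex Ia.
  exists a, b; split => // x px; exfalso.
  suff : K x by rewrite K0.
  exact: subset_closure.
have cid : {within K, continuous (@idfun R)}.
  by apply: continuous_subspaceT => x; exact: cvg_id.
have [p /set_mem Kp pmin] := compact_EVT_min K0 cpt cid.
have [q /set_mem Kq qmax] := compact_EVT_max K0 cpt cid.
have [[a Ia ap] _] := eitv_lt_ex (clI _ Kp).
have [_ [b Ib qb]] := eitv_lt_ex (clI _ Kq).
have pK x : psi x != 0%R -> x \in K by move=> px; apply/mem_set; exact: subset_closure.
exists a, b; split => //.
  by rewrite (lt_trans ap)// (le_lt_trans _ qb)// pmin// mem_set.
move=> x /pK xK; rewrite (lt_le_trans ap (pmin _ xK))/=.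
exact: (le_lt_trans (qmax _ xK) qb).
Qed.

(** What the integration by parts in [tail_weak_derivative] uses about a test
    function [psi]. *)
Lemma test_function_primitive (psi : R -> R) : c < d -> test_function I psi ->
  exists a b M : R, [/\ I a, I b,
    leb_measurable I (EFin \o (psi^`())%classic) /\
    (forall x, `|(psi^`())%classic x| <= M)%R,
    forall x, (psi^`())%classic x != 0%R -> (a < x < b)%R &
    forall t, I t -> \int[mu]_(x in eitv c t%:E) ((psi^`())%classic x)%:E = (psi t)%:E].
Proof.
move=> cd tpsi; have [a1 [b1 [Ia1 Ib1 ab1 psiab1]]] := test_function_support cd tpsi.
have [spsi _ _] := tpsi.
have cpsi : continuous psi by exact: smooth_continuous.
have cpsi' : continuous (psi^`())%classic by apply/smooth_continuous/smooth_derive.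
have psi'0 (x : R) (A : set R) : nbhs x A -> (forall y, A y -> psi y = 0%R) ->
    (psi^`())%classic x = 0%R.
  move=> xA A0; rewrite derive1E.
  rewrite -[RHS](@derive_cst R R R 0%R x 1%R); apply: near_eq_derive.
  by apply: filterS xA => y /A0.
(* the derivative may a priori be nonzero at the ends of the support, hence
   the closed interval, enlarged to [(a, b)] below *)
have psi'ab1 (x : R) : (psi^`())%classic x != 0%R -> (a1 <= x <= b1)%R.
  move=> px; apply/andP; split; rewrite leNgt; apply: contra px => lx; apply/eqP.
    apply: (@psi'0 x `]-oo, a1[%classic); first by apply: open_nbhs_nbhs; split => //; rewrite /= in_itv.
    move=> y; rewrite /= in_itv/= => ya.
    by apply/eqP; apply: contraT => /psiab1/andP[+ _]; rewrite ltNge ltW.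
  apply: (@psi'0 x `]b1, +oo[%classic); first by apply: open_nbhs_nbhs; split => //; rewrite /= in_itv/= lx.
  move=> y; rewrite /= in_itv/= andbT => yb.
  by apply/eqP; apply: contraT => /psiab1/andP[_]; rewrite ltNge ltW.
have [[a Ia aa1] _] := eitv_lt_ex Ia1; have [_ [b Ib bb1]] := eitv_lt_ex Ib1.
have ab : (a < b)%R by rewrite (lt_trans aa1)// (lt_trans ab1).
have psiab x : psi x != 0%R -> (a < x < b)%R.
  by move=> /psiab1/andP[ax xb]; rewrite (lt_trans aa1)// (lt_trans xb).
have psi'ab x : (psi^`())%classic x != 0%R -> (a < x < b)%R.
  by move=> /psi'ab1/andP[ax xb]; rewrite (lt_le_trans aa1)// (le_lt_trans xb).
have psia : psi a = 0%R.
  by apply/eqP; apply: contraT => /psiab; rewrite ltxx.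
have [M psiM] : exists M, forall x, (`|(psi^`())%classic x| <= M)%R.
  have cn : {within `[a, b], continuous (fun x => `|(psi^`())%classic x|%R : R)}.
    apply: continuous_subspaceT => x; apply: continuous_comp; first exact: cpsi'.
    exact: norm_continuous.
  have [z zab zmax] := EVT_max (ltW ab) cn.
  exists `|(psi^`())%classic z|%R => x.
  have [->|/psi'ab xab] := eqVneq ((psi^`())%classic x) 0%R; first by rewrite normr0.
  by apply: zmax; case/andP: xab => ax xb; rewrite in_itv/= !ltW.
have mpsi' : measurable_fun (setT : set BR) (EFin \o (psi^`())%classic).
  by apply/measurable_EFinP; exact: continuous_measurable_fun.
exists a, b, M; split => //.
  by split => //; apply: leb_measurable_EFin => //; exact: leb_set_eitv.
move=> t It; have [ta|at_] := leP t a.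
  have -> : psi t = 0%R.
    by apply/eqP; apply: contraT => /psiab/andP[+ _]; rewrite ltNge ta.
  rewrite -[RHS](@integral0 _ (leb_line R) _ mu (eitv c t%:E)).
  apply: eq_leb_integral => x [_ xt]; congr EFin; apply/eqP; apply: contraT.
  move=> /psi'ab/andP[ax _]; move: xt; rewrite lte_fin => xt.
  by have := lt_trans ax (lt_le_trans xt ta); rewrite ltxx.
rewrite (@leb_integral_support _ (eitv a%:E t%:E)); first last.
- move=> x [cx xt] xa; congr EFin; apply/eqP; apply: contraT => /psi'ab/andP[ax _].
  by exfalso; apply: xa; split.
- by apply: eitvS => //; case: Ia => /ltW.
rewrite integral_leb; first last.
- exact: measurable_funTS.
- exact: borel_measurable_eitv.
rewrite eitv_fin -(@integral_itv_bndoo _ a t _ true false); last first.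
  exact: measurable_funTS.
rewrite (@continuous_FTC2 _ _ psi _ _ at_).
- by rewrite psia sube0.
- by apply: continuous_subspaceT.
- split => [x _| |]; first exact: (spsi 0%N).
  + by apply: cvg_at_right_filter; exact: cpsi.
  + by apply: cvg_at_left_filter; exact: cpsi.
- by [].
Qed.

End test_functions.

Section tail_elements.
Context {R : realType} (c d : \bar R) (v w : R -> \bar R).
Local Notation mu := (leb R).
Local Notation I := (eitv c d).
Local Notation V := (mass c v).
Hypothesis hv : weight c d v.
Hypothesis hw : forall x, I x -> w x = (V x)^-1.
Implicit Types (q : R -> \bar R) (f : L0 I).

Let mI : leb_set I. Proof. exact: leb_set_eitv. Qed.
Let mv : leb_measurable I v. Proof. by case: hv. Qed.

Lemma tail_le q (a b : R) : leb_measurable I q -> I a -> (a <= b)%R ->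
  \int[mu]_(t in eitv b%:E d) `|q t| <= \int[mu]_(t in eitv a%:E d) `|q t|.
Proof.
move=> mq Ia ab; apply: ge0_subset_leb_integral.
- exact: leb_set_eitv.
- exact: leb_set_eitv.
- exact/leb_measurable_abse/(leb_measurableS mI (eitv_tail Ia)).
- by [].
- by apply: eitvS.
Qed.

Lemma L1loc_tail q f : leb_measurable I q ->
  \int[mu]_(t in I) (V t * `|q t|) < +oo ->
  {ae mu, forall x, I x -> f x = \int[mu]_(t in eitv x%:E d) q t} ->
  L1loc I f.
Proof.
move=> mq qV fq a b Ia Ib.
have [ba|ab] := leP b a.
  rewrite /L1norm (_ : eitv a%:E b%:E = set0).
    by rewrite (@integral_set0 _ (leb_line R)) ltry.
  apply/seteqP; split => // x [ax xb]; move: (lt_trans ax xb).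
  by rewrite lte_fin ltNge ba.
have qa := tail_integrable hv mq qV Ia; have [_ qaoo] := iffLR (leb_integrableP _ _) qa.
have mab := leb_set_eitv a%:E b%:E.
rewrite /L1norm.
apply: (@le_lt_trans _ _ (\int[mu]_(x in eitv a%:E b%:E) \int[mu]_(t in eitv a%:E d) `|q t|)).
  apply: ae_ge0_le_leb_integral.
  - exact: mab.
  - by [].
  - exact/leb_measurable_abse/(leb_measurableS mI (eitv_sub Ia Ib))/L0_measurable.
  - by move=> x _; exact: leb_integral_abse_ge0.
  - exact: leb_measurable_cst.
  - apply: aeS fq => x fx abx; have Ix := eitv_sub Ia Ib abx.
    have ax : (a <= x)%R by case: abx => + _; rewrite lte_fin => /ltW.
    rewrite fx//; apply: le_trans (tail_le mq Ia ax).
    apply: le_abse_leb_integral; first exact: leb_set_eitv.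
    exact: (leb_measurableS mI (eitv_tail Ix)).
rewrite leb_integral_cst// leb_eitv ?(ltW ab)// muleC lte_mul_pinfty//.
by rewrite lee_fin subr_ge0 ltW.
Qed.

Lemma L1loc_density q : leb_measurable I q ->
  \int[mu]_(t in I) (V t * `|q t|) < +oo -> L1loc I q.
Proof.
move=> mq qV a b Ia [_ bd]; rewrite /L1norm.
have [_] := iffLR (leb_integrableP _ _) (tail_integrable hv mq qV Ia).
apply: le_lt_trans; apply: ge0_subset_leb_integral.
- exact: leb_set_eitv.
- exact: leb_set_eitv.
- exact/leb_measurable_abse/(leb_measurableS mI (eitv_tail Ia)).
- by [].
- by apply: eitvS => //; exact: ltW.
Qed.

(** Fubini on the triangle, applied to [psi'] and [q], is the integration by
    parts of a tail against a test function [psi]. *)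
Lemma tail_weak_derivative q f : leb_measurable I q ->
  \int[mu]_(t in I) (V t * `|q t|) < +oo ->
  {ae mu, forall x, I x -> f x = \int[mu]_(t in eitv x%:E d) q t} ->
  is_weak_derivative I f (fun x => - q x).
Proof.
move=> mq qV fq; have [cd _ _ _ _] := hv; split.
- exact: (L1loc_tail mq qV).
- move=> a b Ia Ib; have := L1loc_density mq qV Ia Ib.
  by rewrite /L1norm; under [in X in X -> _]eq_leb_integral do rewrite -abseN.
move=> psi tpsi.
have [a [b [M [Ia Ib [mpsi' psi'M] psi'ab psiE]]]] := test_function_primitive cd tpsi.
pose p x := ((psi^`())%classic x)%:E.
have abI := eitv_sub Ia Ib.
have ip : leb_integrable I p.
  apply: (@leb_integrable_support _ (eitv a%:E b%:E)) => //.
  - exact: leb_set_eitv.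
  - move=> x Ix xab; congr EFin; apply/eqP; apply: contraT => /psi'ab/andP[ax xb].
    by exfalso; apply: xab; split; rewrite lte_fin.
  - have := leb_integrable_cst a b 1.
    move/(leb_integrableMr (leb_set_eitv _ _)) => /(_ (psi^`())%classic M).
    rewrite (_ : (fun x => _) = p); last by apply/funext => x; rewrite mul1e.
    by apply=> //; exact: (leb_measurableS mI abI).
have mp := leb_integrable_measurable ip.
have [B B0 pB] : exists2 B : R, (0 <= B)%R & \int[mu]_(x in I) `|p x| = B%:E.
  have := leb_integrable_fin_num mI (leb_integrable_abse ip).
  have := leb_integral_abse_ge0 I p.
  by case: (\int[mu]_(x in I) _) => [B| |] // B0 _; exists B; rewrite -?lee_fin.
have headB t : I t -> \int[mu]_(x in eitv c t%:E) `|p x| <= B%:E.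
  move=> It; rewrite -pB; apply: ge0_subset_leb_integral.
  - exact: leb_set_eitv.
  - exact: mI.
  - exact: leb_measurable_abse.
  - by [].
  - exact: eitv_head.
have ipt t : I t -> leb_integrable (eitv c t%:E) p.
  by move=> It; apply: (leb_integrableS mI (leb_set_eitv _ _) (eitv_head It) ip).
have qa := tail_integrable hv mq qV Ia.
have [_ qaoo] := iffLR (leb_integrableP _ _) qa.
have maI := leb_set_eitv a%:E d; have aI := eitv_tail Ia.
have pa0 t : (t <= a)%R -> \int[mu]_(x in eitv c t%:E) `|p x| = 0.
  move=> ta; rewrite -[RHS](@integral0 _ (leb_line R) _ mu (eitv c t%:E)).
  apply: eq_leb_integral => x [_]; rewrite lte_fin => xt.
  rewrite /p; have [->|] := eqVneq ((psi^`())%classic x) 0%R; first by rewrite abse0.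
  by move/psi'ab/andP => [ax _]; have := lt_trans ax (lt_le_trans xt ta); rewrite ltxx.
have fin : \int[mu]_(t in I) (`|q t| * \int[mu]_(x in eitv c t%:E) `|p x|) < +oo.
  rewrite (@leb_integral_support _ (eitv a%:E d)) //; last first.
    move=> t [_ td] at_; rewrite pa0 ?mule0// leNgt; apply/negP => ?.
    by apply: at_; split => //; rewrite lte_fin.
  apply: (@le_lt_trans _ _ (\int[mu]_(t in eitv a%:E d) (B%:E * `|q t|))).
    have mqa := leb_measurable_abse (leb_measurableS mI aI mq).
    apply: ge0_le_leb_integral.
    - exact: maI.
    - by move=> t _; apply: mule_ge0 => //; exact: leb_integral_abse_ge0.
    - apply: leb_measurableM => //; apply: (leb_measurableS mI aI).
      exact/leb_measurable_head/leb_measurable_abse.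
    - by apply: leb_measurableM => //; exact: leb_measurable_cst.
    - by move=> t /aI It; rewrite muleC lee_wpmul2r// headB.
  rewrite (ge0_leb_integralZl maI (leb_measurable_abse (leb_measurableS mI aI mq))
    (fun t _ => abse_ge0 _)) ?lee_fin//.
  by rewrite lte_mul_pinfty ?lee_fin.
transitivity (\int[mu]_(t in I) (q t * (psi t)%:E)).
  transitivity (\int[mu]_(x in I) (p x * \int[mu]_(t in eitv x%:E d) q t)).
    apply: ae_eq_leb_integral => //.
    - by apply: leb_measurableM => //; exact: L0_measurable.
    - by apply: leb_measurableM => //; exact: leb_measurable_tail.
    - by apply: aeS fq => x fx Ix; rewrite fx// muleC.
  rewrite triangle_fubini//.
  - by apply: eq_leb_integral => t It; rewrite psiE.
  - by apply: aeW.
  - exact: (density_ae_fin_num hv).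
  - by move=> x Ix; exact: (tail_integrable hv).
have psi_le t : I t -> `|(psi t)%:E| <= \int[mu]_(x in eitv c t%:E) `|p x|.
  move=> It; rewrite -psiE//; apply: le_abse_leb_integral; first exact: leb_set_eitv.
  exact: leb_integrable_measurable (ipt t It).
have [spsi _ _] := tpsi.
have mpsi : leb_measurable I (EFin \o psi).
  by apply: leb_measurable_EFin => //; exact: smooth_continuous.
have iqpsi : leb_integrable I (fun t => - q t * (psi t)%:E).
  apply: (@leb_integrable_support _ (eitv a%:E d)) => //.
  - by apply: leb_measurableM => //; exact: leb_measurableN.
  - move=> t It at_; suff -> : psi t = 0%R by rewrite mule0.
    have ta : (t <= a)%R.
      rewrite leNgt; apply/negP => lat; apply: at_.
      by split; [rewrite lte_fin|case: It].
    apply/eqP; rewrite -normr_le0 -lee_fin -[leLHS]/(`|(psi t)%:E|).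
    by apply: le_trans (psi_le t It) _; rewrite pa0.
  - apply: (leb_integrableMr (M := B)) => //.
    + exact: leb_integrableN.
    + exact: (leb_measurableS mI aI).
    + move=> t /aI It; rewrite -lee_fin -[leLHS]/(`|(psi t)%:E|).
      exact: le_trans (psi_le t It) (headB t It).
rewrite -leb_integralN//.
by apply: eq_leb_integral => t _; rewrite mulNe oppeK.
Qed.

Lemma is_weak_derivative_ae f (g g' : R -> \bar R) :
  leb_measurable I g -> leb_measurable I g' ->
  {ae mu, forall x, I x -> g x = g' x} ->
  is_weak_derivative I f g -> is_weak_derivative I f g'.
Proof.
move=> mg mg' gg' [f1 g1 fg]; split => //.
- move=> a b Ia Ib; have := g1 a b Ia Ib; congr (_ < +oo).
  have sub := eitv_sub Ia Ib.
  apply: ae_eq_leb_integral; first exact: leb_set_eitv.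
  - exact/leb_measurable_abse/(leb_measurableS mI sub).
  - exact/leb_measurable_abse/(leb_measurableS mI sub).
  - by apply: aeS gg' => x gx /sub Ix; rewrite gx.
- move=> psi tpsi; rewrite (fg psi tpsi); congr (- _).
  have [spsi _ _] := tpsi.
  have mpsi : leb_measurable I (fun x => (psi x)%:E).
    by apply: leb_measurable_EFin => //; exact: smooth_continuous.
  apply: ae_eq_leb_integral => //.
  - exact: leb_measurableM.
  - exact: leb_measurableM.
  - by apply: aeS gg' => x gx Ix; rewrite gx.
Qed.

(** The two terms of the norm agree: Tonelli gives
    [\int v f = \int V q], and the weak derivative of [f] is [- q]. *)
Lemma tail_W11 q : leb_measurable I q -> (forall x, 0 <= q x) ->
  \int[mu]_(t in I) (V t * q t) < +oo ->
  forall f, {ae mu, forall x, I x -> f x = \int[mu]_(t in eitv x%:E d) q t} ->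
  W11 I v w f /\
  W11norm I v w f = \int[mu]_(t in I) (V t * q t) + \int[mu]_(t in I) (V t * q t).
Proof.
move=> mq q0 qV' f fq.
have qV : \int[mu]_(t in I) (V t * `|q t|) < +oo.
  by under eq_leb_integral do rewrite gee0_abs//.
have mnq := leb_measurableN mq.
have fnq := tail_weak_derivative mq qV fq.
pose g : L0 I := (\pi_(L0 I) (MkMfun mnq))%qT.
have mg : leb_measurable I g by exact: L0_measurable.
have gE : {ae mu, forall x, I x -> - q x = g x}.
  have := L0_piE (MkMfun mnq); apply: aeS => x gx Ix; rewrite /g gx//.
have fg : is_weak_derivative I f g by exact: (is_weak_derivative_ae mnq mg gE fnq).
have fD : is_weak_derivative I f (weak_derivative f).
  have exg : exists g : L0 I, is_weak_derivative I f g by exists g.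
  exact: (xgetPex (L0_cst I +oo) exg).
have mD : leb_measurable I (weak_derivative f) by exact: L0_measurable.
have DE := weak_derivative_unique mD mnq fD fnq.
have normE : W11norm I v w f =
    \int[mu]_(t in I) (V t * q t) + \int[mu]_(t in I) (V t * q t).
  rewrite (W11normE hv hw); congr (_ + _).
    transitivity (\int[mu]_(x in I) (`|v x| * \int[mu]_(t in eitv x%:E d) q t)).
      apply: ae_eq_leb_integral => //.
      - by apply: leb_measurableM; apply: leb_measurable_abse => //; exact: L0_measurable.
      - by apply: leb_measurableM; [exact: leb_measurable_abse|exact: leb_measurable_tail].
      - apply: aeS fq => x fx Ix; rewrite fx//; congr (_ * _).
        by rewrite gee0_abs//; exact: leb_integral_ge0.
    rewrite triangle_tonelli//; last exact: leb_measurable_abse.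
    by apply: eq_leb_integral => t _; rewrite muleC.
  apply: ae_eq_leb_integral => //.
  - by apply: leb_measurableM; [exact: leb_measurable_mass|exact: leb_measurable_abse].
  - by apply: leb_measurableM => //; exact: leb_measurable_mass.
  - by apply: aeS DE => x Dx Ix; rewrite Dx// abseN gee0_abs.
split => //; split.
- by case: fD.
- by case: fD.
- by rewrite normE lte_add_pinfty.
Qed.

Lemma tail_class q : leb_measurable I q -> exists f,
  {ae mu, forall x, I x -> f x = \int[mu]_(t in eitv x%:E d) q t}.
Proof.
move=> mq; have mT := leb_measurable_tail mq.
by exists (\pi_(L0 I) (MkMfun mT))%qT; exact: (L0_piE (MkMfun mT)).
Qed.

End tail_elements.

(** * Bounded densities and duality *)

Section bounded_densities.
Context {R : realType} (c d : \bar R) (v : R -> \bar R).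
Local Notation mu := (leb R).
Local Notation I := (eitv c d).
Local Notation V := (mass c v).
Hypothesis hv : weight c d v.
Implicit Types (m q : R -> \bar R).

Let mI : leb_set I. Proof. exact: leb_set_eitv. Qed.

(** The densities whose tails lie in both spaces at once: the tail is
    Lipschitz, constant near [c] and zero near [d]. *)
Definition bounded_density q : Prop := leb_measurable I q /\
  exists a b M : R, [/\ I a, I b, (a < b)%R,
    forall x, 0 <= q x <= M%:E & forall x, q x != 0 -> (a < x < b)%R].

Lemma bounded_density_indic (E : set R) (p r : R) : I p -> I r -> (p < r)%R ->
  leb_set E -> E `<=` eitv p%:E r%:E ->
  bounded_density ((fun=> 1) \_ E).
Proof.
move=> Ip Ir pr mE EJ; have EI := subset_trans EJ (eitv_sub Ip Ir).
split; first by apply: leb_measurable_patchS => //; exact: leb_measurable_cst.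
exists p, r, 1%R; split => // x; rewrite patchE.
  by case: ifP => _; rewrite ?lexx ?lee01.
case: ifPn => [/set_mem/EJ[px xr] _|_]; last by rewrite eqxx.
by apply/andP; rewrite -!lte_fin.
Qed.

Lemma bounded_density_mass q : bounded_density q ->
  \int[mu]_(t in I) (V t * q t) < +oo.
Proof.
move=> [mq [a [b [M [Ia Ib ab qM qab]]]]].
have M0 : 0 <= M%:E by case/andP: (qM a) => qa0; exact: le_trans.
have abI := eitv_sub Ia Ib; have mab := leb_set_eitv a%:E b%:E.
have mV := leb_measurable_mass hv.
rewrite (leb_integral_support abI); last first.
  move=> x Ix xab; apply/eqP; rewrite mule_eq0; apply/orP; right.
  apply: contra_notT xab => /qab/andP[ax xb]; split; rewrite lte_fin//.
apply: (@le_lt_trans _ _ (\int[mu]_(t in eitv a%:E b%:E) (V b * M%:E))).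
  apply: ge0_le_leb_integral => //.
  - move=> t _; apply: mule_ge0; first exact: mass_ge0.
    by case/andP: (qM t).
  - by apply: leb_measurableM; apply: (leb_measurableS mI abI).
  - exact: leb_measurable_cst.
  - move=> t [_ tb]; case/andP: (qM t) => q0 qt; apply: lee_pmul => //.
      exact: mass_ge0.
    by apply: (mass_le hv Ib); move: tb; rewrite lte_fin => /ltW.
rewrite leb_integral_cst// leb_eitv ?(ltW ab)//.
by rewrite -(fineK (mass_fin_num hv Ib)) -!EFinM ltry.
Qed.

Lemma tail_bounded_density_AC q : bounded_density q ->
  AC_vanishing c d (fun x => fine (\int[mu]_(t in eitv x%:E d) q t)) /\
  forall x, I x -> \int[mu]_(t in eitv x%:E d) q t \is a fin_num.
Proof.
move=> bq; have [mq [a [b [M [Ia Ib ab qM qab]]]]] := bq.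
have q0 x : 0 <= q x by case/andP: (qM x).
have M0 : (0 <= M)%R by rewrite -lee_fin; case/andP: (qM a) => qa0; exact: le_trans.
have qV : \int[mu]_(t in I) (V t * `|q t|) < +oo.
  by under eq_leb_integral do rewrite gee0_abs//; exact: bounded_density_mass.
have qtail x : I x -> leb_integrable (eitv x%:E d) q.
  by move=> Ix; exact: (tail_integrable hv).
pose T x := \int[mu]_(t in eitv x%:E d) q t.
have Tfin x : I x -> T x \is a fin_num.
  by move=> Ix; exact: leb_integrable_fin_num (leb_set_eitv _ _) (qtail x Ix).
split => //; set f := (fun x : R => fine (T x)).
have lip x y : I x -> I y -> (x <= y)%R -> (`|f y - f x| <= M * (y - x))%R.
  move=> Ix Iy; rewrite le_eqVlt => /predU1P[->|xy].
    by rewrite !subrr normr0 mulr0.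
  have xd : x%:E < y%:E by rewrite lte_fin.
  have yd : y%:E < d by case: Iy.
  have xyI := eitv_sub Ix Iy; have mxy := leb_set_eitv x%:E y%:E.
  have TE : T x = \int[mu]_(t in eitv x%:E y%:E) q t + T y.
    exact: (leb_integral_split xd yd (qtail x Ix)).
  have J0 : 0 <= \int[mu]_(t in eitv x%:E y%:E) q t by exact: leb_integral_ge0.
  have JM : \int[mu]_(t in eitv x%:E y%:E) q t <= (M * (y - x))%:E.
    apply: (@le_trans _ _ (\int[mu]_(t in eitv x%:E y%:E) M%:E)).
      apply: ge0_le_leb_integral => //.
      - exact: (leb_measurableS mI xyI).
      - exact: leb_measurable_cst.
      - by move=> t _; case/andP: (qM t).
    by rewrite leb_integral_cst// leb_eitv ?(ltW xy).
  move: TE J0 JM (Tfin x Ix) (Tfin y Iy); rewrite /f.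
  case: (T x) => // r1; case: (T y) => // r2.
  case: (\int[mu]_(t in _) _) => // r3.
  rewrite -EFinD => -[->]; rewrite !lee_fin => r30 r3M _ _ /=.
  by rewrite opprD addrCA subrr addr0 normrN ger0_norm.
split.
- move=> e e0; have M1 : (0 < M + 1)%R by rewrite ltr_wpDl.
  exists (e / (M + 1))%R; first by rewrite divr_gt0.
  move=> n p r pr _ prd.
  apply: (@le_lt_trans _ _ (M * \sum_(i < n) (r i - p i))%R).
    rewrite mulr_sumr; apply: ler_sum => i _.
    by have [Ip Ir pri] := pr i; exact: lip.
  have s0 : (0 <= \sum_(i < n) (r i - p i))%R.
    by apply: sumr_ge0 => i _; rewrite subr_ge0; have [] := pr i.
  move: prd; rewrite ltr_pdivlMr// => ?; nra.
- have Fc : Filter (ereal_at_right c) by case: c => [r| |] /=; exact: _.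
  exists (f a); apply: cvg_near_cst.
  have fa x : I x -> (x <= a)%R -> f x = f a.
    move=> Ix xa; rewrite /f /T; congr fine.
    apply: leb_integral_support; first by apply: eitvS.
    move=> t [_ td] at_; apply/eqP; apply: contra_notT at_ => /qab/andP[? _].
    by split => //; rewrite lte_fin.
  have [ca ad] := Ia.
  have Ix x : (x < a)%R -> c < x%:E -> f x = f a.
    move=> xa cx; apply: fa; last exact: ltW.
    by split => //; rewrite (lt_trans _ ad)// lte_fin.
  move: ca Ix {Fc}; case: c => [r| |] ca Ix; rewrite /ereal_at_right.
  + exists (a - r)%R; first by rewrite /= subr_gt0 -lte_fin.
    move=> x /= xr rx; apply: Ix; last by rewrite lte_fin.
    by move: xr; rewrite ltr_distlC subrKC => /andP[].
  + by rewrite ltNge leey in ca.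
  + by exists a; split; [exact: num_real|move=> x xa; apply: Ix => //; rewrite ltNyr].
- exists b => // x [bx xd]; rewrite /f /T (_ : \int[mu]_(t in _) _ = 0)//.
  rewrite -[RHS](@integral0 _ (leb_line R) _ mu (eitv x%:E d)).
  apply: eq_leb_integral => t [xt _]; apply/eqP; apply: contraT => /qab/andP[_ tb].
  have := lt_trans bx xt; rewrite lte_fin => /(lt_trans tb).
  by rewrite ltxx.
Qed.

(** For [l > A], test with the indicator of the set [E] where
    [m > l * V] inside a compact subinterval: then
    [l * \int_E V <= \int_E m <= A * \int_E V], so that
    [\int_E V = 0] and [E] is null because [V] is positive. Rational [l]
    and endpoints are enough. *)
Lemma density_duality (A : R) m : leb_measurable I m -> (0 <= A)%R ->
  (forall q, bounded_density q ->
    \int[mu]_(t in I) (q t * m t) <= A%:E * \int[mu]_(t in I) (V t * q t)) ->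
  {ae mu, forall x, I x -> m x <= A%:E * V x}.
Proof.
move=> mm A0 mA; have mV := leb_measurable_mass hv.
have key (l p r : R) : (A < l)%R -> I p -> I r -> (p < r)%R ->
    {ae mu, forall x, (p < x < r)%R -> m x <= l%:E * V x}.
  move=> Al Ip Ir pr; have l0 : (0 < l)%R by exact: le_lt_trans Al.
  have JI := eitv_sub Ip Ir; have mJ := leb_set_eitv p%:E r%:E.
  pose E := eitv p%:E r%:E `&` [set x | 0 < m x - l%:E * V x].
  have mmV : leb_measurable I (fun x => m x - l%:E * V x).
    apply: leb_measurableB => //; apply: leb_measurableM => //.
    exact: leb_measurable_cst.
  have mE : leb_set E.
    have mmVJ := leb_measurableS mI JI mmV.
    exact: (@emeasurable_fun_o_infty _ (leb_line R) R _ _ mJ mmVJ 0).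
  have EI : E `<=` I by move=> x [/JI].
  have Em x : E x -> l%:E * V x < m x.
    move=> [Jx /=]; rewrite -(fineK (mass_fin_num hv (JI _ Jx))) -EFinM.
    by rewrite sube_gt0.
  pose q := (fun _ : R => 1 : \bar R) \_ E.
  have qE x : q x = if x \in E then 1 else 0 by rewrite /q patchE.
  have bq : bounded_density q.
    by apply: (bounded_density_indic Ip Ir pr mE) => x [].
  have intq h : \int[mu]_(t in I) (q t * h t) = \int[mu]_(t in E) h t.
    rewrite -(leb_integral_patchS _ EI); apply: eq_leb_integral => t _.
    by rewrite qE patchE; case: ifP => _; rewrite ?mul1e ?mul0e.
  have VqE : \int[mu]_(t in I) (V t * q t) = \int[mu]_(t in E) V t.
    by rewrite -intq; apply: eq_leb_integral => t _; rewrite muleC.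
  have H : \int[mu]_(t in E) m t <= A%:E * \int[mu]_(t in E) V t.
    by rewrite -intq -VqE; exact: mA.
  have lV : l%:E * \int[mu]_(t in E) V t <= \int[mu]_(t in E) m t.
    rewrite -(ge0_leb_integralZl mE (leb_measurableS mI EI mV)
      (fun t _ => mass_ge0 c v t)) ?lee_fin ?(ltW l0)//.
    apply: ge0_le_leb_integral.
    - exact: mE.
    - by move=> t _; apply: mule_ge0; [rewrite lee_fin ltW|exact: mass_ge0].
    - apply: leb_measurableM; first exact: leb_measurable_cst.
      exact: (leb_measurableS mI EI).
    - exact: (leb_measurableS mI EI).
    - by move=> t /Em /ltW.
  have V0 : \int[mu]_(t in E) V t = 0.
    have := bounded_density_mass bq; rewrite VqE.
    have : 0 <= \int[mu]_(t in E) V t by apply: leb_integral_ge0 => t _; exact: mass_ge0.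
    have := le_trans lV H.
    case: (\int[mu]_(t in E) V t) => [s| |] //; rewrite -!EFinM !lee_fin => lsA s0 _.
    by congr EFin; nra.
  have aeV : {ae mu, forall x, E x -> V x = 0}.
    apply: leb_integral_eq0; [exact: mE|exact: (leb_measurableS mI EI)|].
    by rewrite -[RHS]V0; apply: eq_leb_integral => t _; rewrite gee0_abs// mass_ge0.
  apply: aeS aeV => x Vx /andP[px xr]; rewrite leNgt; apply/negP => mx.
  have Jx : eitv p%:E r%:E x by split; rewrite lte_fin.
  have Ex : E x.
    split => //=; move: mx; rewrite -(fineK (mass_fin_num hv (JI _ Jx))) -EFinM.
    by rewrite sube_gt0.
  by have := mass_gt0 hv (EI _ Ex); rewrite Vx// ltxx.
have : {ae mu, forall x, forall lpr : rat * (rat * rat), (A < ratr lpr.1)%R ->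
    I (ratr lpr.2.1) -> I (ratr lpr.2.2) -> (ratr lpr.2.1 < x < ratr lpr.2.2)%R ->
    m x <= (ratr lpr.1)%:E * V x}.
  apply: ae_forall_countable => -[l [p r]] /=.
  have [Al|Al] := boolP (A < ratr l)%R; last exact: aeW.
  have [Ip|Ip] := pselect (I (ratr p)); last exact: aeW.
  have [Ir|Ir] := pselect (I (ratr r)); last exact: aeW.
  have [pr|rp] := ltP (ratr p : R) (ratr r).
    by apply: aeS (key _ _ _ Al Ip Ir pr) => x mx _ _ _ /mx.
  apply: aeW => x _ _ _ /andP[px xr].
  by have := lt_le_trans (lt_trans px xr) rp; rewrite ltxx.
apply: aeS => x mx Ix; have [p [r [Ip Ir px xr]]] := rat_between_eitv Ix.
have {}mx (l : rat) : (A < ratr l)%R -> m x <= (ratr l)%:E * V x.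
  by move=> Al; apply: (mx (l, (p, r))) => //=; rewrite px.
have := mass_gt0 hv Ix; move: mx; rewrite -(fineK (mass_fin_num hv Ix)).
set s := fine (V x); rewrite lte_fin => mx s0.
rewrite -EFinM; apply/lee_addgt0Pr => e e0.
(* a rational slope so close to [A] that the excess at [x] is at most [e] *)
have /rat_in_itvoo[l] : (A < A + e / s)%R by rewrite ltrDl divr_gt0.
rewrite in_itv/= => /andP[Al lA]; apply: le_trans (mx l Al) _.
rewrite -EFinM -EFinD lee_fin -ler_pdivlMr// mulrDl mulfK ?gt_eqF//.
exact: ltW.
Qed.

End bounded_densities.

(** * Lower bounds for the associate norms *)

Section test_elements.
Context {R : realType} (c d : \bar R) (v w : R -> \bar R).
Local Notation mu := (leb R).
Local Notation I := (eitv c d).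
Local Notation V := (mass c v).
Local Notation NW := (W11norm I v w).
Local Notation piX := (L0_image I (AC_vanishing c d)).
Hypothesis hv : weight c d v.
Hypothesis hw : forall x, I x -> w x = (V x)^-1.
Implicit Types (k q : R -> \bar R) (f : L0 I).

Let mI : leb_set I. Proof. exact: leb_set_eitv. Qed.

Lemma test_element q : bounded_density c d q -> exists f,
  [/\ piX f, W11 I v w f, NW f = \int[mu]_(t in I) (V t * q t) +
                                 \int[mu]_(t in I) (V t * q t) &
      {ae mu, forall x, I x -> f x = \int[mu]_(t in eitv x%:E d) q t}].
Proof.
move=> bq; have [mq [a [b [M [_ _ _ qM _]]]]] := bq.
have q0 x : 0 <= q x by case/andP: (qM x).
have [f fq] := tail_class mq; exists f.
have [Wf Nf] := tail_W11 hv hw mq q0 (bounded_density_mass hv bq) fq.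
have [AC Tfin] := tail_bounded_density_AC hv bq.
split => //; exists (fun x => fine (\int[mu]_(t in eitv x%:E d) q t)) => //.
by apply: aeS fq => x fx Ix; rewrite fx//= fineK// Tfin.
Qed.

Lemma pairing_abse q k f : leb_measurable I q -> (forall x, 0 <= q x) ->
  leb_measurable I k ->
  {ae mu, forall x, I x -> f x = \int[mu]_(t in eitv x%:E d) q t} ->
  L1norm I (fun x => f x * k x) = \int[mu]_(t in I) (q t * mass c k t).
Proof.
move=> mq q0 mk fq; have mka := leb_measurable_abse mk.
rewrite /L1norm /mass -triangle_tonelli//.
apply: ae_eq_leb_integral => //.
- by apply/leb_measurable_abse/leb_measurableM => //; exact: L0_measurable.
- by apply: leb_measurableM => //; exact: leb_measurable_tail.
- apply: aeS fq => x fx Ix; rewrite fx// abseM muleC; congr (_ * _).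
  by rewrite gee0_abs//; exact: leb_integral_ge0.
Qed.

Lemma bounded_density_pairing_lty q k : leb_measurable I k ->
  L1loc_left c d k -> bounded_density c d q ->
  \int[mu]_(t in I) (q t * mass c k t) < +oo.
Proof.
move=> mk k1 [mq [a [b [M [Ia Ib ab qM qab]]]]].
have M0 : 0 <= M%:E by case/andP: (qM a) => qa0; exact: le_trans.
have abI := eitv_sub Ia Ib; have mab := leb_set_eitv a%:E b%:E.
have mK := leb_measurable_head (leb_measurable_abse mk).
rewrite (leb_integral_support abI); last first.
  move=> x Ix xab; apply/eqP; rewrite mule_eq0; apply/orP; left.
  apply: contra_notT xab => /qab/andP[ax xb]; split; rewrite lte_fin//.
apply: (@le_lt_trans _ _ (\int[mu]_(t in eitv a%:E b%:E) (M%:E * mass c k b))).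
  apply: ge0_le_leb_integral => //.
  - move=> t _; apply: mule_ge0; last exact: leb_integral_abse_ge0.
    by case/andP: (qM t).
  - by apply: leb_measurableM; apply: (leb_measurableS mI abI).
  - exact: leb_measurable_cst.
  - move=> t [_ tb]; case/andP: (qM t) => q0 qt; apply: lee_pmul => //.
      exact: leb_integral_abse_ge0.
    by apply: (head_le mk Ib); move: tb; rewrite lte_fin => /ltW.
rewrite leb_integral_cst// leb_eitv ?(ltW ab)//.
have kb : mass c k b \is a fin_num.
  by rewrite ge0_fin_numE; [exact: (k1 b Ib)|exact: leb_integral_abse_ge0].
by rewrite -(fineK kb) -!EFinM ltry.
Qed.

(** Here the exchange of integrals is legitimate for every [k] that is
    integrable up to [c], because the density vanishes near [c] and [d]. *)
Lemma pairing q k f : leb_measurable I k -> L1loc_left c d k ->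
  bounded_density c d q ->
  {ae mu, forall x, I x -> f x = \int[mu]_(t in eitv x%:E d) q t} ->
  \int[mu]_(x in I) (f x * k x) =
  \int[mu]_(t in I) (q t * \int[mu]_(x in eitv c t%:E) k x).
Proof.
move=> mk k1 bq fq; have [mq [a [b [M [_ _ _ qM _]]]]] := bq.
have q0 x : 0 <= q x by case/andP: (qM x).
have qV : \int[mu]_(t in I) (V t * `|q t|) < +oo.
  by under eq_leb_integral do rewrite gee0_abs//; exact: bounded_density_mass.
rewrite -triangle_fubini.
- apply: ae_eq_leb_integral => //.
  + by apply: leb_measurableM => //; exact: L0_measurable.
  + by apply: leb_measurableM => //; exact: leb_measurable_tail.
  + by apply: aeS fq => x fx Ix; rewrite fx// muleC.
- exact: mk.
- exact: mq.
- exact: (head_ae_fin_num mk k1).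
- exact: (density_ae_fin_num hv mq qV).
- by move=> t; exact: L1loc_left_integrable.
- by move=> x; exact: (tail_integrable hv).
- under eq_leb_integral do rewrite gee0_abs//.
  exact: bounded_density_pairing_lty.
Qed.

Lemma ae_mass_L1loc_left (C : R) k : leb_measurable I k ->
  {ae mu, forall x, I x -> mass c k x <= C%:E * V x} -> L1loc_left c d k.
Proof.
move=> mk kC x Ix; have [_ [y Iy xy]] := eitv_lt_ex Ix.
have [z /andP[xz zy] kz] := leb_ae_ex xy kC.
have [cx _] := Ix; have [_ yd] := Iy.
have Iz : I z by split; [rewrite (lt_trans cx)|rewrite (lt_trans _ yd)]; rewrite ?lte_fin.
apply: le_lt_trans (head_le mk Iz (ltW xz)) _; apply: le_lt_trans (kz Iz) _.
by rewrite -(fineK (mass_fin_num hv Iz)) -EFinM ltry.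
Qed.

(** For the indicator of [(x, y)] as density, the pairing is at least
    [(y - x) * \int_c^x |k|]. *)
Lemma test_pairing_L1loc_left k : leb_measurable I k ->
  (forall f, piX f -> W11 I v w f -> L1norm I (fun x => f x * k x) < +oo) ->
  L1loc_left c d k.
Proof.
move=> mk fk x Ix; have [_ [y Iy xy]] := eitv_lt_ex Ix.
have mJ := leb_set_eitv x%:E y%:E; have JI := eitv_sub Ix Iy.
have bq := bounded_density_indic Ix Iy xy mJ (@subset_refl _ _).
have [f [Xf Wf _ fq]] := test_element bq.
have [mq [? [? [M [_ _ _ qM _]]]]] := bq.
have mK := leb_measurable_head (leb_measurable_abse mk).
have := fk f Xf Wf; rewrite (pairing_abse mq _ mk fq) => [|t]; last by case/andP: (qM t).
have -> : \int[mu]_(t in I) (((fun=> 1) \_ (eitv x%:E y%:E)) t * mass c k t) =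
    \int[mu]_(t in eitv x%:E y%:E) mass c k t.
  rewrite -(leb_integral_patchS _ JI); apply: eq_leb_integral => t _.
  by rewrite !patchE; case: ifP => _; rewrite ?mul1e ?mul0e.
have : mass c k x * (y - x)%:E <= \int[mu]_(t in eitv x%:E y%:E) mass c k t.
  rewrite -(leb_eitv (ltW xy)) -leb_integral_cst//.
  apply: ge0_le_leb_integral => //.
  - by move=> _ _; exact: leb_integral_abse_ge0.
  - exact: leb_measurable_cst.
  - exact: (leb_measurableS mI JI).
  - move=> t Jt; apply: (head_le mk (JI _ Jt)).
    by case: Jt; rewrite lte_fin => /ltW.
move=> /le_lt_trans/[apply]; rewrite /mass /L1norm.
have : 0 <= \int[mu]_(t in eitv c x%:E) `|k t| by exact: leb_integral_abse_ge0.
case: (\int[mu]_(t in eitv c x%:E) `|k t|) => [r _ _| |] //.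
  by rewrite ltry.
by rewrite gt0_mulye ?ltxx// lte_fin subr_gt0.
Qed.

(** The factor 2 is the norm of a tail divided by [\int V q]. *)
Lemma strong_lower (A : R) k : leb_measurable I k -> (0 <= A)%R ->
  (forall f, piX f -> W11 I v w f ->
     L1norm I (fun x => f x * k x) <= A%:E * NW f) ->
  {ae mu, forall x, I x -> mass c k x <= (2 * A)%:E * V x}.
Proof.
move=> mk A0 fk; apply: (density_duality hv) => //.
- exact/leb_measurable_head/leb_measurable_abse.
- by rewrite mulr_ge0.
move=> q bq; have [f [Xf Wf Nf fq]] := test_element bq.
have [mq [? [? [M [_ _ _ qM _]]]]] := bq.
rewrite -(pairing_abse mq _ mk fq) => [|t]; last by case/andP: (qM t).
apply: le_trans (fk f Xf Wf) _; rewrite Nf.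
rewrite EFinM [2%:E * _]muleC -muleA lee_wpmul2l ?lee_fin//.
by rewrite mule_natl mule2n.
Qed.

Lemma weak_lower_one_sided (A : R) k : leb_measurable I k -> L1loc_left c d k ->
  (0 <= A)%R ->
  (forall f, piX f -> W11 I v w f ->
     \int[mu]_(x in I) (f x * k x) <= A%:E * NW f) ->
  {ae mu, forall x, I x ->
     \int[mu]_(t in eitv c x%:E) k t <= (2 * A)%:E * V x}.
Proof.
move=> mk k1 A0 fk; apply: (density_duality hv) => //.
- exact: leb_measurable_head.
- by rewrite mulr_ge0.
move=> q bq; have [f [Xf Wf Nf fq]] := test_element bq.
rewrite -(pairing mk k1 bq fq); apply: le_trans (fk f Xf Wf) _; rewrite Nf.
rewrite EFinM [2%:E * _]muleC -muleA lee_wpmul2l ?lee_fin//.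
by rewrite mule_natl mule2n.
Qed.

(** The one-sided bound for [k] and for [- k]. *)
Lemma weak_lower (A : R) k : leb_measurable I k -> L1loc_left c d k ->
  (0 <= A)%R ->
  (forall f, piX f -> W11 I v w f -> L1norm I (fun x => f x * k x) < +oo) ->
  (forall f, piX f -> W11 I v w f ->
     `|\int[mu]_(x in I) (f x * k x)| <= A%:E * NW f) ->
  {ae mu, forall x, I x ->
     `|\int[mu]_(t in eitv c x%:E) k t| <= (2 * A)%:E * V x}.
Proof.
move=> mk k1 A0 fkoo fk; have mk' := leb_measurableN mk.
have k1' : L1loc_left c d (fun x => - k x).
  move=> x /k1; rewrite /L1norm; apply: le_lt_trans.
  by under eq_leb_integral do rewrite abseN.
have up : {ae mu, forall x, I x ->
    \int[mu]_(t in eitv c x%:E) k t <= (2 * A)%:E * V x}.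
  apply: weak_lower_one_sided => // f Xf Wf; apply: le_trans (fk f Xf Wf).
  exact: lee_abs.
have dn : {ae mu, forall x, I x ->
    \int[mu]_(t in eitv c x%:E) - k t <= (2 * A)%:E * V x}.
  apply: weak_lower_one_sided => // f Xf Wf; apply: le_trans (fk f Xf Wf).
  under eq_leb_integral do rewrite muleN.
  rewrite leb_integralN//; last first.
    apply/leb_integrableP; split; last exact: fkoo.
    by apply: leb_measurableM => //; exact: L0_measurable.
  by rewrite -abseN lee_abs.
apply: aeS (aeI up dn) => x [ux dx] Ix; move: (ux Ix) (dx Ix).
rewrite leb_integralN; [|exact: leb_set_eitv|exact: (L1loc_left_integrable mk k1 Ix)].
have := leb_integrable_fin_num (leb_set_eitv _ _) (L1loc_left_integrable mk k1 Ix).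
rewrite -(fineK (mass_fin_num hv Ix)).
case: (\int[mu]_(t in _) _) => [s| |] // _.
by rewrite -!EFinM -EFinN !lee_fin ler_norml lerNl => -> ->.
Qed.

(** Without a nonzero element the suprema defining the associate norms would
    be [-oo], and no equivalence could hold. *)
Lemma test_element_neq0 : exists f, [/\ piX f, W11 I v w f & f <> L0_cst I 0].
Proof.
have [x Ix] := eitv_nonempty (let: And5 h _ _ _ _ := hv in h).
have [[y Iy yx] [z Iz xz]] := eitv_lt_ex Ix.
have mJ := leb_set_eitv x%:E z%:E; have JI := eitv_sub Ix Iz.
have bq := bounded_density_indic Ix Iz xz mJ (@subset_refl _ _).
have [f [Xf Wf Nf fq]] := test_element bq; exists f; split => // f0.
have [mq [? [? [M [_ _ _ qM _]]]]] := bq.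
have := L0_piE (Mfun_cst I 0); rewrite -/(L0_cst I 0) -f0 => f0E.
have [s /andP[ys sx] [fs f0s]] := leb_ae_ex yx (aeI fq f0E).
have Is : I s.
  by split; [case: Iy => cy _; rewrite (lt_trans cy)|
    case: Ix => _ xd; rewrite (lt_trans _ xd)]; rewrite ?lte_fin.
move: (fs Is); rewrite f0s//= => /esym T0.
have : (z - x)%:E <= 0.
  rewrite -T0 -(leb_eitv (ltW xz)) -[leLHS]mul1e -leb_integral_cst//.
  have sI : eitv s%:E d `<=` I by exact: eitv_tail.
  have Js : eitv x%:E z%:E `<=` eitv s%:E d.
    move=> t [xt tz]; split; first by rewrite (lt_trans _ xt)// lte_fin.
    by rewrite (lt_trans tz)//; case: Iz.
  rewrite (leb_integral_support Js (f := _ \_ _)); last first.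
    by move=> t _ Jt; rewrite patchE memNset.
  by rewrite le_eqVlt; apply/orP; left; apply/eqP; apply: eq_leb_integral => t Jt;
    rewrite patchE mem_set.
by rewrite lee_fin subr_le0 leNgt xz.
Qed.

End test_elements.

(** * The gliding hump *)

Section series.
Context {R : realType} (D : set R) (f : nat -> R -> \bar R).

Lemma leb_measurable_nneseries : (forall n, leb_measurable D (f n)) ->
  (forall n x, D x -> 0 <= f n x) ->
  leb_measurable D (fun x => \sum_(0 <= n <oo) f n x).
Proof.
move=> mf f0; apply: (@ge0_emeasurable_sum _ (leb_line R)).
  by move=> n x Dx _; exact: f0.
by move=> n _; exact: mf.
Qed.

Lemma leb_integral_nneseries : leb_set D -> (forall n, leb_measurable D (f n)) ->
  (forall n x, D x -> 0 <= f n x) ->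
  \int[leb R]_(x in D) \sum_(0 <= n <oo) f n x =
  \sum_(0 <= n <oo) \int[leb R]_(x in D) f n x.
Proof. by move=> mD mf f0; exact: (@integral_nneseries _ (leb_line R) R (leb R) D mD f mf f0). Qed.

End series.

Section gliding_hump.
Context {R : realType} (c d : \bar R) (v w : R -> \bar R).
Local Notation mu := (leb R).
Local Notation I := (eitv c d).
Local Notation V := (mass c v).
Hypothesis hv : weight c d v.
Hypothesis hw : forall x, I x -> w x = (V x)^-1.
Implicit Types (k q : R -> \bar R) (f : L0 I).

Let mI : leb_set I. Proof. exact: leb_set_eitv. Qed.

(** By [density_duality], failure of the bound gives a density with
    [\int q * mass c k > 2^n \int V q]; it is scaled to make the
    first integral 1. *)
Lemma normalized_density k n : leb_measurable I k -> L1loc_left c d k ->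
  ~ {ae mu, forall x, I x -> mass c k x <= (2 ^+ n)%:E * V x} ->
  exists q, [/\ leb_measurable I q, forall x, 0 <= q x,
    \int[mu]_(t in I) (V t * q t) <= (1 / (2 ^ n)%:R)%:E &
    1 <= \int[mu]_(t in I) (q t * mass c k t)].
Proof.
move=> mk k1 kn; have mV := leb_measurable_mass hv.
have mK := leb_measurable_head (leb_measurable_abse mk).
have pn : (0 < 2 ^+ n :> R)%R by rewrite exprn_gt0.
apply: contrapT => noq; apply: kn; apply: (density_duality hv mK (ltW pn)).
move=> q bq; rewrite leNgt; apply/negP => qk; apply: noq.
have [mq [? [? [M [_ _ _ qM _]]]]] := bq.
have q0 x : 0 <= q x by case/andP: (qM x).
have Voo := bounded_density_mass hv bq.
have koo := bounded_density_pairing_lty mk k1 bq.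
have V0 : 0 <= \int[mu]_(t in I) (V t * q t).
  by apply: leb_integral_ge0 => t _; apply: mule_ge0 => //; exact: mass_ge0.
move: qk Voo koo V0.
have Vq a : (0 <= a)%R -> \int[mu]_(t in I) (V t * (a%:E * q t)) =
    a%:E * \int[mu]_(t in I) (V t * q t).
  move=> a0; rewrite -ge0_leb_integralZl//.
  - by apply: eq_leb_integral => t _; rewrite muleCA.
  - exact: leb_measurableM.
  - by move=> t _; apply: mule_ge0 => //; exact: mass_ge0.
have kq a : (0 <= a)%R -> \int[mu]_(t in I) (a%:E * q t * mass c k t) =
    a%:E * \int[mu]_(t in I) (q t * mass c k t).
  move=> a0; rewrite -ge0_leb_integralZl//.
  - by apply: eq_leb_integral => t _; rewrite muleA.
  - exact: leb_measurableM.
  - by move=> t _; apply: mule_ge0 => //; exact: leb_integral_abse_ge0.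
move: Vq kq.
case: (\int[mu]_(t in I) (q t * mass c k t)) => [j| |];
  case: (\int[mu]_(t in I) (V t * q t)) => [i| |] // Vq kq.
rewrite -EFinM !lte_fin lee_fin => ij _ _ i0.
have j0 : (0 < j)%R by apply: le_lt_trans ij; rewrite mulr_ge0// ltW.
have j1 : (0 <= j^-1)%R by rewrite invr_ge0 ltW.
(* [j] is finite because [q] is bounded and supported inside [I], and positive
   because it exceeds [2 ^ n * i] *)
exists (fun x => j^-1%:E * q x); split.
- by apply: leb_measurableM => //; exact: leb_measurable_cst.
- by move=> x; apply: mule_ge0.
- rewrite Vq// -EFinM lee_fin natrX ler_pdivlMr// -mulrA.
  by rewrite ler_pdivrMl// mulr1 mulrC ltW.
- by rewrite kq// -EFinM mulVf ?gt_eqF.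
Qed.

(** The densities of [normalized_density] are added up: the [V]-integrals form
    a convergent geometric series, while each term contributes at least 1 to
    the pairing with [|k|], so that the tail of the sum is in the space but
    not integrable against [k]. *)
Lemma gliding_hump k : leb_measurable I k -> L1loc_left c d k ->
  (forall f, W11 I v w f -> L1norm I (fun x => f x * k x) < +oo) ->
  exists n : nat, {ae mu, forall x, I x -> mass c k x <= (2 ^+ n)%:E * V x}.
Proof.
move=> mk k1 fk; apply: contrapT => nok.
have mV := leb_measurable_mass hv.
have mK := leb_measurable_head (leb_measurable_abse mk).
have /choice[q qP] : forall n, exists q, [/\ leb_measurable I q,
    forall x, 0 <= q x,
    \int[mu]_(t in I) (V t * q t) <= (1 / (2 ^ n.+1)%:R)%:E &
    1 <= \int[mu]_(t in I) (q t * mass c k t)].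
  by move=> n; apply: normalized_density => // nk; apply: nok; exists n.+1.
have q0 n x : 0 <= q n x by have [] := qP n.
have mq n : leb_measurable I (q n) by have [] := qP n.
pose Q x := \sum_(0 <= n <oo) q n x.
have Q0 x : 0 <= Q x by exact: nneseries_ge0.
have mQ : leb_measurable I Q.
  by apply: leb_measurable_nneseries => // n x _; exact: q0.
have VQ : \int[mu]_(t in I) (V t * Q t) <= 1.
  rewrite (_ : \int[mu]_(t in I) _ =
      \int[mu]_(t in I) \sum_(0 <= n <oo) (V t * q n t)); last first.
    apply: eq_leb_integral => t It; rewrite -(fineK (mass_fin_num hv It)).
    by rewrite nneseriesZl.
  rewrite leb_integral_nneseries; last 3 first.
  - exact: mI.
  - by move=> n; exact: leb_measurableM.
  - by move=> n t _; apply: mule_ge0 => //; exact: mass_ge0.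
  apply: (@le_trans _ _ (\sum_(0 <= n <oo) (0 + (1 / (2 ^ n.+1)%:R)%:E))).
    apply: lee_nneseries => n _.
      by move=> _; apply: leb_integral_ge0 => t _; apply: mule_ge0 => //; exact: mass_ge0.
    by rewrite add0e; have [] := qP n.
  apply: (le_trans (epsilon_trick _ _ _)) => //.
  by rewrite eseries0// add0e.
have KQ : \int[mu]_(t in I) (Q t * mass c k t) = +oo.
  rewrite (_ : \int[mu]_(t in I) _ =
      \int[mu]_(t in I) \sum_(0 <= n <oo) (q n t * mass c k t)); last first.
    apply: eq_leb_integral => t It; rewrite muleC.
    have Kt : mass c k t \is a fin_num.
      by rewrite ge0_fin_numE; [exact: (k1 t It)|exact: leb_integral_abse_ge0].
    rewrite -(fineK Kt) -nneseriesZl//.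
    by apply: eq_eseriesr => n _; rewrite muleC.
  rewrite leb_integral_nneseries; last 3 first.
  - exact: mI.
  - by move=> n; exact: leb_measurableM.
  - by move=> n t _; apply: mule_ge0 => //; exact: leb_integral_abse_ge0.
  apply: eq_infty => r; set s := Num.truncn `|r|.
  apply: (@le_trans _ _ (\sum_(0 <= n < s.+1) \int[mu]_(t in I) (q n t * mass c k t))).
    apply: (@le_trans _ _ (\sum_(0 <= n < s.+1) 1)).
      rewrite sumEFin lee_fin big_const_nat iter_addr addr0 subn0.
      by apply: (le_trans (ler_norm r)); rewrite -mulr_natl mulr1 ltW// truncnS_gt.
    by apply: lee_sum => n _; have [] := qP n.
  apply: nneseries_lim_ge => n _ _; apply: leb_integral_ge0 => t _.
  by apply: mule_ge0 => //; exact: leb_integral_abse_ge0.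
have [f fQ] := tail_class mQ.
have [Wf _] := tail_W11 hv hw mQ Q0 (le_lt_trans VQ (ltry 1)) fQ.
by have := fk f Wf; rewrite (pairing_abse mQ Q0 mk fQ) KQ ltxx.
Qed.

End gliding_hump.

(** * Boundedness of the absolutely continuous functions vanishing near the right endpoint *)

Section bounded_elements.
Context {R : realType} (c d : \bar R).
Local Notation I := (eitv c d).

(** Near [c] the limit bounds [f]. From there to a point [b] past the support,
    absolute continuity with tolerance 1 bounds [|f|] by the number of steps
    of length [dl / 2] needed to reach [b]. *)
Lemma AC_vanishing_bounded (f : R -> R) : AC_vanishing c d f ->
  exists b M : R, [/\ I b, (0 <= M)%R, forall x, I x -> (`|f x| <= M)%R &
    forall x, I x -> (b < x)%R -> f x = 0%R].
Proof.
move=> [fAC [l fl] [b0 Ib0 fb0]].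
have [_ [b Ib b0b]] := eitv_lt_ex Ib0.
have fb x : I x -> (b <= x)%R -> f x = 0%R.
  by move=> [_ xd] bx; apply: fb0; split => //; rewrite lte_fin (lt_le_trans b0b).
have [dl dl0 fdl] := fAC 1%R ltr01.
have step x y : I x -> I y -> (x <= y)%R -> (y - x < dl)%R -> (`|f y - f x| < 1)%R.
  move=> Ix Iy xy xydl.
  have := fdl 1%N (fun=> x) (fun=> y) (fun=> And3 Ix Iy xy).
  rewrite !big_ord_recl !big_ord0 !addr0; apply => //.
  by move=> i j _ _ _; rewrite !ord1.
(* the step is half of [dl] because [dl] itself is excluded by the strict
   inequality *)
have chain n x : I x -> (x <= b)%R -> (b - x < dl / 2 * n%:R)%R -> (`|f x| <= n%:R)%R.
  elim: n x => [|n IH] x Ix xb.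
    by rewrite mulr0 ltNge subr_ge0 xb.
  rewrite -(natr1 n) => bxn; have [bx|bx] := ltP (b - x)%R (dl / 2)%R.
    have dl2 : (dl / 2 < dl)%R by lra.
    have := step x b Ix Ib xb (lt_trans bx dl2).
    rewrite fb// sub0r normrN => /ltW/le_trans; apply.
    by rewrite lerDr.
  pose y := (x + dl / 2)%R.
  have xy : (x <= y)%R by rewrite lerDl; lra.
  have yb : (y <= b)%R by rewrite /y; lra.
  have Iy : I y.
    case: Ix Ib => cx _ [_ bd]; split.
      by apply: lt_le_trans cx _; rewrite lee_fin.
    by apply: le_lt_trans bd; rewrite lee_fin.
  have byn : (b - y < dl / 2 * n%:R)%R by rewrite /y; lra.
  have yx : (y - x < dl)%R by rewrite /y; lra.
  have := step x y Ix Iy xy yx; have := IH y Iy yb byn.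
  rewrite distrC => fy fyx; rewrite -(subrK (f y) (f x)).
  by rewrite (le_trans (ler_normD _ _))// addrC lerD// ltW.
have near_c : exists2 a, I a & forall x, I x -> (x <= a)%R -> (`|f x| <= `|l| + 1)%R.
  have fl1 : \forall x \near ereal_at_right c, (`|f x| <= `|l| + 1)%R.
    have Fc : Filter (ereal_at_right c) by case: c => [r| |] /=; exact: _.
    have : \forall x \near ereal_at_right c, (`|l - f x| < 1)%R.
      by move/cvgrPdist_lt : fl; apply.
    apply: filterS => x flx; rewrite -(subrK l (f x)) (le_trans (ler_normD _ _))//.
    by rewrite addrC lerD2l distrC ltW.
  have [[y Iy _] _] := eitv_lt_ex Ib.
  have Idn s t : I t -> (s <= t)%R -> c < s%:E -> I s.
    by move=> [_ td] st cs; split => //; apply: le_lt_trans td; rewrite lee_fin.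
  move: Iy Idn fl1 {fAC fl Ib0 fb0 Ib fb fdl step chain}.
  case: c => [r| |] [cy yd] Idn; rewrite /ereal_at_right.
  - move=> [e /= e0 fe]; rewrite lte_fin in cy.
    pose a := Order.min y (r + e / 2)%R.
    have ra : (r < a)%R by rewrite lt_min cy ltrDl divr_gt0.
    have ay : (a <= y)%R by rewrite ge_min lexx.
    exists a; first by apply: (Idn _ y) => //; rewrite lte_fin.
    move=> x [rx xd] xa; apply: fe => //=; rewrite lte_fin in rx.
    have : (a <= r + e / 2)%R by rewrite ge_min lexx orbT.
    by rewrite distrC gtr0_norm ?subr_gt0//; lra.
  - by rewrite ltNge leey in cy.
  - move=> [B [_ fB]]; exists (Order.min y (B - 1))%R.
      by apply: (Idn _ y) => //; [rewrite ge_min lexx|rewrite ltNyr].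
    move=> x Ix; rewrite le_min => /andP[_ xB]; apply: fB.
    by apply: le_lt_trans xB _; rewrite ltrBlDr ltrDl.
have [a Ia fa] := near_c.
have [n an] : exists n : nat, (b - a < dl / 2 * n%:R)%R.
  exists (Num.truncn `|(b - a) / (dl / 2)|%R).+1.
  rewrite mulrC -ltr_pdivrMr ?divr_gt0//.
  by apply: (le_lt_trans (ler_norm _)); rewrite truncnS_gt.
exists b, (`|l| + 1 + n%:R)%R; split => //.
- move=> x Ix; have [xa|ax] := leP x a.
    by rewrite (le_trans (fa x Ix xa))// lerDl.
  have [bx|xb] := leP b x; first by rewrite fb// normr0 !addr_ge0.
  rewrite (le_trans (chain n x Ix (ltW xb) _))//; last by rewrite lerDr addr_ge0.
  by apply: lt_trans an; rewrite ltrD2l ltrN2.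
- by move=> x Ix /ltW; exact: fb.
Qed.

End bounded_elements.

(** * Associate norms as best constants *)

Section quotients.
Context {R : realType}.
Implicit Types (x N a b : \bar R) (C : R).

(** The conventions [x / +oo = 0] and [0 / 0 = 0 * +oo = 0] make
    the inequality hold in the degenerate cases as well. *)
Lemma quotient_le x N C : (0 <= C)%R -> 0 <= x -> 0 <= N ->
  (N < +oo -> x <= C%:E * N) -> x / N <= C%:E.
Proof.
move=> C0; case: N => [r| |] // x0 r0 xC.
- move: r0; rewrite lee_fin le_eqVlt => /predU1P[r0|r0].
    move: (xC (ltry _)); rewrite -r0 mule0 => x1.
    by rewrite (_ : x = 0) ?mul0e ?lee_fin//; apply/eqP; rewrite eq_le x0 x1.
  by rewrite inver gt_eqF// lee_pdivrMr// xC// ltry.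
- by rewrite invey mule0 lee_fin.
Qed.

Lemma le_quotient x N C : 0 <= x -> 0 <= N -> N < +oo -> x / N <= C%:E ->
  x <= C%:E * N.
Proof.
case: N => [r| |] // x0; rewrite lee_fin le_eqVlt => /predU1P[<-|r0] _.
  rewrite inve0; move: x0; rewrite le_eqVlt => /predU1P[<-|x0].
    by rewrite mule0.
  by rewrite gt0_muley.
by rewrite inver gt_eqF// lee_pdivrMr.
Qed.

(** Extended numbers are compared through their finite upper bounds, which is
    the form in which the dualities are proved. *)
Lemma equiv_norms_of_bounds a b : 0 <= a -> 0 <= b ->
  (forall C, (0 <= C)%R -> b <= C%:E -> a <= C%:E) ->
  (forall C, (0 <= C)%R -> a <= C%:E -> b <= (2 * C)%:E) ->
  1%:E * a <= b /\ b <= 2%:E * a.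
Proof.
move=> a0 b0 ba ab; rewrite mul1e; split.
  case: b b0 ba {ab} => [r| |] // r0 ba; last by rewrite leey.
  by apply: ba; rewrite // -lee_fin.
case: a a0 ab {ba} => [r| |] // r0 ab.
  by rewrite -EFinM; apply: ab; rewrite // -lee_fin.
by rewrite gt0_muley ?leey// lte_fin.
Qed.

Lemma lty_bound a : 0 <= a -> a < +oo -> exists2 C, (0 <= C)%R & a = C%:E.
Proof. by case: a => [r| |] // r0 _; exists r. Qed.

End quotients.

Section associate_norms.
Context {R : realType} (I : set R) (Z : set (L0 I)) (N P : L0 I -> \bar R).
Hypothesis N0 : forall h, 0 <= N h.
Hypothesis P0 : forall h, 0 <= P h.
Hypothesis Pzero : P (L0_cst I 0) = 0.
Hypothesis Znz : exists2 h, Z h & h <> L0_cst I 0.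
Local Notation S := (ereal_sup [set P h / N h | h in Z `\ L0_cst I 0]).

Lemma quotient_sup_ge0 : 0 <= S.
Proof.
have [h Zh h0] := Znz; apply: (@le_trans _ _ (P h / N h)).
  by apply: mule_ge0 => //; rewrite inve_ge0.
by apply: ereal_sup_ubound; exists h.
Qed.

(** The zero class, left out of the supremum, satisfies the inequality anyway;
    elements of infinite norm contribute a quotient 0. *)
Lemma quotient_sup_le (C : R) : (0 <= C)%R -> S <= C%:E <->
  forall h, Z h -> N h < +oo -> P h <= C%:E * N h.
Proof.
move=> C0; split => [SC h Zh Nh|PN].
  have [->|h0] := pselect (h = L0_cst I 0).
    by rewrite Pzero mule_ge0// lee_fin.
  apply: le_quotient => //; apply: le_trans SC.
  by apply: ereal_sup_ubound; exists h.
apply: ge_ereal_sup => _ [h [Zh _] <-].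
by apply: quotient_le => // Nh; exact: PN.
Qed.

End associate_norms.

(** * The norms of Cs and Ch as best constants *)

Section cesaro_norms.
Context {R : realType} (c d : \bar R) (v w : R -> \bar R).
Local Notation mu := (leb R).
Local Notation I := (eitv c d).
Local Notation V := (mass c v).
Hypothesis hv : weight c d v.
Hypothesis hw : forall x, I x -> w x = (V x)^-1.

Lemma weight_gt0 x : I x -> 0 < w x.
Proof.
move=> Ix; rewrite hw//; have := mass_gt0 hv Ix.
rewrite -(fineK (mass_fin_num hv Ix)) lte_fin => V0.
by rewrite inver gt_eqF// lte_fin invr_gt0.
Qed.

(** An almost sure property holds at some point because the line has positive
    measure. *)
Lemma ess_sup_ge0 (f : R -> \bar R) : (forall x, 0 <= f x) -> 0 <= ess_sup mu f.
Proof.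
move=> f0; have [x _ fx] := leb_ae_ex (@ltr01 R) (ess_sup_ge mu f).
exact: le_trans fx.
Qed.

Lemma weighted_ess_sup_le (h : R -> \bar R) (C : R) : (0 <= C)%R ->
  (forall x, 0 <= h x) ->
  ess_sup mu ((fun x => w x * h x) \_ I) <= C%:E <->
  {ae mu, forall x, I x -> h x <= C%:E * V x}.
Proof.
move=> C0 h0.
have wh x : I x -> (w x * h x <= C%:E) = (h x <= C%:E * V x).
  move=> Ix; rewrite hw//; have := mass_gt0 hv Ix.
  rewrite -(fineK (mass_fin_num hv Ix)) lte_fin => V0.
  by rewrite inver gt_eqF// muleC lee_pdivrMr.
split => [/ess_supP|hC].
  by apply: aeS => x; rewrite patchE => wx Ix; move: wx; rewrite mem_set// wh.
apply/ess_supP; apply: aeS hC => x hx; rewrite patchE.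
by case: ifPn => [/set_mem Ix|_]; [rewrite wh//; exact: hx|rewrite lee_fin].
Qed.

Lemma Cs_norm_le (C : R) k : (0 <= C)%R -> Cs_norm c d w k <= C%:E <->
  {ae mu, forall x, I x -> mass c k x <= C%:E * V x}.
Proof.
by move=> C0; apply: weighted_ess_sup_le => // x; exact: leb_integral_abse_ge0.
Qed.

Lemma Ch_normE k : Ch_norm c d w k =
  ess_sup mu ((fun x => w x * `|\int[mu]_(t in eitv c x%:E) k t|) \_ I).
Proof.
rewrite /Ch_norm; congr (ess_sup _ _); apply/funext => x; rewrite !patchE.
case: ifPn => [/set_mem Ix|//].
by rewrite abseM gee0_abs// ltW// weight_gt0.
Qed.

Lemma Ch_norm_le (C : R) k : (0 <= C)%R -> Ch_norm c d w k <= C%:E <->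
  {ae mu, forall x, I x ->
    `|\int[mu]_(t in eitv c x%:E) k t| <= C%:E * V x}.
Proof. by move=> C0; rewrite Ch_normE; apply: weighted_ess_sup_le. Qed.

Lemma Cs_norm_ge0 k : 0 <= Cs_norm c d w k.
Proof.
apply: ess_sup_ge0 => x; rewrite patchE; case: ifPn => [/set_mem Ix|//].
by apply: mule_ge0; [exact/ltW/weight_gt0|exact: leb_integral_abse_ge0].
Qed.

Lemma Ch_norm_ge0 k : 0 <= Ch_norm c d w k.
Proof. by apply: ess_sup_ge0 => x; rewrite patchE; case: ifPn. Qed.

Lemma Ch_norm_le_Cs (C : R) k : leb_measurable I k -> (0 <= C)%R ->
  Cs_norm c d w k <= C%:E -> Ch_norm c d w k <= C%:E.
Proof.
move=> mk C0 /Cs_norm_le kC; apply/Ch_norm_le => //.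
apply: aeS (kC C0) => x kx Ix; apply: le_trans (kx Ix).
apply: le_abse_leb_integral; first exact: leb_set_eitv.
exact: (leb_measurableS (leb_set_eitv _ _) (eitv_head Ix)).
Qed.

End cesaro_norms.

(** * The three dualities *)

Section duality.
Context {R : realType} (c d : \bar R) (v w : R -> \bar R).
Local Notation mu := (leb R).
Local Notation I := (eitv c d).
Local Notation V := (mass c v).
Local Notation W := (W11 I v w).
Local Notation NW := (W11norm I v w).
Local Notation piX := (L0_image I (AC_vanishing c d)).
Hypothesis hv : weight c d v.
Hypothesis hw : forall x, I x -> w x = (V x)^-1.
Implicit Types g f : L0 I.

Let mI : leb_set I. Proof. exact: leb_set_eitv. Qed.
Let mL g : leb_measurable I g. Proof. exact: L0_measurable. Qed.
Let N0 f : 0 <= NW f. Proof. exact: W11norm_ge0. Qed.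

Lemma zero_ae : {ae mu, forall x, I x -> L0_cst I 0 x = 0}.
Proof. exact: L0_piE. Qed.

Lemma zero_pairing_abse g : L1norm I (fun x => L0_cst I 0 x * g x) = 0.
Proof.
rewrite -[RHS](@integral0 _ (leb_line R) _ mu I); apply: ae_eq_leb_integral.
- exact: mI.
- by apply/leb_measurable_abse/leb_measurableM; exact: mL.
- exact: leb_measurable_cst.
- by apply: aeS zero_ae => x zx Ix; rewrite zx// mul0e abse0.
Qed.

Lemma zero_pairing g : `|\int[mu]_(x in I) (L0_cst I 0 x * g x)| = 0.
Proof.
have mz : leb_measurable I (fun x => L0_cst I 0 x * g x).
  by apply: leb_measurableM; exact: mL.
apply/eqP; rewrite eq_le abse_ge0 andbT.
apply: le_trans (le_abse_leb_integral mI mz) _.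
by rewrite [leLHS](zero_pairing_abse g).
Qed.

Let Wnz : exists2 h, W h & h <> L0_cst I 0.
Proof. by have [f [_ Wf f0]] := test_element_neq0 hv hw; exists f. Qed.

Let Xnz : exists2 h, piX h & h <> L0_cst I 0.
Proof. by have [f [Xf _ f0]] := test_element_neq0 hv hw; exists f. Qed.

Lemma strong_norm_ge0 g : 0 <= strong_assoc_norm W NW g.
Proof. by apply: quotient_sup_ge0 => // h; exact: leb_integral_abse_ge0. Qed.

Lemma weak_norm_ge0 (Z : set (L0 I)) g :
  (exists2 h, Z h & h <> L0_cst I 0) -> 0 <= weak_assoc_norm Z NW g.
Proof. by move=> Znz; apply: quotient_sup_ge0. Qed.

Lemma strong_norm_le (C : R) g : (0 <= C)%R ->
  strong_assoc_norm W NW g <= C%:E <->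
  forall h, W h -> NW h < +oo -> L1norm I (fun x => h x * g x) <= C%:E * NW h.
Proof.
move=> C0; apply: quotient_sup_le => //.
- by move=> h; exact: leb_integral_abse_ge0.
- exact: zero_pairing_abse.
Qed.

Lemma weak_norm_le (Z : set (L0 I)) (C : R) g : (0 <= C)%R ->
  weak_assoc_norm Z NW g <= C%:E <->
  forall h, Z h -> NW h < +oo ->
    `|\int[mu]_(x in I) (h x * g x)| <= C%:E * NW h.
Proof.
move=> C0; apply: quotient_sup_le => //.
exact: zero_pairing.
Qed.

Lemma strong_norm_le_Cs (C : R) g : (0 <= C)%R ->
  Cs_norm c d w g <= C%:E -> strong_assoc_norm W NW g <= C%:E.
Proof.
move=> C0 /(Cs_norm_le hv hw _ C0) gC; apply/strong_norm_le => // h _ Nh.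
exact: (strong_upper hv hw).
Qed.

Lemma Cs_norm_le_strong (C : R) g : (0 <= C)%R ->
  strong_assoc_norm W NW g <= C%:E ->
  Cs_norm c d w g <= (2 * C)%:E /\ L1loc_left c d g.
Proof.
move=> C0 /(strong_norm_le _ C0) gC; have C2 : (0 <= 2 * C)%R by exact: mulr_ge0.
have gV : {ae mu, forall x, I x -> mass c g x <= (2 * C)%:E * V x}.
  apply: (strong_lower hv hw) => // f _ Wf; apply: gC => //.
  by case: Wf.
by split; [exact/(Cs_norm_le hv hw _ C2)|exact: (ae_mass_L1loc_left hv _ gV)].
Qed.

Lemma weak_norm_le_Ch (C : R) g : Cs c d w g -> (0 <= C)%R ->
  Ch_norm c d w g <= C%:E -> weak_assoc_norm W NW g <= C%:E.
Proof.
move=> [g1 goo] C0 /(Ch_norm_le hv hw _ C0) gC; apply/weak_norm_le => // h _ Nh.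
have [C' C'0 gE] := lty_bound (Cs_norm_ge0 hv hw g) goo.
have /(Cs_norm_le hv hw _ C'0) gC' : Cs_norm c d w g <= C'%:E by rewrite gE.
exact: (weak_upper hv hw _ g1 C0 C'0).
Qed.

(** Stated for any space [Z] that contains the test elements, so that it
    serves both weak associated spaces. *)
Lemma Ch_norm_le_weak (Z : set (L0 I)) (C : R) g :
  (forall f, piX f -> W f -> Z f) ->
  (forall f, Z f -> L1norm I (fun x => f x * g x) < +oo) ->
  (0 <= C)%R -> weak_assoc_norm Z NW g <= C%:E ->
  Ch_norm c d w g <= (2 * C)%:E.
Proof.
move=> XWZ goo C0 /(weak_norm_le _ _ C0) gC.
apply/(Ch_norm_le hv hw); first exact: mulr_ge0.
have g1 : L1loc_left c d g.
  apply: (test_pairing_L1loc_left hv hw) => // f Xf Wf.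
  by apply: goo; exact: XWZ.
apply: (weak_lower hv hw) => // f Xf Wf.
  by apply: goo; exact: XWZ.
by apply: gC; [exact: XWZ|case: Wf].
Qed.

Lemma vanishing_class_bounded f : piX f -> exists b M : R, [/\ I b, (0 <= M)%R,
  {ae mu, forall x, I x -> `|f x| <= M%:E} &
  {ae mu, forall x, I x -> (b < x)%R -> f x = 0}].
Proof.
move=> [f0 /AC_vanishing_bounded[b [M [Ib M0 fM fb]]] ff0].
exists b, M; split => //; apply: aeS ff0 => x fx Ix.
  by rewrite -fx//= lee_fin fM.
by move=> bx; rewrite -fx//= fb.
Qed.

Lemma strong_assocE : strong_assoc W NW = Cs c d w.
Proof.
apply/seteqP; split => g.
  move=> /(lty_bound (strong_norm_ge0 g))[C C0 gE].
  have gC : strong_assoc_norm W NW g <= C%:E by rewrite gE.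
  have [g2 g1] := Cs_norm_le_strong C0 gC.
  by split => //; apply: le_lt_trans g2 _; rewrite ltry.
move=> [_ /(lty_bound (Cs_norm_ge0 hv hw g))[C C0 gE]].
apply: (@le_lt_trans _ _ C%:E); last by rewrite ltry.
by apply: strong_norm_le_Cs; rewrite ?gE.
Qed.

Lemma weak_assocE : weak_assoc W NW = Cs c d w.
Proof.
apply/seteqP; split => g.
  move=> [goo _].
  have g1 : L1loc_left c d g.
    by apply: (test_pairing_L1loc_left hv hw) => // f _; exact: goo.
  have [n gn] := gliding_hump hv hw (@mL g) g1 goo.
  split => //; apply: (@le_lt_trans _ _ (2 ^+ n)%:E); last by rewrite ltry.
  by apply/(Cs_norm_le hv hw) => //; exact: exprn_ge0.
move=> Csg; have [g1 goo] := Csg.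
have [C C0 gE] := lty_bound (Cs_norm_ge0 hv hw g) goo.
have gC : Cs_norm c d w g <= C%:E by rewrite gE.
split; last first.
  apply: (@le_lt_trans _ _ C%:E); last by rewrite ltry.
  by apply: weak_norm_le_Ch => //; exact: (Ch_norm_le_Cs hv hw (@mL g) C0 gC).
move=> f Wf; have Nf : NW f < +oo by case: Wf.
move: gC => /(Cs_norm_le hv hw _ C0) gC.
apply: le_lt_trans (strong_upper hv hw (@mL g) C0 gC Nf) _.
by move: (N0 f) Nf; case: (NW f) => // r _ _; rewrite -EFinM ltry.
Qed.

Lemma weak_vanishing_norm_le_Ch (C : R) g : L1loc_left c d g -> (0 <= C)%R ->
  Ch_norm c d w g <= C%:E -> weak_assoc_norm piX NW g <= C%:E.
Proof.
move=> g1 C0 /(Ch_norm_le hv hw _ C0) gC; apply/weak_norm_le => // h Xh Nh.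
have [b [M [Ib M0 hM hb]]] := vanishing_class_bounded Xh.
exact: (vanishing_upper hv hw _ g1 C0 M0 Ib hM hb gC Nh).
Qed.

Lemma weak_vanishing_assocE : weak_assoc piX NW = Ch c d w.
Proof.
apply/seteqP; split => g.
  move=> [goo /(lty_bound (weak_norm_ge0 g Xnz))[C C0 gE]].
  have gC : weak_assoc_norm piX NW g <= C%:E by rewrite gE.
  split.
    by apply: (test_pairing_L1loc_left hv hw) => // f Xf _; exact: goo.
  apply: le_lt_trans (Ch_norm_le_weak (fun f Xf _ => Xf) goo C0 gC) _.
  by rewrite ltry.
move=> [g1 /(lty_bound (Ch_norm_ge0 c d w g))[C C0 gE]].
have gC : Ch_norm c d w g <= C%:E by rewrite gE.
split; last first.
  apply: le_lt_trans (weak_vanishing_norm_le_Ch g1 C0 gC) _.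
  by rewrite ltry.
move=> f Xf; have [b [M [Ib M0 fM fb]]] := vanishing_class_bounded Xf.
apply: le_lt_trans (bounded_pairing_le (@mL g) g1 M0 Ib fM fb) _.
have gb : mass c g b \is a fin_num.
  by rewrite ge0_fin_numE; [exact: (g1 b Ib)|exact: leb_integral_abse_ge0].
by rewrite -(fineK gb) -EFinM ltry.
Qed.

End duality.

Theorem theorem2p2 (R : realType) :
  exists k1 k2 : R, [/\ (0 < k1)%R, (0 < k2)%R &
  forall (c d : \bar R) (v w : R -> \bar R),
  c < d ->
  leb_measurable (eitv c d) v ->
  {ae leb R, forall x, eitv c d x -> 0 < v x} ->
  L1loc_left c d v ->
  \int[leb R]_(t in eitv c b%:E) v t @[b --> ereal_at_left d] --> +oo ->
  (forall x, eitv c d x -> w x = (\int[leb R]_(t in eitv c x%:E) v t)^-1) ->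
  let I := eitv c d in
  let W := W11 I v w in
  let NW := W11norm I v w in
  let piX := L0_image I (AC_vanishing c d) in
  [/\ strong_assoc W NW = Cs c d w /\
      equiv_norms k1 k2 (Cs c d w) (strong_assoc_norm W NW) (Cs_norm c d w),
      weak_assoc W NW = Cs c d w /\
      equiv_norms k1 k2 (Cs c d w) (weak_assoc_norm W NW) (Ch_norm c d w) &
      weak_assoc piX NW = Ch c d w /\
      equiv_norms k1 k2 (Ch c d w) (weak_assoc_norm piX NW) (Ch_norm c d w)]].
Proof.
exists 1%R, 2%R; split => // c d v w cd mv v0 v1 voo w' I W NW piX.
have hv : weight c d v by [].
have hw x : eitv c d x -> w x = (mass c v x)^-1.
  by move=> Ix; rewrite w'// (massE hv Ix).
have [f [Xf Wf f0]] := test_element_neq0 hv hw.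
have Wnz : exists2 h, W h & h <> L0_cst I 0 by exists f.
have Xnz : exists2 h, piX h & h <> L0_cst I 0 by exists f.
have sE := strong_assocE hv hw; have wE := weak_assocE hv hw.
have xE := weak_vanishing_assocE hv hw.
split; split => // g.
- move=> _; apply: equiv_norms_of_bounds.
  + exact: (strong_norm_ge0 hv hw).
  + exact: (Cs_norm_ge0 hv hw).
  + by move=> C; exact: (strong_norm_le_Cs hv hw).
  + by move=> C C0 /(Cs_norm_le_strong hv hw C0)[].
- move=> Csg; have : weak_assoc W NW g by rewrite wE.
  move=> [goo _]; apply: equiv_norms_of_bounds.
  + exact: weak_norm_ge0.
  + exact: Ch_norm_ge0.
  + by move=> C; exact: (weak_norm_le_Ch hv hw).
  + by move=> C; apply: (Ch_norm_le_weak hv hw) goo => f' _.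
- move=> Chg; have : weak_assoc piX NW g by rewrite xE.
  move=> [goo _]; have [g1 _] := Chg; apply: equiv_norms_of_bounds.
  + exact: weak_norm_ge0.
  + exact: Ch_norm_ge0.
  + by move=> C; exact: (weak_vanishing_norm_le_Ch hv hw).
  + by move=> C; apply: (Ch_norm_le_weak hv hw) goo => f'.
Qed.
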